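(* Let $X^{\mathbb{R}}\subseteq\mathbb{P}^n_{\mathbb{R}}$ be a real projective variety and let $X=\overline{X^{\mathbb{R}}}\subseteq\mathbb{P}^n$ be its Zariski closure in complex projective space. Let $q$ be a positive-definite quadratic form on $\mathbb{R}^{n+1}$, $\omega$ a positive integer, and $q_{\mathrm{BW}}$ the Bombieri-Weyl quadratic form associated to $q$ and $\omega$. Let $Q_{\mathrm{BW}}$ be the quadric hypersurface in $\mathbb{P}(\mathbb{C}[x_0,\ldots,x_n]_\omega)$ cut out by $q_{\mathrm{BW}}$. Then $$\mathrm{RRdeg}_\omega(X)=\mathrm{DD}(\nu_\omega(X),Q_{\mathrm{BW}}).$$
   Context: $\mathbb{K}[x]_\omega$ is the space of homogeneous polynomials of degree $\omega$ in $x_0,\ldots,x_n$ over $\mathbb{K}$, where $x_0,\ldots,x_n$ are the coordinates dual to a basis of $\mathbb{R}^{n+1}$ orthonormal for the inner product $\langle\,,\rangle$ associated with $q$. The Bombieri-Weyl quadratic form $q_{\mathrm{BW}}$ on $\mathbb{R}[x]_\omega$ (extended to $\mathbb{C}[x]_\omega$) is that of the inner product for which the polynomials $\left(\frac{\omega!}{\alpha_0!\cdots\alpha_n!}\right)^{1/2}x^\alpha$, $|\alpha|=\omega$, are an orthonormal basis. The Veronese map is $\nu_\omega\colon\mathbb{P}^n\to\mathbb{P}(\mathbb{C}[x]_\omega)$, $[\psi]\mapsto[(\psi_0x_0+\cdots+\psi_nx_n)^\omega]$. $C(Z)$ denotes the affine cone over a projective variety $Z$, and $S_q=\{x\in\mathbb{C}^{n+1}:q(x)=1\}$.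 For an affine variety $Y$ and a polynomial function $g$, $\mathrm{Crit}(g,Y)$ is the set of nonsingular points $y$ of $Y$ at which the differential of $g|_Y$ vanishes on $T_yY$. An $X$-eigenpoint of a homogeneous polynomial $f$ is a class $[\psi]\in\mathbb{P}^n$ with $\psi\in\mathrm{Crit}(f,C(X)\cap S_q)$. The Rayleigh-Ritz degree $\mathrm{RRdeg}_\omega(X)$ (of index $\omega$, with respect to $q$) is the number of $X$-eigenpoints of a generic $f\in\mathbb{C}[x]_\omega$. Distance degree: let $W$ be a complex vector space with a nondegenerate quadratic form $p$ (with associated bilinear form), $P\subseteq\mathbb{P}(W)$ the quadric $p=0$, and $Z\subseteq\mathbb{P}(W)$ a projective variety not contained in $P$. Then $\mathrm{DD}(Z,P)$ is the cardinality of $\mathrm{Crit}(p(\cdot-u),C(Z))$ for generic $u\in W$. *)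

(* Defs.v *)
From HB Require Import structures.
From mathcomp Require Import all_boot all_order all_algebra.
From mathcomp Require Import boolp classical_sets cardinality reals.
From mathcomp Require Import complex mpoly.

Set Implicit Arguments.
Unset Strict Implicit.
Unset Printing Implicit Defensive.

Import GRing.Theory.

Local Open Scope ring_scope.
Local Open Scope classical_set_scope.

(* Naive (classical) algebraic geometry inside a finite-dimensional vector
   space W over an infinite field K.  Closed sets are sets of K-points. *)
Section Affine.
Variables (K : fieldType) (W : vectType K).
Implicit Types (g : W -> K) (w y v : W) (A Y Z : set W) (d : nat).

(* The choice of the basis [vbasis fullv] is immaterial: polynomial functions
   and homogeneous polynomial functions are invariant under linear changes of
   coordinates. *)
Definition coordinates w : 'I_(\dim {:W}) -> K :=
  fun i => coord (vbasis {:W}) i w.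

Definition polynomial_function g : Prop :=
  exists h : {mpoly K[\dim {:W}]}, forall w, g w = h.@[coordinates w].

Definition homogeneous_function d g : Prop :=
  exists2 h : {mpoly K[\dim {:W}]}, h \is d.-homog &
    forall w, g w = h.@[coordinates w].

Definition zariski_closed A : Prop :=
  exists2 S : set (W -> K), S `<=` polynomial_function &
    A = [set w | forall g, S g -> g w = 0].

(* P holds on a nonempty Zariski-open subset of W. *)
Definition generic (P : set W) : Prop :=
  exists A, [/\ zariski_closed A, A != setT & ~` A `<=` P].

Definition irreducible Z : Prop :=
  [/\ zariski_closed Z, Z !=set0 &
      forall A B, zariski_closed A -> zariski_closed B ->
        Z `<=` A `|` B -> Z `<=` A \/ Z `<=` B].

Definition alg_independent_on Z d (g : 'I_d -> W -> K) : Prop :=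
  (forall i, polynomial_function (g i)) /\
  (forall P : {mpoly K[d]}, (forall w, Z w -> P.@[fun i => g i w] = 0) -> P = 0).

(* For Z irreducible: the transcendence degree of the coordinate ring of Z. *)
Definition has_dim Z d : Prop :=
  (exists g : 'I_d -> W -> K, alg_independent_on Z g) /\
  (forall d' (g : 'I_d' -> W -> K), alg_independent_on Z g -> (d' <= d)%N).

(* The largest dimension of an irreducible closed subset of Y through y. *)
Definition has_local_dim Y y d : Prop :=
  (exists Z, [/\ irreducible Z, Z `<=` Y, Z y & has_dim Z d]) /\
  (forall Z d', irreducible Z -> Z `<=` Y -> Z y -> has_dim Z d' -> (d' <= d)%N).

(* The differential at y of the polynomial function g takes the value l on v:
   l is the linear coefficient of the univariate polynomial t |-> g (y + t v),
   which is unique since K is infinite. *)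
Definition differential g y v (l : K) : Prop :=
  exists2 r : {poly K}, (forall t, g (y + t *: v) = r.[t]) & r^`().[0] = l.

Definition tangent_space Y y : set W :=
  [set v | forall g, polynomial_function g -> (forall w, Y w -> g w = 0) ->
             differential g y v 0].

Definition nonsingular Y y : Prop :=
  Y y /\ exists d (T : {vspace W}),
    [/\ has_local_dim Y y d,
        forall v, tangent_space Y y v <-> v \in T & \dim T = d].

Definition Crit g Y : set W :=
  [set y | nonsingular Y y /\
           forall v, tangent_space Y y v -> differential g y v 0].

(* The cardinality of S w for generic w (and 0 should there be none). *)
Definition generic_card (T : Type) (S : W -> set T) : nat :=
  xget 0%N [set d | generic [set w | (S w #= `I_d)%card]].

End Affine.

Section Projective.
Variables (K : fieldType) (W : vectType K).

(* Points of P(W) are the lines of W; [val L = <[w]>%VS] says L = [w]. *)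
Definition projective_space := {L : {vspace W} | \dim L == 1%N}.

Definition projective_variety (Z : set projective_space) : Prop :=
  exists2 S : set (W -> K),
    S `<=` [set g | exists d, homogeneous_function d g] &
    Z = [set L : projective_space |
           forall g, S g -> forall w, w \in val L -> g w = 0].

Definition zariski_closure (Z : set projective_space) : set projective_space :=
  \bigcap_(Y in [set Y | projective_variety Y /\ Z `<=` Y]) Y.

Definition affine_cone (Z : set projective_space) : set W :=
  [set w | exists2 L, Z L & w \in val L].

(* The distance degree DD(Z, P), where P is the quadric p = 0; rescaling the
   equation p of P does not change the critical points. *)
Definition DD (Z : set projective_space) (p : W -> K) : nat :=
  generic_card (fun u => Crit (fun w => p (w - u)) (affine_cone Z)).

End Projective.

Section RayleighRitz.
Variables (K : fieldType) (n omega : nat).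
Let V := 'rV[K]_n.+1.
Implicit Types (A E : 'M[K]_n.+1) (psi : V) (X : set (projective_space V)).

(* The quadratic form with Gram matrix A in the standard basis. *)
Definition qform A psi : K := (psi *m A *m psi^T) 0 0.

(* The coordinates x_0, ..., x_n dual to the basis given by the rows of E. *)
Definition xcoord E psi : 'I_n.+1 -> K := fun i => (psi *m invmx E) 0 i.

Definition affine_quadric A : set V := [set psi | qform A psi = 1].

Definition eigenpoint A E X (f : dhomog n.+1 K omega) :
    set (projective_space V) :=
  [set L : projective_space V | exists2 psi, val L = <[psi]>%VS &
     Crit (fun phi => (f : {mpoly K[n.+1]}).@[xcoord E phi])
          (affine_cone X `&` affine_quadric A) psi].

Definition RRdeg A E X : nat :=
  generic_card (fun f : dhomog n.+1 K omega => eigenpoint A E X f).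

Lemma veronese_homog E psi :
  (\sum_i xcoord E psi i *: 'X_i) ^+ omega \is [in K[n.+1], omega.-homog].
Proof.
rewrite -[X in X.-homog]mul1n; apply: dhomogMn; apply: rpred_sum => i _.
by apply: dhomogZ; rewrite dhomogX; apply/eqP/mdeg1.
Qed.

Definition veronese E psi : dhomog n.+1 K omega := DHomog (veronese_homog E psi).

Definition veronese_image E X : set (projective_space (dhomog n.+1 K omega)) :=
  [set M : projective_space (dhomog n.+1 K omega) |
     exists L, X L /\
       exists2 psi, val L = <[psi]>%VS & val M = <[veronese E psi]>%VS].

End RayleighRitz.

Section RealComplex.
Variables (R : realType) (n : nat).

Definition complexify m (A : 'M[R]_(m, n.+1)) : 'M[R[i]]_(m, n.+1) :=
  map_mx (real_complex R) A.

Definition complex_points (X : set (projective_space 'rV[R]_n.+1)) :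
    set (projective_space 'rV[R[i]]_n.+1) :=
  [set L : projective_space _ |
     exists M, X M /\
       exists2 v, val M = <[v]>%VS & val L = <[complexify v]>%VS].

(* The alpha-coordinate of f in the Bombieri-Weyl orthonormal basis
   (omega! / (alpha_0! ... alpha_n!))^(1/2) x^alpha. *)
Definition bw_coord omega (alpha : 'X_{1..n.+1})
    (f : dhomog n.+1 R[i] omega) : R[i] :=
  (f : {mpoly R[i][n.+1]})@_alpha /
  (Num.sqrt (omega`!%:R / (\prod_i (alpha i)`!)%:R : R))%:C%C.

(* Sum of squares, not of squared moduli: the quadratic form on C[x]_omega is
   the extension by scalars of the real one. *)
Definition q_BW omega (f : dhomog n.+1 R[i] omega) : R[i] :=
  \sum_(alpha : 'X_{1..n.+1 < omega.+1} | mdeg alpha == omega)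
     bw_coord alpha f ^+ 2.

End RealComplex.

(* Main.v *)
Require Import Defs.
From HB Require Import structures.
From mathcomp Require Import all_boot all_order all_algebra.
From mathcomp Require Import boolp classical_sets cardinality filter functions reals.
From mathcomp Require Import complex mpoly ring zify ring_quotient generic_quotient.

Set Implicit Arguments.
Unset Strict Implicit.
Unset Printing Implicit Defensive.

Import Order.TTheory GRing.Theory Num.Theory.

Local Open Scope ring_scope.
Local Open Scope classical_set_scope.

(** Write [q] for the quadratic form, [C] for the affine cone over [X], [Y] for its
   section by [q = 1], [nu] for the Veronese map and [N] for the cone over the
   Veronese image, which is [nu(C)] as scalars have [omega]-th roots.  The pairing
   of the Bombieri-Weyl form satisfies [<f, nu(x)> = f(x)], a consequence of the
   multinomial theorem.  Differentiating this identity shows that [w = nu(x)] is a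
   critical point of the distance from [f] on [N] exactly when [x] is a nonsingular
   point of [C] and
     [D f (x) v = omega q(x)^(omega - 1) <x, v>]  for all [v] tangent to [C] at [x]
   ([critical_veronese]).  A unit vector [y] of [C] is an eigenvector of [f] when
   it is a nonsingular point of [Y] at which [D f] vanishes on the tangent vectors of
   [C] orthogonal to [y].  Splitting tangent vectors of [C] into a multiple of [y]
   and an orthogonal part, and applying Euler's relation to the former, one sees
   that the two conditions correspond to each other under [y |-> f(y) nu(y)]
   ([critical_correspondence]).  This is a bijection between the eigenpoints of
   [f] and its critical points ([eigenpoint_card]), except for the forms [f] which
   vanish at some eigenvector or for which some critical point is isotropic or the
   origin.

   Both the exclusion of these forms and the comparison of nonsingular points rest
   on the same fact, [generic_tangent]: on a set [T] on which [g_1, ..., g_d] are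
   algebraically independent there is a point where their differentials are linearly
   independent on the common kernel of any finitely many differentials of functions
   vanishing on [T].  It follows from the extension of derivations
   in characteristic 0, applied to a generic point of [T] with coordinates in an
   ultrapower of the base field.

   For the exceptional forms this gives a Bertini theorem
   ([generic_transversality]): if [f] could be chosen generic, the relation
   [f(x) = 0] could be differentiated in every direction [l] of the space of
   forms, and since [D f] vanishes on the velocity of [x] this would give
   [l(x) = 0] for every [l].

   For nonsingular points it shows that the dimension of an irreducible closed set
   is the smallest dimension of its tangent spaces.  Hence [y] is nonsingular on
   [Y] when some irreducible closed subset through [y] has tangent spaces which are
   all at least as large as that of [Y] at [y] ([nonsingular_irreducible],
   [nonsingular_dense]), and nonsingularity can be transported along maps by
   comparing tangent spaces: between [C] and [N] along the Veronese map and the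
   polar maps, which invert it up to a scalar ([nonsingular_veronese]), and between
   [C] and [Y] along radial projection ([nonsingular_cone],
   [nonsingular_unit_section]). *)

(** * Polynomial functions and their differentials *)

Section PolynomialFunctions.
Variables (K : numFieldType) (W : vectType K).
Implicit Types (g : W -> K) (y v w : W).

Lemma polynomial_function_ind (P : (W -> K) -> Prop) :
    (forall c, P (fun _ => c)) ->
    (forall i, P (coord (vbasis {:W}) i)) ->
    (forall g1 g2, P g1 -> P g2 -> P (fun w => g1 w + g2 w)) ->
    (forall g1 g2, P g1 -> P g2 -> P (fun w => g1 w * g2 w)) ->
  forall g, polynomial_function g -> P g.
Proof.
move=> Pc Px PD PM g [h hE].
rewrite (funext hE : g = _) {hE}; elim/mpolyind: h => [|c m p _ _ IHp].
  by rewrite (_ : (fun w => _) = fun=> 0) //; apply/funext => w; rewrite meval0.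
suff PX : P (fun w => 'X_[m].@[coordinates w]).
  rewrite (_ : (fun w => _) = fun w =>
    (fun w => c * ('X_[m]).@[coordinates w]) w + p.@[coordinates w]); last first.
    by apply/funext => w; rewrite mevalD mevalZ.
  by apply: (PD (fun w => c * _)) => //; apply: (PM (fun=> c)).
rewrite (_ : (fun w => _) = fun w => \prod_i coordinates w i ^+ m i); last first.
  by apply/funext => w; rewrite mevalX.
have Pexp i : forall k, P (fun w => coordinates w i ^+ k).
  elim=> [|k IHk]; first exact: (Pc 1).
  by under eq_fun do rewrite exprS; apply: PM => //; apply: Px.
elim: (index_enum _) => [|i s IHs].
  by under eq_fun do rewrite big_nil; apply: Pc.
by under eq_fun do rewrite big_cons; apply: PM.
Qed.

Lemma polynomial_function_cst c : polynomial_function (fun _ : W => c).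
Proof. by exists c%:MP => w; rewrite mevalC. Qed.

Lemma polynomial_function_coord i : polynomial_function (coord (vbasis {:W}) i).
Proof. by exists 'X_i => w; rewrite mevalXU. Qed.

Lemma polynomial_functionD g1 g2 : polynomial_function g1 ->
  polynomial_function g2 -> polynomial_function (fun w => g1 w + g2 w).
Proof. by move=> [h1 e1] [h2 e2]; exists (h1 + h2) => w; rewrite mevalD e1 e2. Qed.

Lemma polynomial_functionM g1 g2 : polynomial_function g1 ->
  polynomial_function g2 -> polynomial_function (fun w => g1 w * g2 w).
Proof. by move=> [h1 e1] [h2 e2]; exists (h1 * h2) => w; rewrite mevalM e1 e2. Qed.

Lemma polynomial_functionZ c g : polynomial_function g ->
  polynomial_function (fun w => c * g w).
Proof. by move=> hg; apply: polynomial_functionM => //; apply: polynomial_function_cst. Qed.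

Lemma polynomial_functionN g : polynomial_function g ->
  polynomial_function (fun w => - g w).
Proof.
by move=> /(polynomial_functionZ (-1)); under eq_fun do rewrite mulN1r.
Qed.

Lemma polynomial_functionB g1 g2 : polynomial_function g1 ->
  polynomial_function g2 -> polynomial_function (fun w => g1 w - g2 w).
Proof. by move=> h1 /polynomial_functionN; apply: polynomial_functionD. Qed.

Lemma polynomial_functionX g k : polynomial_function g ->
  polynomial_function (fun w => g w ^+ k).
Proof.
move=> hg; elim: k => [|k IHk].
  by under eq_fun do rewrite expr0; apply: polynomial_function_cst.
by under eq_fun do rewrite exprS; apply: polynomial_functionM.
Qed.

Lemma polynomial_function_sum (I : Type) (r : seq I) (P : pred I) (g : I -> W -> K) :
  (forall i, polynomial_function (g i)) ->
  polynomial_function (fun w => \sum_(i <- r | P i) g i w).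
Proof.
move=> hg; elim: r => [|i r IHr].
  by under eq_fun do rewrite big_nil; apply: polynomial_function_cst.
under eq_fun do rewrite big_cons; case: (P i) => //.
exact: polynomial_functionD.
Qed.

Lemma polynomial_function_prod (I : Type) (r : seq I) (P : pred I) (g : I -> W -> K) :
  (forall i, polynomial_function (g i)) ->
  polynomial_function (fun w => \prod_(i <- r | P i) g i w).
Proof.
move=> hg; elim: r => [|i r IHr].
  by under eq_fun do rewrite big_nil; apply: polynomial_function_cst.
under eq_fun do rewrite big_cons; case: (P i) => //.
exact: polynomial_functionM.
Qed.

Lemma polynomial_function_meval d (P : {mpoly K[d]}) (g : 'I_d -> W -> K) :
  (forall i, polynomial_function (g i)) ->
  polynomial_function (fun w => P.@[fun i => g i w]).
Proof.
move=> hg; under eq_fun do rewrite mevalE.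
apply: polynomial_function_sum => m; apply: polynomial_functionZ.
by apply: polynomial_function_prod => i; apply: polynomial_functionX.
Qed.

Lemma scalar_sum (l : W -> K) : scalar l ->
  forall (I : Type) (r : seq I) (P : pred I) (c : I -> K) (u : I -> W),
  l (\sum_(i <- r | P i) c i *: u i) = \sum_(i <- r | P i) c i * l (u i).
Proof.
move=> hl I r P c u; elim: r => [|i r IHr].
  by rewrite !big_nil; have := hl (-1) 0 0; rewrite scaler0 addr0 mulN1r addNr.
by rewrite !big_cons; case: (P i) => //; rewrite hl IHr.
Qed.

Lemma scalar_coord (l : W -> K) : scalar l ->
  l = fun w => \sum_(i < \dim {:W}) l (vbasis {:W})`_i * coord (vbasis {:W}) i w.
Proof.
move=> hl; apply/funext => w; rewrite {1}(coord_vbasis (memvf w)) scalar_sum //.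
by apply: eq_bigr => i _; rewrite mulrC.
Qed.

Lemma polynomial_function_scalar (l : W -> K) :
  scalar l -> polynomial_function l.
Proof.
move=> hl; rewrite (scalar_coord hl).
apply: polynomial_function_sum => i; apply: polynomial_functionZ.
exact: polynomial_function_coord.
Qed.

(** A nonzero polynomial has finitely many roots, and [K] is infinite. *)
Lemma poly_eq0_fun (r : {poly K}) : (forall t, r.[t] = 0) -> r = 0.
Proof.
move=> r0; apply: contrapT => /eqP rN0.
have := @max_poly_roots _ r [seq i%:R | i <- iota 0 (size r)] rN0.
rewrite size_map size_iota ltnn => H; suff: false by []; apply: H.
  by apply/allP => x _; rewrite /root r0.
by rewrite map_inj_uniq ?iota_uniq // => i j /eqP; rewrite eqr_nat => /eqP.
Qed.

Definition directional g y v : K := xget 0 [set l | differential g y v l].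

Local Notation D := directional.

Lemma directionalE g y v l : differential g y v l -> D g y v = l.
Proof.
move=> [r hr <-]; rewrite /D; case: xgetP => [_ -> [r' hr' <-]|/(_ r^`().[0])]; last first.
  by case; exists r.
have /eqP : r' - r = 0.
  by apply: poly_eq0_fun => t; rewrite hornerD hornerN -hr -hr' subrr.
by rewrite subr_eq0 => /eqP ->.
Qed.

Lemma directional_curve g y v (r : {poly K}) :
  (forall t, g (y + t *: v) = r.[t]) -> D g y v = r^`().[0].
Proof. by move=> hr; apply: directionalE; exists r. Qed.

Lemma polynomial_function_curve g : polynomial_function g ->
  forall y v, exists r : {poly K}, forall t, g (y + t *: v) = r.[t].
Proof.
move: g; apply: polynomial_function_ind => [c|i|g1 g2 IH1 IH2|g1 g2 IH1 IH2] y v.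
- by exists c%:P => t; rewrite hornerC.
- exists ((coord (vbasis {:W}) i y)%:P + coord (vbasis {:W}) i v *: 'X) => t.
  by rewrite linearD linearZ /= !hornerE mulrC.
- have [[r1 e1] [r2 e2]] := (IH1 y v, IH2 y v).
  by exists (r1 + r2) => t; rewrite hornerD e1 e2.
- have [[r1 e1] [r2 e2]] := (IH1 y v, IH2 y v).
  by exists (r1 * r2) => t; rewrite hornerM e1 e2.
Qed.

Lemma differentialP g y v l : polynomial_function g ->
  differential g y v l <-> D g y v = l.
Proof.
move=> hg; split=> [/directionalE //|<-].
have [r hr] := polynomial_function_curve hg y v.
by exists r => //; rewrite (directional_curve hr).
Qed.

Lemma directional_cst c y v : D (fun _ => c) y v = 0.
Proof.
by rewrite (@directional_curve _ _ _ c%:P) ?derivC ?horner0// => t; rewrite hornerC.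
Qed.

Lemma directionalD g1 g2 y v : polynomial_function g1 -> polynomial_function g2 ->
  D (fun w => g1 w + g2 w) y v = D g1 y v + D g2 y v.
Proof.
move=> h1 h2; have [r1 e1] := polynomial_function_curve h1 y v.
have [r2 e2] := polynomial_function_curve h2 y v.
rewrite (directional_curve e1) (directional_curve e2).
rewrite (@directional_curve _ _ _ (r1 + r2)) ?derivD ?hornerD // => t.
by rewrite hornerD e1 e2.
Qed.

Lemma directionalM g1 g2 y v : polynomial_function g1 -> polynomial_function g2 ->
  D (fun w => g1 w * g2 w) y v = D g1 y v * g2 y + g1 y * D g2 y v.
Proof.
move=> h1 h2; have [r1 e1] := polynomial_function_curve h1 y v.
have [r2 e2] := polynomial_function_curve h2 y v.
rewrite (directional_curve e1) (directional_curve e2).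
rewrite (@directional_curve _ _ _ (r1 * r2)); last by move=> t; rewrite hornerM e1 e2.
rewrite derivM hornerD !hornerM.
by rewrite -e1 -e2 scale0r addr0.
Qed.

Lemma directionalZ c g y v : polynomial_function g ->
  D (fun w => c * g w) y v = c * D g y v.
Proof.
move=> hg; rewrite directionalM ?directional_cst ?mul0r ?add0r //.
exact: polynomial_function_cst.
Qed.

Lemma directionalB g1 g2 y v : polynomial_function g1 -> polynomial_function g2 ->
  D (fun w => g1 w - g2 w) y v = D g1 y v - D g2 y v.
Proof.
move=> h1 h2; rewrite -mulN1r -directionalZ // -directionalD //; last exact: polynomial_functionZ.
by congr D; apply/funext => w; rewrite mulN1r.
Qed.

Lemma directional_scalar (l : W -> K) y v : scalar l -> D l y v = l v.
Proof.
move=> hl; rewrite (@directional_curve _ _ _ ((l y)%:P + l v *: 'X)).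
  by rewrite derivD derivC derivZ derivX !hornerE.
by move=> t; rewrite addrC hl addrC !hornerE mulrC.
Qed.

Lemma directionalX k g y v : polynomial_function g ->
  D (fun w => g w ^+ k) y v = k%:R * g y ^+ k.-1 * D g y v.
Proof.
move=> hg; have [r e] := polynomial_function_curve hg y v.
rewrite (directional_curve e) (@directional_curve _ _ _ (r ^+ k)).
  by rewrite deriv_exp hornerMn hornerM horner_exp -e scale0r addr0 -mulr_natl; ring.
by move=> t; rewrite horner_exp e.
Qed.

Lemma directional_sum (I : Type) (r : seq I) (g : I -> W -> K) y v :
  (forall i, polynomial_function (g i)) ->
  D (fun w => \sum_(i <- r) g i w) y v = \sum_(i <- r) D (g i) y v.
Proof.
move=> hg; elim: r => [|i r IHr].
  by under eq_fun do rewrite big_nil; rewrite big_nil directional_cst.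
under eq_fun do rewrite big_cons.
by rewrite big_cons directionalD ?IHr //; apply: polynomial_function_sum.
Qed.

Lemma coord_scalar i : scalar (coord (vbasis {:W}) i).
Proof. by move=> a u v; rewrite linearP. Qed.

Lemma polynomial_function_rect (P : (W -> K) -> Prop) :
    (forall c, P (fun _ => c)) ->
    (forall l, scalar l -> P l) ->
    (forall g1 g2, polynomial_function g1 -> polynomial_function g2 ->
      P g1 -> P g2 -> P (fun w => g1 w + g2 w)) ->
    (forall g1 g2, polynomial_function g1 -> polynomial_function g2 ->
      P g1 -> P g2 -> P (fun w => g1 w * g2 w)) ->
  forall g, polynomial_function g -> P g.
Proof.
move=> Pc Px PD PM g hg.
suff [] : polynomial_function g /\ P g by [].
move: g hg; apply: polynomial_function_ind => [c|i|g1 g2|g1 g2].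
- by split; [apply: polynomial_function_cst|apply: Pc].
- by split; [apply: polynomial_function_coord|apply/Px/coord_scalar].
- by move=> [? ?] [? ?]; split; [apply: polynomial_functionD|apply: PD].
- by move=> [? ?] [? ?]; split; [apply: polynomial_functionM|apply: PM].
Qed.

Lemma directional_linear g y : polynomial_function g -> scalar (D g y).
Proof.
move: g; apply: polynomial_function_rect => [c|l hl|g1 g2 h1 h2 I1 I2|g1 g2 h1 h2 I1 I2] a u v.
- by rewrite !directional_cst mulr0 addr0.
- by rewrite !directional_scalar // hl.
- by rewrite !directionalD // I1 I2; ring.
- by rewrite !directionalM // I1 I2; ring.
Qed.

Lemma directional0 g y : polynomial_function g -> D g y 0 = 0.
Proof.
move=> hg; have := directional_linear y hg (-1) 0 0.
by rewrite scaler0 addr0 mulN1r addNr.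
Qed.

Lemma directional_scale g y a v : polynomial_function g -> D g y (a *: v) = a * D g y v.
Proof.
by move=> hg; have := directional_linear y hg a v 0; rewrite addr0 directional0 // addr0.
Qed.

Lemma directional_add g y u v : polynomial_function g -> D g y (u + v) = D g y u + D g y v.
Proof.
by move=> hg; have := directional_linear y hg 1 u v; rewrite scale1r mul1r.
Qed.

Lemma polynomial_function_directional g v : polynomial_function g ->
  polynomial_function (fun y => D g y v).
Proof.
move: g; apply: polynomial_function_rect => [c|l hl|g1 g2 h1 h2 I1 I2|g1 g2 h1 h2 I1 I2].
- by under eq_fun do rewrite directional_cst; apply: polynomial_function_cst.
- by under eq_fun do rewrite directional_scalar //; apply: polynomial_function_cst.
- by under eq_fun do rewrite directionalD //; apply: polynomial_functionD.
- under eq_fun do rewrite directionalM //.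
  by apply: polynomial_functionD; apply: polynomial_functionM.
Qed.

Lemma directional_meval d (P : {mpoly K[d]}) (g : 'I_d -> W -> K) y v :
  (forall i, polynomial_function (g i)) ->
  D (fun w => P.@[fun i => g i w]) y v =
  \sum_i P^`M(i).@[fun j => g j y] * D (g i) y v.
Proof.
move=> hg; elim/mpolyind: P => [|c m p _ _ IHp].
  under eq_fun do rewrite meval0.
  by rewrite directional_cst big1 // => i _; rewrite mderiv0 meval0 mul0r.
under eq_fun do rewrite mevalD mevalZ.
rewrite directionalD ?IHp ?directionalZ; try by
  [apply: polynomial_function_meval|apply: polynomial_functionZ; apply: polynomial_function_meval].
suff -> : D (fun w => 'X_[m].@[g^~ w]) y v =
  \sum_i ('X_[m])^`M(i).@[g^~ y] * D (g i) y v.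
  rewrite big_distrr -big_split /=; apply: eq_bigr => i _.
  by rewrite mderivD mderivZ mevalD mevalZ; ring.
rewrite {IHp} mpolyXE_id.
suff H s : D (fun w => (\prod_(i <- s) 'X_i ^+ m i).@[g^~ w]) y v =
    \sum_i (\prod_(i <- s) 'X_i ^+ m i)^`M(i).@[g^~ y] * D (g i) y v by exact: H.
elim: s => [|i s IHs].
  under eq_fun do rewrite big_nil meval1.
  by rewrite big_nil directional_cst big1 // => i _; rewrite -mpolyC1 mderivC meval0 mul0r.
under eq_fun do rewrite big_cons mevalM rmorphXn /= mevalXU.
rewrite directionalM ?directionalX ?IHs; try by
  [|apply: polynomial_functionX|apply: polynomial_function_meval].
rewrite big_cons.
under [RHS]eq_bigr do rewrite mderivM mevalD !mevalM mulrDl.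
rewrite big_split /=; congr (_ + _); last first.
  rewrite big_distrr /=; apply: eq_bigr => j _.
  by rewrite rmorphXn /= mevalXU mulrA.
rewrite (bigD1 i) //= [X in _ = _ + X]big1 ?addr0.
  rewrite mpolyXn mderivX mulmnE mnm1E eqxx mul1n mevalZ.
  rewrite (_ : (U_(i) *+ m i - U_(i) = U_(i) *+ (m i).-1)%MM); last first.
    apply/mnmP => j; rewrite mnmBE !mulmnE mnm1E.
    by case: (i == j); rewrite ?mul1n ?mul0n ?subn1.
  by rewrite -mpolyXn rmorphXn /= mevalXU; ring.
move=> j jNi; rewrite mpolyXn mderivX mulmnE mnm1E eq_sym (negPf jNi) mul0n.
by rewrite scale0r meval0 !mul0r.
Qed.

End PolynomialFunctions.

Section ZariskiClosure.
Variables (K : numFieldType) (W : vectType K).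
Implicit Types (g : W -> K) (A B Z : set W).

Definition vanishes_on Z g : Prop := forall w, Z w -> g w = 0.

Definition affine_closure Z : set W :=
  [set w | forall g, polynomial_function g -> vanishes_on Z g -> g w = 0].

Lemma sub_affine_closure Z : Z `<=` affine_closure Z.
Proof. by move=> w Zw g _; apply. Qed.

Lemma affine_closure_closed Z : zariski_closed (affine_closure Z).
Proof.
exists [set g | polynomial_function g /\ vanishes_on Z g]; first by move=> g [].
apply/seteqP; split=> w /= h g; first by case; apply: h.
by move=> pg gZ; apply: h.
Qed.

Lemma affine_closure_min Z A : zariski_closed A -> Z `<=` A -> affine_closure Z `<=` A.
Proof.
move=> [S Spf ->] ZS w wZ g Sg; apply: wZ; first exact: Spf.
by move=> z /ZS; apply.
Qed.

Lemma zariski_closed_zero g : polynomial_function g ->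
  zariski_closed [set w | g w = 0].
Proof.
move=> pg; exists [set g]; first by move=> _ ->.
by apply/seteqP; split=> [w /= gw _ ->|w /=] //; apply.
Qed.

Lemma zariski_closed_bigcap (I : Type) (P : set I) (F : I -> set W) :
  (forall i, P i -> zariski_closed (F i)) -> zariski_closed (\bigcap_(i in P) F i).
Proof.
move=> hF; suff -> : \bigcap_(i in P) F i = affine_closure (\bigcap_(i in P) F i).
  exact: affine_closure_closed.
apply/seteqP; split; first exact: sub_affine_closure.
move=> w hw i Pi; apply: (affine_closure_min (hF i Pi)) hw.
exact: bigcap_inf.
Qed.

Lemma zariski_closedI A B : zariski_closed A -> zariski_closed B ->
  zariski_closed (A `&` B).
Proof.
move=> hA hB; rewrite -bigcap2E; apply: zariski_closed_bigcap => -[|[|i]] _ //=.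
by exists set0 => //; apply/seteqP; split=> // w _ g [].
Qed.

Lemma zariski_closedU A B : zariski_closed A -> zariski_closed B ->
  zariski_closed (A `|` B).
Proof.
move=> [S Spf ->] [T Tpf ->].
exists [set g | exists g1 g2, [/\ S g1, T g2 & g = fun w => g1 w * g2 w]].
  by move=> _ [g1 [g2 [/Spf h1 /Tpf h2 ->]]]; apply: polynomial_functionM.
apply/seteqP; split=> w /=.
  case=> h _ [g1 [g2 [S1 T2 ->]]]; first by rewrite h // mul0r.
  by rewrite (h _ T2) mulr0.
move=> h; have [hS|/existsNP[g1 /not_implyP[S1 /eqP g1w]]] :=
  pselect (forall g, S g -> g w = 0); first by left.
right=> g2 T2; have /eqP := h _ (ex_intro _ g1 (ex_intro _ g2 (And3 S1 T2 erefl))).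
by rewrite mulf_eq0 (negPf g1w) => /eqP.
Qed.

Lemma irreducible_prime Z g1 g2 : irreducible Z ->
  polynomial_function g1 -> polynomial_function g2 ->
  vanishes_on Z (fun w => g1 w * g2 w) -> vanishes_on Z g1 \/ vanishes_on Z g2.
Proof.
move=> [_ _ Zirr] h1 h2 h12.
apply: Zirr; [exact: zariski_closed_zero|exact: zariski_closed_zero|].
by move=> w /h12/eqP; rewrite mulf_eq0 => /orP[]/eqP; [left|right].
Qed.

(** Irreducible sets can thus be built as closures of images or of dense
   subsets, without knowing equations for them. *)
Lemma irreducible_affine_closure (S : set W) : S !=set0 ->
  (forall g1 g2, polynomial_function g1 -> polynomial_function g2 ->
    vanishes_on S (fun w => g1 w * g2 w) -> vanishes_on S g1 \/ vanishes_on S g2) ->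
  irreducible (affine_closure S).
Proof.
move=> [s Ss] Sprime; split; first exact: affine_closure_closed.
  by exists s; apply: sub_affine_closure.
move=> A B clA clB SAB.
suff [SA|SB] : S `<=` A \/ S `<=` B.
- by left; apply: affine_closure_min.
- by right; apply: affine_closure_min.
case: clA clB SAB => [P Ppf ->] [Q Qpf ->] SAB.
have [|/existsNP[a /not_implyP[Sa /existsNP[g1 /not_implyP[P1 g1a]]]]] :=
  pselect (S `<=` [set w | forall g, P g -> g w = 0]); first by left.
right=> b Sb g2 Q2.
have [w Sw|/(_ _ Sa)//|] := Sprime g1 g2 (Ppf _ P1) (Qpf _ Q2); last exact.
have [/= /(_ _ P1)->|/= /(_ _ Q2)->] := SAB w (sub_affine_closure Sw).
- by rewrite mul0r.
- by rewrite mulr0.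
Qed.

Lemma tangent_spaceP Y y v : tangent_space Y y v <->
  forall g, polynomial_function g -> vanishes_on Y g -> directional g y v = 0.
Proof.
split=> h g pg gY; first exact/differentialP/h.
by apply/(differentialP _ _ _ pg); apply: h.
Qed.

End ZariskiClosure.

Section PolynomialMaps.
Variables (K : numFieldType) (W1 W2 : vectType K).
Implicit Types (F : W1 -> W2) (y v : W1).

Definition polynomial_map F : Prop := forall g : W2 -> K,
  polynomial_function g -> polynomial_function (fun w => g (F w)).

Lemma polynomial_map_scalar F : (forall l : W2 -> K, scalar l ->
  polynomial_function (fun w => l (F w))) -> polynomial_map F.
Proof.
move=> hF; apply: polynomial_function_rect => [c|l hl|g1 g2 h1 h2 I1 I2|g1 g2 h1 h2 I1 I2].
- exact: polynomial_function_cst.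
- exact: hF.
- exact: polynomial_functionD.
- exact: polynomial_functionM.
Qed.

Lemma polynomial_map_linear F : linear F -> polynomial_map F.
Proof.
move=> lF; apply: polynomial_map_scalar => l hl.
by apply: polynomial_function_scalar => a u v; rewrite lF hl.
Qed.

Definition tangent_map F y v : W2 :=
  \sum_i directional (fun w => coord (vbasis {:W2}) i (F w)) y v *: (vbasis {:W2})`_i.

Lemma scalar_tangent_map F y v (l : W2 -> K) : polynomial_map F -> scalar l ->
  l (tangent_map F y v) = directional (fun w => l (F w)) y v.
Proof.
move=> pF hl; rewrite /tangent_map scalar_sum //.
rewrite [in RHS](scalar_coord hl) directional_sum; last first.
  move=> i; apply: polynomial_functionZ; apply: pF.
  exact: polynomial_function_coord.
apply: eq_bigr => i _; rewrite directionalZ 1?mulrC //.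
by apply: pF; apply: polynomial_function_coord.
Qed.

Lemma tangent_map_linear F y : polynomial_map F -> linear (tangent_map F y).
Proof.
move=> pF a u v; rewrite /tangent_map scaler_sumr -big_split /=.
apply: eq_bigr => i _; rewrite directional_linear ?scalerDl ?scalerA //.
by apply: pF; apply: polynomial_function_coord.
Qed.

Lemma chain_rule F g y v : polynomial_map F -> polynomial_function g ->
  directional (fun w => g (F w)) y v = directional g (F y) (tangent_map F y v).
Proof.
move=> pF; move: g.
apply: polynomial_function_rect => [c|l hl|g1 g2 h1 h2 I1 I2|g1 g2 h1 h2 I1 I2].
- by rewrite !directional_cst.
- by rewrite (directional_scalar _ _ hl) (scalar_tangent_map _ _ pF hl).
- by rewrite (directionalD _ _ (pF _ h1) (pF _ h2)) directionalD // I1 I2.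
- by rewrite (directionalM _ _ (pF _ h1) (pF _ h2)) directionalM // I1 I2.
Qed.

Lemma tangent_map_of_linear F y v : linear F -> tangent_map F y v = F v.
Proof.
move=> lF; rewrite [RHS](coord_vbasis (memvf _)); apply: eq_bigr => i _.
rewrite directional_scalar // => a u w; rewrite lF; exact: linearP.
Qed.

Lemma zariski_closed_preimage F (A : set W2) : polynomial_map F ->
  zariski_closed A -> zariski_closed (F @^-1` A).
Proof.
move=> pF [S Spf ->]; exists [set h | exists2 g, S g & h = fun w => g (F w)].
  by move=> _ [g /Spf pg ->]; apply: pF.
apply/seteqP; split=> w /= h; first by move=> _ [g Sg ->]; apply: h.
by move=> g Sg; apply: (h (fun w => g (F w))); exists g.
Qed.

Lemma zariski_closed_eq F G : polynomial_map F -> polynomial_map G ->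
  zariski_closed [set w | F w = G w].
Proof.
move=> pF pG; rewrite (_ : [set w | _] = \bigcap_(i in setT) [set w |
    coord (vbasis {:W2}) i (F w) - coord (vbasis {:W2}) i (G w) = 0]).
  apply: zariski_closed_bigcap => i _; apply: zariski_closed_zero.
  by apply: polynomial_functionB; [apply: pF|apply: pG]; apply: polynomial_function_coord.
apply/seteqP; split=> [w /= h i _ /=|w /= h]; first by rewrite h subrr.
rewrite (coord_vbasis (memvf (F w))) (coord_vbasis (memvf (G w))).
by apply: eq_bigr => i _; congr (_ *: _); apply/eqP; rewrite -subr_eq0; apply/eqP/(h i).
Qed.

Lemma tangent_map_tangent F (Y1 : set W1) (Y2 : set W2) y v :
  polynomial_map F -> (forall w, Y1 w -> Y2 (F w)) ->
  tangent_space Y1 y v -> tangent_space Y2 (F y) (tangent_map F y v).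
Proof.
move=> pF F12 /tangent_spaceP hv; apply/tangent_spaceP => g pg gY.
rewrite -chain_rule //; apply: hv; first exact: pF.
by move=> w /F12/gY.
Qed.

End PolynomialMaps.

(** * Finite generation of the ideal of a set *)

Section FiniteGeneration.

(** Dickson's lemma, by induction on the number [k] of exponents which are
   compared.  Elements whose next exponent is at least the largest one among the
   generators found for [k] are already covered; the others fall into finitely
   many slices, on which that exponent is constant. *)
Lemma dickson (k : nat) (S : set (nat -> nat)) : exists s : seq (nat -> nat),
  (forall f, List.In f s -> S f) /\
  forall f, S f -> exists2 f', List.In f' s & forall i, (i < k)%N -> (f' i <= f i)%N.
Proof.
elim: k S => [|k IHk] S.
  have [->|/set0P[f Sf]] := eqVneq S set0; first by exists [::].
  exists [:: f]; split=> [_ [<-|] //|f' Sf']; by exists f => //; left.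
have [s [sS hs]] := IHk S.
pose M := (\max_(f <- s) f k)%N.
have /choice[t ht] (j : nat) : exists u : seq (nat -> nat),
    (forall f, List.In f u -> S f /\ f k = j) /\
    forall f, S f -> f k = j ->
      exists2 f', List.In f' u & forall i, (i < k)%N -> (f' i <= f i)%N.
  have [u [uS hu]] := IHk [set f | S f /\ f k = j].
  by exists u; split=> // f Sf fk; apply: hu.
exists (s ++ flatten [seq t j | j <- iota 0 M]); split=> [f|f Sf].
  case/(@List.in_app_or _ _ _ _) => [/sS //|].
  elim: (iota 0 M) => //= j r IHr fjr.
  by case: (List.in_app_or _ _ _ fjr) => // /(ht j).1[].
have [Mf|fM] := leqP M (f k).
  have [f' f's hf'] := hs f Sf.
  exists f'; first by apply: List.in_or_app; left.
  move=> i; rewrite ltnS leq_eqVlt => /orP[/eqP->|/hf' //].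
  apply: leq_trans Mf; rewrite /M {hs sS M t ht Sf hf'}.
  elim: s f's => //= g s IHs; rewrite big_cons leq_max => -[->|/IHs->]; first by rewrite leqnn.
  by rewrite orbT.
have [f' f't hf'] := (ht (f k)).2 f Sf erefl.
exists f'.
  apply: List.in_or_app; right.
  have : f k \in iota 0 M by rewrite mem_iota.
  elim: (iota 0 M) => //= j r IHr; rewrite inE.
  by move=> /orP[/eqP <-|/IHr h]; apply: List.in_or_app; [left|right].
move=> i; rewrite ltnS leq_eqVlt => /orP[/eqP->|/hf' //].
by rewrite ((ht (f k)).1 _ f't).2.
Qed.

(** Hilbert's basis theorem: polynomials whose leading monomials generate, in the
   sense of Dickson's lemma, all the leading monomials of [I] generate [I] by
   division.  Quantifying over the ideals [J] avoids cofactors. *)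
Lemma hilbert_basis (K : fieldType) n (I : set {mpoly K[n]}) :
  (forall p q, I p -> I q -> I (p - q)) -> (forall p q, I p -> I (q * p)) ->
  exists s : seq {mpoly K[n]}, (forall p, p \in s -> I p) /\
    forall J : set {mpoly K[n]},
      J 0 -> (forall p q, J p -> J q -> J (p + q)) -> (forall p q, J p -> J (q * p)) ->
      (forall p, p \in s -> J p) -> I `<=` J.
Proof.
move=> IB IM.
pose e (m : 'X_{1..n}) (i : nat) := (nth 0%N m i).
have eE m (i : 'I_n) : e m i = m i by rewrite /e (mnm_nth 0%N).
have [s [sS hs]] := dickson n [set f | exists p, [/\ I p, p != 0 & f = e (mlead p)]].
have [t [tI ht]] : exists t : seq {mpoly K[n]}, (forall p, p \in t -> I p /\ p != 0) /\
    forall f, List.In f s -> exists2 p, p \in t & f = e (mlead p).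
  elim: s sS {hs} => [|f s IHs] sS; first by exists [::].
  have [t [tI ht]] := IHs (fun f fs => sS f (or_intror fs)).
  have [p [Ip pN0 fE]] := sS f (or_introl erefl).
  exists (p :: t); split=> [q|g]; first by rewrite inE => /orP[/eqP->|/tI].
  case=> [<-|/ht[q qt ->]]; first by exists p; rewrite ?mem_head.
  by exists q; rewrite // inE qt orbT.
exists t; split=> [p /tI[]//|J J0 JD JM Jt p].
move: {1}(mlead p) (erefl (mlead p)) => m.
elim/(well_founded_ind (@ltom_wf n)): m p => m IH p mE Ip.
have [->//|pN0] := eqVneq p 0.
have [f fs hf] := hs (e (mlead p)) (ex_intro _ p (And3 Ip pN0 erefl)).
have [q qt fE] := ht f fs; have [Iq qN0] := tI q qt.
have qp : (mlead q <= mlead p)%MM.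
  by apply/mnm_lepP => i; rewrite -!eE -fE hf.
pose r := ((mleadc p / mleadc q) *: 'X_[mlead p - mlead q]) * q.
have c0 : mleadc p / mleadc q != 0.
  by rewrite mulf_neq0 ?invr_eq0 ?mleadc_eq0.
have Xn0 : 'X_[K, mlead p - mlead q] != 0 by rewrite -msize_poly_eq0 msizeX.
have rN0 : (mleadc p / mleadc q) *: 'X_[mlead p - mlead q] != 0.
  by rewrite scaler_eq0 negb_or c0.
have mr : mlead r = mlead p.
  by rewrite /r mleadM // mleadZ // mleadXm submK.
have cr : r@_(mlead p) = mleadc p.
  have := mleadcM ((mleadc p / mleadc q) *: 'X_[mlead p - mlead q]) q.
  rewrite -(mleadM rN0 qN0) -/r mr => ->.
  by rewrite mleadcZE mleadXm mcoeffX eqxx mulr1 divfK ?mleadc_eq0.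
have Jr : J r by apply/JM/Jt.
rewrite -(subrK r p); apply: JD => //.
have [->//|prN0] := eqVneq (p - r) 0.
apply: (IH (mlead (p - r))) => //; last first.
  by apply: IB => //; apply: IM.
rewrite mE lt_neqAle; apply/andP; split; last first.
  by apply: le_trans (mleadB_le _ _) _; rewrite mr joinxx.
apply: contraNneq prN0 => E.
by rewrite -mleadc_eq0 E mcoeffB cr subrr.
Qed.

Variables (K : numFieldType) (W : vectType K).

(** Generators of the ideal of [Z] suffice, as by Leibniz' rule the functions
   which vanish at [z] together with their derivative along [v] form an ideal.
   Membership is [List.In] because functions have no decidable equality. *)
Lemma tangent_space_finite (Z : set W) : exists ps : seq (W -> K),
  (forall p, List.In p ps -> polynomial_function p /\ vanishes_on Z p) /\
  forall z v, Z z -> tangent_space Z z v <->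
    forall p, List.In p ps -> directional p z v = 0.
Proof.
pose I : set {mpoly K[\dim {:W}]} :=
  [set h | vanishes_on Z (fun w => h.@[coordinates w])].
have [||s [sI hs]] := @hilbert_basis K _ I.
- by move=> p q Ip Iq w Zw; rewrite mevalB Ip ?Iq ?subrr.
- by move=> p q Ip w Zw; rewrite mevalM Ip ?mulr0.
pose ev (h : {mpoly K[\dim {:W}]}) w : K := h.@[coordinates w].
have pev h : polynomial_function (ev h) by exists h.
have In_map p : List.In p [seq ev h | h <- s] -> exists2 h, h \in s & p = ev h.
  elim: (s) => //= h r IHr [<-|/IHr[h' h'r ->]]; first by exists h; rewrite ?mem_head.
  by exists h'; rewrite // inE h'r orbT.
have map_In h : h \in s -> List.In (ev h) [seq ev h | h <- s].
  by elim: (s) => //= h' r IHr; rewrite inE => /orP[/eqP->|/IHr]; [left|right].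
exists [seq ev h | h <- s]; split=> [p /In_map[h /sI Ih ->]//|z v Zz].
rewrite tangent_spaceP; split=> hv p.
  by move=> /In_map[h /sI Ih ->]; apply: hv.
move=> [h hE]; rewrite (funext hE : p = ev h) => Ih.
pose J : set {mpoly K[\dim {:W}]} :=
  [set h | ev h z = 0 /\ directional (ev h) z v = 0].
suff [] : J h by [].
have evD p1 p2 : ev (p1 + p2) = fun w => ev p1 w + ev p2 w.
  by apply/funext => w; rewrite /ev mevalD.
have evM p1 p2 : ev (p1 * p2) = fun w => ev p1 w * ev p2 w.
  by apply/funext => w; rewrite /ev mevalM.
apply: (hs J) => //.
- have ev0 : ev 0 = fun=> 0 by apply/funext => w; rewrite /ev meval0.
  by split; rewrite ev0 ?directional_cst.
- move=> p1 p2 [a1 b1] [a2 b2]; split; rewrite evD ?a1 ?a2 ?addr0 //.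
  by rewrite directionalD // b1 b2 addr0.
- move=> p1 p2 [a1 b1]; split; rewrite evM ?a1 ?mulr0 //.
  by rewrite directionalM // a1 b1 !mulr0 addr0.
by move=> p' p's; split; [exact: (sI _ p's)|apply: hv; exact: map_In].
Qed.

End FiniteGeneration.

(** * Extension of derivations *)

Section DerivationExtension.
Variable (F : fieldType).
Hypothesis char0 : forall n, n.+1%:R != 0 :> F.
Implicit Types (G : set (F * F)) (p d : {poly F}).

(** The graph of a derivation from a subring of [F] to [F]: a subring of the
   dual numbers [F + F eps] which meets [F eps] in [0]. *)
Record derivation_graph G : Prop := DerivationGraph {
  der1 : G (1, 0);
  derB : forall a a' b b', G (a, a') -> G (b, b') -> G (a - b, a' - b');
  derM : forall a a' b b', G (a, a') -> G (b, b') -> G (a * b, a * b' + a' * b);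
  der_functional : forall a', G (0, a') -> a' = 0 }.

Section Closure.
Variables (G : set (F * F)) (hG : derivation_graph G).

Lemma der0 : G (0, 0).
Proof. by have := derB hG (der1 hG) (der1 hG); rewrite !subrr. Qed.

Lemma derD a a' b b' : G (a, a') -> G (b, b') -> G (a + b, a' + b').
Proof.
move=> Ga Gb; have := derB hG Ga (derB hG der0 Gb).
by rewrite !sub0r !opprK.
Qed.

Lemma der_sum (I : Type) (r : seq I) (f f' : I -> F) :
  (forall i, G (f i, f' i)) -> G (\sum_(i <- r) f i, \sum_(i <- r) f' i).
Proof.
move=> hf; elim: r => [|i r IHr]; first by rewrite !big_nil; apply: der0.
by rewrite !big_cons; apply: derD.
Qed.

Lemma derMn a a' n : G (a, a') -> G (a *+ n, a' *+ n).
Proof.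
move=> Ga; elim: n => [|n IHn]; first by rewrite !mulr0n; apply: der0.
by rewrite !mulrS; apply: derD.
Qed.

Lemma der_inj a a' a'' : G (a, a') -> G (a, a'') -> a' = a''.
Proof.
move=> Ga Gb; have := derB hG Ga Gb; rewrite subrr => /(der_functional hG)/eqP.
by rewrite subr_eq0 => /eqP.
Qed.

(** [d] is the image of [p] when the derivation acts on coefficients. *)
Definition der_poly p d := forall i, G (p`_i, d`_i).

Lemma der_polyB p d p' d' : der_poly p d -> der_poly p' d' ->
  der_poly (p - p') (d - d').
Proof. by move=> h h' i; rewrite !coefB; apply: derB. Qed.

Lemma der_polyM p d p' d' : der_poly p d -> der_poly p' d' ->
  der_poly (p * p') (p * d' + d * p').
Proof.
move=> h h' i; rewrite coefD !coefM -big_split /=.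
by apply: der_sum => j; apply: derM.
Qed.

Lemma der_polyC c c' : G (c, c') -> der_poly c%:P c'%:P.
Proof. by move=> h [|i]; rewrite !coefC //=; apply: der0. Qed.

Lemma der_polyXn n : der_poly 'X^n 0.
Proof.
move=> i; rewrite coef0 coefXn; case: eqP => _; first exact: der1.
exact: der0.
Qed.

Lemma der_poly_deriv p d : der_poly p d -> der_poly p^`() d^`().
Proof. by move=> h i; rewrite !coef_deriv; apply: derMn. Qed.

Lemma der_poly0 d : der_poly 0 d -> d = 0.
Proof.
by move=> h; apply/polyP => i; have := h i; rewrite !coef0 => /(der_functional hG).
Qed.

End Closure.

Section Adjoin.
Variables (G : set (F * F)) (hG : derivation_graph G) (a : F).

Definition der_adjoin (a' : F) : set (F * F) :=
  [set z | exists p d, der_poly G p d /\ z = (p.[a], d.[a] + p^`().[a] * a')].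

Lemma der_adjoin_graph a' :
  (forall p d, der_poly G p d -> p.[a] = 0 -> d.[a] + p^`().[a] * a' = 0) ->
  derivation_graph (der_adjoin a').
Proof.
move=> hfun; split.
- exists 1, 0; split; first by have := der_polyXn hG 0; rewrite expr0.
  by rewrite derivC !hornerE.
- move=> _ _ _ _ [p [d [h [-> ->]]]] [p' [d' [h' [-> ->]]]].
  exists (p - p'), (d - d'); split; first exact: der_polyB.
  by rewrite derivB !hornerE; congr (_, _); ring.
- move=> _ _ _ _ [p [d [h [-> ->]]]] [p' [d' [h' [-> ->]]]].
  exists (p * p'), (p * d' + d * p'); split; first exact: der_polyM.
  by rewrite derivM !hornerE; congr (_, _); ring.
- by move=> _ [p [d [h [/esym p0 ->]]]]; apply: hfun.
Qed.

(** A derivation extends to the subring generated by one more element [a].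
   If [a] is transcendental its image is arbitrary; otherwise a relation [m]
   of minimal degree for [a] forces it, and division by [m] shows that no other
   relation contradicts this choice. *)
Lemma der_extend : exists G' a', [/\ derivation_graph G', G `<=` G' & G' (a, a')].
Proof.
suff [a' ha'] : exists a', forall p d,
    der_poly G p d -> p.[a] = 0 -> d.[a] + p^`().[a] * a' = 0.
  exists (der_adjoin a'), a'; split; first exact: der_adjoin_graph.
    move=> [b b'] Gb; exists b%:P, b'%:P; split; first exact: der_polyC.
    by rewrite derivC !hornerE.
  exists 'X, 0; split; first by have := der_polyXn hG 1; rewrite expr1.
  by rewrite derivX !hornerE.
have [alg|trans] := pselect (exists n, `[< exists m md,
  [/\ der_poly G m md, m != 0, m.[a] = 0 & size m = n] >]); last first.
  exists 0 => p d pd p0; have [p_0|pN0] := eqVneq p 0.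
    by move: pd; rewrite p_0 => /(der_poly0 hG) ->; rewrite derivC !hornerE.
  by case: trans; exists (size p); apply/asboolP; exists p, d.
case: (ex_minnP alg) => _ /asboolP[m [md [hm mN0 m0 <-]]] min.
have hmin p d : der_poly G p d -> p.[a] = 0 -> (size p < size m)%N -> p = 0.
  move=> hp p0; apply: contraTeq => pN0; rewrite -leqNgt; apply: min.
  by apply/asboolP; exists p, d.
have m'N0 : m^`().[a] != 0.
  have m1 : (1 < size m)%N.
    rewrite ltnNge; apply: contra mN0 => /size1_polyC mC.
    by move: m0; rewrite mC hornerC => ->.
  apply/eqP => m'0.
  have := hmin _ _ (der_poly_deriv hG hm) m'0 (lt_size_deriv mN0).
  move=> /(congr1 (fun p : {poly F} => p`_(size m).-2)) /eqP; rewrite coef_deriv coef0.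
  have -> : (size m).-2.+1 = (size m).-1 by case: (size m) m1 => [|[]].
  rewrite -mulr_natr mulf_eq0 -/(lead_coef m) lead_coef_eq0 (negPf mN0) /=.
  by case: (size m) m1 => [|[|k]] // _; rewrite (negPf (char0 _)).
exists (- md.[a] / m^`().[a]) => p.
set a' := - _ / _.
have ma' : md.[a] + m^`().[a] * a' = 0 by rewrite /a'; field.
clearbody a'.
have [k] := ubnP (size p); elim: k p => // k IHk p; rewrite ltnS => pk d hp p0.
have [pm|mp] := ltnP (size p) (size m).
  have p_0 := hmin _ _ hp p0 pm.
  by move: hp; rewrite p_0 => /(der_poly0 hG) ->; rewrite derivC !hornerE.
have [p_0|pN0] := eqVneq p 0.
  by move: hp; rewrite p_0 => /(der_poly0 hG) ->; rewrite derivC !hornerE.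
pose c := lead_coef m; pose l := lead_coef p; pose e := (size p - size m)%N.
have [[c' Gc] [l' Gl]] : (exists c', G (c, c')) /\ (exists l', G (l, l')).
  by split; [exists md`_(size m).-1; apply: hm|exists d`_(size p).-1; apply: hp].
have cN0 : c != 0 by rewrite lead_coef_eq0.
have hcp := der_polyM hG (der_polyC hG Gc) hp.
have hlm := der_polyM hG (der_polyM hG (der_polyC hG Gl) (der_polyXn hG e)) hm.
have := IHk _ _ _ (der_polyB hG hcp hlm).
have sp : (size (c%:P * p - l%:P * 'X^e * m)%R < size p)%N.
  have pgt0 : (0 < size p)%N by rewrite size_poly_gt0.
  rewrite -(prednK pgt0) ltnS; apply/leq_sizeP => j; rewrite leq_eqVlt => /orP[/eqP<-|hj].
    rewrite coefB -mulrA !coefCM coefXnM.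
    have mgt0 : (0 < size m)%N by rewrite size_poly_gt0.
    have -> : ((size p).-1 < e)%N = false.
      by apply/negbTE; rewrite -leqNgt /e; clear -mp pgt0 mgt0; lia.
    have -> : ((size p).-1 - e = (size m).-1)%N by rewrite /e; clear -mp pgt0 mgt0; lia.
    by rewrite -!/(lead_coef _) mulrC subrr.
  rewrite coefB -mulrA !coefCM coefXnM.
  rewrite (nth_default 0 (s := p)) ?mulr0 ?sub0r; last by rewrite -(prednK pgt0).
  case: ifP => _; first by rewrite mulr0 oppr0.
  have pj : (size p <= j)%N by rewrite -(prednK pgt0).
  rewrite nth_default ?mulr0 ?oppr0 // -(leq_add2r e) subnK ?subnKC //.
  exact: leq_trans (leq_subr _ _) pj.
move=> /(_ (leq_trans sp pk)); rewrite !hornerE p0 m0 !mulr0 subrr => /(_ erefl).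
rewrite !(derivB, derivM, derivC) !hornerE ?p0 ?m0 ?mulr0 ?mul0r ?addr0 ?add0r ?subr0.
move=> h; apply: (mulfI cN0); rewrite mulr0 -[RHS]h.
have mda : md.[a] = - (m^`().[a] * a') by apply/eqP; rewrite -addr_eq0 ma'.
by rewrite mda; ring.
Qed.

End Adjoin.

Lemma der_extend_seq G (s : seq F) : derivation_graph G ->
  exists G', [/\ derivation_graph G', G `<=` G' &
    forall a, a \in s -> exists a', G' (a, a')].
Proof.
move=> hG; elim: s => [|a s [G1 [hG1 GG1 IHs]]]; first by exists G; split.
have [G2 [a' [hG2 G12 G2a]]] := der_extend hG1 a.
exists G2; split=> // [|b]; first by move=> z /GG1/G12.
rewrite inE => /orP[/eqP->|/IHs[b' Gb]]; first by exists a'.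
by exists b'; apply: G12.
Qed.

End DerivationExtension.

(** * Ultrapowers *)

Section Ultrapower.
Local Open Scope quotient_scope.
Variables (K : fieldType) (T : pointedType) (U : set_system T).
Hypothesis ultraU : UltraFilter U.

Definition null_function : {pred T -> K} := fun f => `[< U [set t | f t = 0] >].

Lemma null_function_ideal : idealr_closed null_function.
Proof.
have FU : Filter U by have [] := @ultra_proper _ _ ultraU.
split.
- by apply/asboolP; apply: filterS filterT => t _.
- apply/negP => /asboolP; have [+ _] := @ultra_proper _ _ ultraU; apply: contra_not.
  by apply: filterS => t /= /eqP; rewrite oner_eq0.
- move=> a f g /asboolP hf /asboolP hg; apply/asboolP.
  apply: filterS (filterI hf hg) => t [/= ft gt].
  by rewrite /GRing.add /GRing.mul /= ft gt mulr0 addr0.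
Qed.

HB.instance Definition _ := isIdealr.Build (T -> K) null_function null_function_ideal.

Local Notation I := (null_function : idealr (T -> K)).
Let Q : comNzRingType := {ideal_quot I}.
Let cls (f : T -> K) : Q := \pi_{ideal_quot I} f.

Let cls_eq f g : cls f = cls g <-> U [set t | f t = g t].
Proof.
have FU : Filter U by have [] := @ultra_proper _ _ ultraU.
rewrite /cls; split=> [/eqP|h].
  rewrite -Quotient.idealrBE => /asboolP; apply: filterS => t /eqP.
  by rewrite /GRing.add /GRing.opp /= subr_eq0 => /eqP.
apply/eqP; rewrite -Quotient.idealrBE; apply/asboolP; apply: filterS h => t /= e.
by rewrite /GRing.add /GRing.opp /= e subrr.
Qed.

Let inv (x : Q) : Q := cls (fun t => (repr (x : {ideal_quot I}) t)^-1).

Let clsK (x : Q) : cls (repr (x : {ideal_quot I})) = x.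
Proof. exact: reprK. Qed.

Let mul_cls x : x != 0 -> inv x * x = 1.
Proof.
move=> xN0; rewrite -[X in _ * X = _]clsK /inv; set f := repr _.
have -> : 1 = cls 1 by rewrite /cls rmorph1.
have -> g : cls g * cls f = cls (g * f) by rewrite /cls rmorphM.
apply/cls_eq; have [fU|] := in_ultra_setVsetC [set t | f t = 0] ultraU.
  case/eqP: xN0; rewrite -(clsK x) -/f.
  have -> : 0 = cls 0 by rewrite /cls rmorph0.
  exact/cls_eq.
have FU : Filter U by have [] := @ultra_proper _ _ ultraU.
by apply: filterS => t /eqP ft; rewrite /GRing.mul /= mulVf.
Qed.

Let inv0 : inv 0 = 0.
Proof.
have -> : 0 = cls 0 by rewrite /cls rmorph0.
apply/cls_eq.
have : cls (repr (cls 0 : {ideal_quot I})) = cls 0 by rewrite clsK.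
have FU : Filter U by have [] := @ultra_proper _ _ ultraU.
by move=> /cls_eq; apply: filterS => t /= e; rewrite e; apply: invr0.
Qed.

(** A statement about almost all points, in the sense of the ultrafilter, becomes
   an identity in a field, in which derivations can be extended. *)
Lemma ultrapower : exists (F : fieldType) (pi : {rmorphism (T -> K) -> F}),
  (forall x, exists f, pi f = x) /\
  forall f, pi f = 0 <-> U [set t | f t = 0].
Proof.
pose F : fieldType := HB.pack (GRing.ComNzRing.sort Q)
  (GRing.ComNzRing_isField.Build (GRing.ComNzRing.sort Q) mul_cls inv0).
have pB : zmod_morphism (cls : (T -> K) -> F).
  by move=> f g; rewrite /cls rmorphB.
have pM : monoid_morphism (cls : (T -> K) -> F).
  by split=> [|f g]; rewrite /cls ?rmorph1 ?rmorphM.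
pose pi : {rmorphism (T -> K) -> F} := HB.pack (cls : (T -> K) -> F)
  (GRing.isZmodMorphism.Build _ _ (cls : (T -> K) -> F) pB)
  (GRing.isMonoidMorphism.Build _ _ (cls : (T -> K) -> F) pM).
exists F, pi; split=> [x|f]; first by exists (repr (x : {ideal_quot I})); apply: clsK.
split=> [|h].
  have -> : (0 : F) = cls 0 by rewrite /cls rmorph0.
  by move/cls_eq.
rewrite (_ : (0 : F) = cls 0); first exact/cls_eq.
by rewrite /cls rmorph0.
Qed.

End Ultrapower.

(** * Tangent vectors at generic points *)

Section GenericTangent.
Variables (K : numFieldType) (W : vectType K).

(** In characteristic 0 a dominant map is generically submersive.  An ultrapower
   of [K] over [T] contains a generic point of [T], at which the [g i] take
   algebraically independent values.  The partial derivatives of the field of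
   rational functions in these values extend to the coordinates of the point.
   Such an extension is a tangent vector at the generic point, and it specializes
   to actual points of [T] because only the finitely many functions [ps] and [g i]
   have to be taken care of. *)
Lemma generic_tangent (T : set W) d (g : 'I_d -> W -> K) (ps : seq (W -> K)) :
    alg_independent_on T g ->
    (forall p, List.In p ps -> polynomial_function p /\ vanishes_on T p) ->
  exists w, T w /\ forall l : 'I_d -> K, exists v,
    (forall p, List.In p ps -> directional p w v = 0) /\
    forall j, directional (g j) w v = l j.
Proof.
move=> [pg gfree] hps.
pose pW : pointedType := HB.pack (Vector.sort W) (isPointed.Build (Vector.sort W) 0).
(* The open subsets of [T] defined by polynomials in the [g i] form a filter
   base, since these are independent. *)
pose B : set_system pW := [set A | exists2 P : {mpoly K[d]}, P != 0 &
  forall w, T w -> P.@[g^~ w] != 0 -> A w].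
have properB : ProperFilter B.
  split.
    move=> [P /eqP PN0 hP]; apply: PN0; apply: gfree => w Tw.
    by apply: contrapT => /eqP /(hP w Tw).
  split.
  - by exists 1; rewrite ?oner_neq0.
  - move=> A1 A2 [P1 P1N0 h1] [P2 P2N0 h2]; exists (P1 * P2); first exact: mulf_neq0.
    move=> w Tw; rewrite mevalM mulf_eq0 negb_or => /andP[N1 N2].
    by split; [apply: h1|apply: h2].
  - by move=> A1 A2 A12 [P PN0 hP]; exists P => // w Tw /(hP w Tw)/A12.
have [U [ultraU BU]] := ultraFilterLemma properB.
have properU : ProperFilter U := @ultra_proper _ _ ultraU.
have [F [pi [pi_surj pi0]]] := ultrapower K ultraU.
have pi_eq (f h : pW -> K) : pi f = pi h <-> U [set w | f w = h w].
  rewrite (_ : [set w | _] = [set w | (f - h) w = 0]).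
    by rewrite -pi0 rmorphB; split=> [->|/eqP]; rewrite ?subrr // subr_eq0 => /eqP.
  apply/seteqP; split=> w /=; rewrite /GRing.add /GRing.opp /=.
    by move=> ->; apply: subrr.
  by move=> /eqP; rewrite subr_eq0 => /eqP.
have UT : U T by apply: BU; exists 1; rewrite ?oner_neq0.
have char0 n : n.+1%:R != 0 :> F.
  apply/eqP; rewrite -(rmorph_nat pi) => /pi0.
  have -> : [set w | (n.+1%:R : pW -> K) w = 0] = set0; last exact: filter_not_empty.
  have natE m w : (m%:R : pW -> K) w = m%:R.
    by elim: m => // m IHm; rewrite -natr1 -[RHS]natr1 -IHm.
  by apply/seteqP; split=> w //= /eqP; rewrite natE pnatr_eq0.
suff step (j : 'I_d) : exists v : W -> W, U [set w |
    (forall p, List.In p ps -> directional p w (v w) = 0) /\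
    forall k, directional (g k) w (v w) = (k == j)%:R].
  have /choice[v hv] := step.
  have filU : Filter U by case: properU.
  have [w [Tw hw]] := filter_ex (filterI UT (filter_forall filU hv)); exists w; split=> // l.
  exists (\sum_j l j *: v j w); split=> [p pps|k].
    rewrite (scalar_sum (directional_linear w (hps _ pps).1)).
    by rewrite big1 // => j _; rewrite (hw j).1 ?mulr0.
  rewrite (scalar_sum (directional_linear w (pg k))).
  rewrite (bigD1 k) //= (hw k).2 eqxx mulr1 big1 ?addr0 // => j jNk.
  by rewrite (hw j).2 eq_sym (negPf jNk) mulr0.
pose val (P : {mpoly K[d]}) : pW -> K := fun w => P.@[g^~ w].
have valB P1 P2 : val (P1 - P2) = val P1 - val P2.
  by apply/funext => w; rewrite /val mevalB.
have valD P1 P2 : val (P1 + P2) = val P1 + val P2.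
  by apply/funext => w; rewrite /val mevalD.
have valM P1 P2 : val (P1 * P2) = val P1 * val P2.
  by apply/funext => w; rewrite /val mevalM.
have valC c : val c%:MP = (fun=> c) by apply/funext => w; rewrite /val mevalC.
(* The derivation [d / d (g j)] on the polynomials in the [g i]. *)
pose G0 : set (F * F) := [set z | exists P, z = (pi (val P), pi (val P^`M(j)))].
have G0P P : G0 (pi (val P), pi (val P^`M(j))) by exists P.
have hG0 : derivation_graph G0.
  split.
  - exists 1; rewrite -mpolyC1 mderivC -(@mpolyC0 d K) !valC.
    by rewrite -[X in (X, _)](rmorph1 pi) -[X in (_, X) = _](rmorph0 pi).
  - move=> _ _ _ _ [P1 [-> ->]] [P2 [-> ->]]; exists (P1 - P2).
    by rewrite mderivB !valB !rmorphB.
  - move=> _ _ _ _ [P1 [-> ->]] [P2 [-> ->]]; exists (P1 * P2).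
    rewrite mderivM valD !valM rmorphD !rmorphM; congr (_, _); exact: addrC.
  - move=> _ [P [/esym/pi0 P0 ->]].
    suff -> : P = 0 by rewrite mderiv0 -(@mpolyC0 d K) valC; apply: (rmorph0 pi).
    apply: contrapT => /eqP PN0.
    have PU : U [set w | val P w != 0] by apply: BU; exists P.
    by have [w [/= ->]] := filter_ex (filterI P0 PU); rewrite eqxx.
pose x i : pW -> K := coord (vbasis {:W}) i.
have [G [hG G0G Gx]] := der_extend_seq char0 [seq pi (x i) | i <- enum 'I_(\dim {:W})] hG0.
have /choice[u hu] (i : 'I_(\dim {:W})) : exists u : pW -> K, G (pi (x i), pi u).
  have [|a' Ga'] := Gx (pi (x i)); first by apply: map_f; rewrite mem_enum.
  by have [u uE] := pi_surj a'; exists u; rewrite uE.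
pose v (w : W) : W := \sum_i u i w *: (vbasis {:W})`_i.
have Gp p : polynomial_function p -> G (pi p, pi (fun w => directional p w (v w))).
  move=> pp; suff [] : polynomial_function p /\
    G (pi p, pi (fun w => directional p w (v w))) by [].
  move: p pp; apply: polynomial_function_ind => [c|i|p1 p2|p1 p2].
  - split; first exact: polynomial_function_cst.
    apply: G0G; exists c%:MP; rewrite valC mderivC -(@mpolyC0 d K) valC.
    by congr (_, pi _); apply/funext => w; rewrite directional_cst.
  - split; first exact: polynomial_function_coord.
    rewrite (_ : (fun w => _) = u i) //; apply/funext => w.
    rewrite (directional_scalar _ _ (coord_scalar i)) /v.
    by rewrite coord_sum_free // (basis_free (vbasisP _)).
  - move=> [pp1 G1] [pp2 G2]; split; first exact: polynomial_functionD.
    rewrite (_ : (fun w => directional _ w _) = fun w => directional p1 w (v w) + directional p2 w (v w)).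
      by have := derD hG G1 G2; rewrite -(rmorphD pi) -(rmorphD pi); apply.
    by apply/funext => w; rewrite directionalD.
  - move=> [pp1 G1] [pp2 G2]; split; first exact: polynomial_functionM.
    rewrite (_ : (fun w => directional _ w _) =
      fun w => p1 w * directional p2 w (v w) + directional p1 w (v w) * p2 w).
      by have := derM hG G1 G2; rewrite -!(rmorphM pi) -(rmorphD pi); apply.
    by apply/funext => w; rewrite directionalM // addrC.
exists v; apply: filterI.
  elim: (ps) hps => [|p s IHs] hps'; first by apply: filterS filterT => w _ p [].
  have Up : U [set w | directional p w (v w) = 0].
    have [pp pT] := hps' p (or_introl erefl).
    apply/pi0; apply: (der_functional hG); have := Gp p pp.
    by have -> : pi p = 0 by apply/pi0; apply: filterS UT.
  apply: (filterS _ (filterI Up (IHs (fun q qs => hps' q (or_intror qs))))).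
  by move=> w [/= h1 h2] q /= [<- //|]; apply: h2.
apply: filter_forall => k.
apply/(pi_eq (fun w => directional (g k) w (v w)) (fun=> (k == j)%:R)).
have Xk : val 'X_k = g k by apply/funext => w; rewrite /val mevalXU.
apply: (der_inj hG (Gp _ (pg k))); rewrite -Xk.
rewrite (_ : (fun=> _) = val 'X_k^`M(j)); first exact/G0G/G0P.
rewrite mderivX mnm1E; case: eqP => [->|_].
  rewrite -{1}[U_(j)%MM]add0m addmK.
  by rewrite scale1r mpolyX0 -mpolyC1 valC.
by rewrite scale0r -(@mpolyC0 d K) valC.
Qed.

End GenericTangent.

(** * Dimension and tangent spaces *)

Section JacobianKernel.
Variables (K : numFieldType) (W : vectType K).
Implicit Types (ps : seq (W -> K)) (z v : W).

Lemma linear_lfun (V : vectType K) (f : W -> V) : linear f ->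
  exists L : 'Hom(W, V), forall v, L v = f v.
Proof.
move=> lf; pose f' : {linear W -> V} := HB.pack f (GRing.isLinear.Build K W V *:%R f lf).
by exists (linfun f') => v; rewrite lfunE.
Qed.

Lemma scalar_row_linear s (l : 'I_s -> W -> K) : (forall k, scalar (l k)) ->
  linear (fun v => \row_k l k v).
Proof. by move=> hl a u v; apply/rowP => k; rewrite !mxE hl. Qed.

Lemma common_kernel s (l : 'I_s -> W -> K) : (forall k, scalar (l k)) ->
  exists T : {vspace W}, forall v, (v \in T) <-> forall k, l k v = 0.
Proof.
move=> /scalar_row_linear/linear_lfun[L hL]; exists (lker L) => v.
rewrite memv_ker hL; split=> [/eqP/rowP h k|h]; first by have := h k; rewrite !mxE.
by apply/eqP/rowP => k; rewrite !mxE.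
Qed.

Lemma In_nth ps p : List.In p ps <-> exists k : 'I_(size ps), p = nth (fun=> 0) ps k.
Proof.
elim: ps => [|q ps IHps] /=; first by split=> // -[[]].
split=> [[<-|/IHps[k ->]]|[k]]; first by exists ord0.
  by exists (lift ord0 k).
by case: (unliftP ord0 k) => [j|] -> pE; [right; apply/IHps; exists j|left].
Qed.

Definition polynomial_functions ps : Prop :=
  forall p, List.In p ps -> polynomial_function p.

Lemma polynomial_functions_nth ps k : polynomial_functions ps ->
  polynomial_function (nth (fun=> 0) ps k).
Proof.
move=> pps; have [kps|kps] := ltnP k (size ps).
  by apply: pps; apply/In_nth; exists (Ordinal kps).
by rewrite nth_default //; apply: polynomial_function_cst.
Qed.

Definition jacobian_kernel ps z : {vspace W} :=
  xget 0%VS [set T : {vspace W} | forall v, (v \in T) <-> forall p, List.In p ps -> directional p z v = 0].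

Lemma jacobian_kernelP ps z v : polynomial_functions ps ->
  (v \in jacobian_kernel ps z) <-> forall p, List.In p ps -> directional p z v = 0.
Proof.
move=> pps; rewrite /jacobian_kernel; case: xgetP => [_ ->|]; first exact.
have [k|T hT] := @common_kernel (size ps) (fun k => directional (nth (fun=> 0) ps k) z).
  by apply/directional_linear/polynomial_functions_nth.
move=> /(_ T) []; move=> u; rewrite hT; split=> [h p /In_nth[k ->] //|h k].
by apply: h; apply/In_nth; exists k.
Qed.

(** A maximal minor which does not vanish at [z0] witnesses that the rank of
   the Jacobian matrix does not drop near [z0]. *)
Lemma jacobian_kernel_semicontinuous ps z0 : polynomial_functions ps ->
  exists h, [/\ polynomial_function h, h z0 != 0 &
    forall z, h z != 0 -> (\dim (jacobian_kernel ps z) <= \dim (jacobian_kernel ps z0))%N].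
Proof.
move=> pps; set T0 := jacobian_kernel ps z0.
pose b := vbasis (T0^C)%VS; pose r := \dim (T0^C).
pose M z : 'M[K]_(r, size ps) := \matrix_(i, k) directional (nth (fun=> 0) ps k) z b`_i.
pose comb (c : 'rV[K]_r) : W := \sum_i c 0 i *: b`_i.
have comb_in c : comb c \in (T0^C)%VS.
  by apply: memv_suml => i _; apply/memvZ/vbasis_mem/mem_nth; rewrite size_tuple.
have comb_ker z c : comb c \in jacobian_kernel ps z <-> c *m M z = 0.
  rewrite jacobian_kernelP //; split=> [h|/rowP h p /In_nth[k ->]].
    apply/rowP => k; rewrite !mxE.
    have := h (nth (fun=> 0) ps k) ((In_nth _ _).2 (ex_intro _ k erefl)).
    rewrite (scalar_sum (directional_linear z (polynomial_functions_nth k pps))) => {2}<-.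
    by apply: eq_bigr => i _; rewrite mxE.
  have := h k; rewrite !mxE => {2}<-.
  rewrite (scalar_sum (directional_linear z (polynomial_functions_nth k pps))).
  by apply: eq_bigr => i _; rewrite mxE.
have comb0 c : comb c = 0 -> c = 0.
  move=> c0; apply/rowP => i; rewrite mxE.
  have := basis_free (vbasisP (T0^C)%VS) => /freeP/(_ (fun i => c 0 i)); exact.
have free0 : row_free (M z0).
  rewrite -kermx_eq0; apply/rowV0P => c /sub_kermxP/comb_ker cT0.
  by apply: comb0; apply/eqP; rewrite -memv0 -(capv_compl T0) memv_cap cT0 comb_in.
have full0 : row_full (M z0)^T by rewrite /row_full mxrank_tr.
pose f := fullrankfun full0; pose h z := \det (rowsub f (M z)^T).
have ph : polynomial_function h.
  apply: polynomial_function_sum => s; apply: polynomial_functionZ.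
  apply: polynomial_function_prod => i; under eq_fun do rewrite !mxE.
  exact/polynomial_function_directional/polynomial_functions_nth.
exists h; split=> // [|z hz].
  by have := fullrowsub_unit full0; rewrite unitmxE unitfE.
have freez : row_free (M z).
  rewrite /row_free eqn_leq rank_leq_row /= -mxrank_tr.
  have := mxrankS (rowsub_sub f (M z)^T).
  by rewrite mxrank_unit // unitmxE unitfE.
have cap0 : (jacobian_kernel ps z :&: T0^C = 0)%VS.
  apply/eqP; rewrite -subv0; apply/subvP => v; rewrite memv_cap => /andP[vz vC].
  have vE : v = comb (\row_i coord b i v).
    by rewrite {1}(coord_vbasis vC); apply: eq_bigr => i _; rewrite mxE.
  move: vz; rewrite vE => /comb_ker c0; have := row_free_inj freez.
  move=> /(_ _ (\row_i coord b i v) 0); rewrite c0 mul0mx => /(_ erefl) ->.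
  by rewrite /comb big1 ?mem0v // => i _; rewrite mxE scale0r.
have := dimv_disjoint_sum cap0.
have : (\dim (jacobian_kernel ps z + T0^C) <= \dim {:W})%N by apply/dimvS/subvf.
have T0W : (\dim T0 <= \dim {:W})%N by apply/dimvS/subvf.
move=> + E; rewrite E dimv_compl -[X in (_ <= X)%N](subnKC T0W).
by rewrite leq_add2r.
Qed.

End JacobianKernel.

Section TangentDimension.
Variables (K : numFieldType) (W : vectType K).
Implicit Types (Y Z : set W) (y z v : W).

Definition tangent_vspace Y y : {vspace W} :=
  xget 0%VS [set T : {vspace W} | forall v, (v \in T) <-> tangent_space Y y v].

Lemma tangent_vspaceP Y y v : Y y -> (v \in tangent_vspace Y y) <-> tangent_space Y y v.
Proof.
move=> Yy; rewrite /tangent_vspace; case: xgetP => [_ ->|]; first exact.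
have [ps [pps hps]] := tangent_space_finite Y.
move=> /(_ (jacobian_kernel ps y)) []; move=> u.
by rewrite hps // jacobian_kernelP // => p /pps[].
Qed.

Lemma tangent_vspaceS Y Z y : Z `<=` Y -> Z y ->
  (tangent_vspace Z y <= tangent_vspace Y y)%VS.
Proof.
move=> ZY Zy; apply/subvP => v; rewrite !tangent_vspaceP => // [/tangent_spaceP h|]; last exact: ZY.
by apply/tangent_spaceP => g pg gY; apply: h => // w /ZY; apply: gY.
Qed.

Lemma tangent_dim_semicontinuous Z z0 : Z z0 -> exists h,
  [/\ polynomial_function h, h z0 != 0 & forall z, Z z -> h z != 0 ->
    (\dim (tangent_vspace Z z) <= \dim (tangent_vspace Z z0))%N].
Proof.
move=> Zz0; have [ps [pps hps]] := tangent_space_finite Z.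
have ppf : polynomial_functions ps by move=> p /pps[].
have [h [ph hz0 hdim]] := jacobian_kernel_semicontinuous z0 ppf.
have E z : Z z -> tangent_vspace Z z = jacobian_kernel ps z.
  move=> Zz; apply/vspaceP => v; apply/idP/idP.
    by move/(tangent_vspaceP _ Zz)/hps => /(_ Zz) ?; apply/jacobian_kernelP.
  by move/(jacobian_kernelP _ _ ppf) => ?; apply/(tangent_vspaceP _ Zz)/hps.
by exists h; split=> // z Zz hz; rewrite !E //; apply: hdim.
Qed.

Lemma alg_independent_open Z h d (g : 'I_d -> W -> K) z0 : irreducible Z ->
  polynomial_function h -> Z z0 -> h z0 != 0 -> alg_independent_on Z g ->
  alg_independent_on [set z | Z z /\ h z != 0] g.
Proof.
move=> Zirr ph Zz0 hz0 [pg gfree]; split=> // P hP; apply: gfree.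
have pP := polynomial_function_meval P pg.
have [|/(_ _ Zz0)/eqP|//] := irreducible_prime Zirr ph pP; last by rewrite (negPf hz0).
move=> z Zz; have [->|hz] := eqVneq (h z) 0; first by rewrite mul0r.
by rewrite hP ?mulr0.
Qed.

(** At a generic point algebraically independent functions have linearly
   independent differentials; the tangent spaces at the other points can only
   be larger. *)
Lemma alg_independent_tangent_dim Z d (g : 'I_d -> W -> K) z0 :
  irreducible Z -> alg_independent_on Z g -> Z z0 ->
  (d <= \dim (tangent_vspace Z z0))%N.
Proof.
move=> Zirr hg Zz0; have [h [ph hz0 hdim]] := tangent_dim_semicontinuous Zz0.
have hgo := alg_independent_open Zirr ph Zz0 hz0 hg.
have [ps [pps hps]] := tangent_space_finite Z.
have [p|w [[Zw hw] wT]] := generic_tangent (ps := ps) hgo.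
  by move=> /pps[pp pZ]; split=> // z [/pZ].
apply: leq_trans (hdim _ Zw hw).
have /choice[v hv] (j : 'I_d) := wT (fun k => (k == j)%:R).
have vfree : free [tuple v j | j < d].
  apply/freeP => c c0 i.
  have := directional_linear w (hg.1 i); move=> lin.
  have := scalar_sum lin (index_enum _) xpredT c v.
  have -> : \sum_i c i *: v i = 0.
    by rewrite -[RHS]c0; apply: eq_bigr => j _; rewrite -tnth_nth tnth_mktuple.
  rewrite (directional0 _ (hg.1 i)) (bigD1 i) //= (hv i).2 eqxx mulr1 big1 ?addr0 //.
  by move=> j jNi; rewrite (hv j).2 eq_sym (negPf jNi) mulr0.
have /eqP := vfree; rewrite size_tuple => <-; apply: dimvS.
apply/span_subvP => _ /mapP[j _ ->].
by apply/(tangent_vspaceP _ Zw)/hps => // p; apply: (hv j).1.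
Qed.

Lemma msize_mderiv d (P : {mpoly K[d]}) i : (msize P^`M(i) <= (msize P).-1)%N.
Proof.
rewrite [X in (X <= _)%N]msizeE; apply/bigmax_leqP_seq => m.
rewrite mcoeff_msupp mcoeff_mderiv => mN0 _.
have /msize_mdeg_lt : (m + U_(i))%MM \in msupp P.
  by rewrite mcoeff_msupp; apply: contraNneq mN0 => ->; rewrite mul0rn.
by rewrite mdegD mdeg1 addn1; case: (msize P).
Qed.

Lemma mderiv_eq0 d (P : {mpoly K[d]}) : (forall i, P^`M(i) = 0) -> P = (P@_0%MM)%:MP.
Proof.
move=> P'0; apply/mpolyP => m; rewrite mcoeffC.
have [->|mN0] := eqVneq m 0%MM; first by rewrite mulr1.
rewrite mulr0; have [i mi] : exists i, m i != 0%N.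
  apply: contrapT => h; case/eqP: mN0; apply/mnmP => i; rewrite mnm0E.
  by apply: contrapT => /eqP mi; apply: h; exists i.
have := congr1 (mcoeff (m - U_(i))%MM) (P'0 i).
rewrite mcoeff_mderiv mcoeff0 submK ?lep1mP // => /eqP.
by rewrite -mulr_natr mulf_eq0 pnatr_eq0 orbF => /eqP.
Qed.

(** Coordinates on a tangent space of minimal dimension [d] are [d]
   algebraically independent functions: the derivative of a relation of
   minimal degree would be a linear relation between them on the tangent spaces
   at nearby points, which they also parametrize. *)
Lemma has_dim_tangent Z z0 : irreducible Z -> Z z0 ->
  (forall z, Z z -> (\dim (tangent_vspace Z z0) <= \dim (tangent_vspace Z z))%N) ->
  has_dim Z (\dim (tangent_vspace Z z0)).
Proof.
move=> Zirr Zz0 zmin; split; last first.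
  by move=> d g hg; apply: (alg_independent_tangent_dim Zirr hg Zz0).
set T0 := tangent_vspace Z z0; set d := \dim T0.
pose x (i : 'I_d) (w : W) : K := coord (vbasis T0) i (projv T0 w).
have xlin i : scalar (x i) by move=> a u v; rewrite /x linearP /= linearP.
have px i : polynomial_function (x i) by apply: polynomial_function_scalar.
have [ps [pps hps]] := tangent_space_finite Z.
pose qs := ps ++ [seq x i | i <- enum 'I_d].
have pqs : polynomial_functions qs.
  move=> q /(@List.in_app_or _ _ _ _) [/pps[]//|].
  by elim: (enum 'I_d) => //= i s IHs [<-|/IHs].
have qsT z v : Z z -> tangent_space Z z v -> (forall i, x i v = 0) ->
    v \in jacobian_kernel qs z.
  move=> Zz Tv xv; apply/(jacobian_kernelP _ _ pqs) => q /(@List.in_app_or _ _ _ _) [qps|].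
    by have /(hps _ _ Zz) := Tv; apply.
  elim: (enum 'I_d) => //= i s IHs [<-|//].
  by rewrite (directional_scalar _ _ (xlin i)).
have ker0 : jacobian_kernel qs z0 = 0%VS.
  apply/eqP; rewrite -subv0; apply/subvP => v /(jacobian_kernelP _ _ pqs) hv.
  have vT : v \in T0.
    apply/(tangent_vspaceP _ Zz0)/hps => // p pps'; apply: hv.
    by apply: List.in_or_app; left.
  have xv i : x i v = 0.
    rewrite -(directional_scalar z0 v (xlin i)); apply: hv; apply: List.in_or_app; right.
    have : i \in enum 'I_d by rewrite mem_enum.
    by elim: (enum 'I_d) => //= j s IHs; rewrite inE => /orP[/eqP->|/IHs]; [left|right].
  rewrite memv0; apply/eqP; rewrite (coord_vbasis vT) big1 // => i _.
  by have := xv i; rewrite /x projv_id // => ->; rewrite scale0r.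
have [h [ph hz0 hdim]] := jacobian_kernel_semicontinuous z0 pqs.
have dual z (i : 'I_d) : Z z -> h z != 0 ->
    exists v, tangent_space Z z v /\ forall j, x j v = (j == i)%:R.
  move=> Zz hz; have [X hX] := linear_lfun (scalar_row_linear xlin).
  have cap0 : (tangent_vspace Z z :&: lker X = 0)%VS.
    apply/eqP; rewrite -subv0; apply/subvP => v; rewrite memv_cap memv_ker hX.
    case/andP=> /(tangent_vspaceP _ Zz) Tv /eqP/rowP xv.
    have := hdim z hz; rewrite ker0 dimv0 leqn0 dimv_eq0 => /eqP <-.
    by apply: qsT => // j; have := xv j; rewrite !mxE.
  have : (X @: tangent_vspace Z z)%VS = fullv.
    apply/eqP; rewrite eqEdim subvf limg_dim_eq // dimvf /dim /= mul1n.
    exact: zmin.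
  move=> /vspaceP/(_ (delta_mx 0 i)); rewrite memvf => /memv_imgP[v Tv vE].
  exists v; split; first exact/(tangent_vspaceP _ Zz).
  by move: vE; rewrite hX => /rowP vE j; have := vE j; rewrite !mxE eqxx.
exists x; split=> // P.
have [n] := ubnP (msize P); elim: n P => // n IHn P; rewrite ltnS => Pn PZ.
have [->//|PN0] := eqVneq P 0.
have P'0 i : P^`M(i) = 0.
  apply: IHn.
    apply: leq_ltn_trans (msize_mderiv P i) _.
    by apply: leq_trans Pn; rewrite prednK // lt0n msize_poly_eq0.
  have pP' := polynomial_function_meval P^`M(i) px.
  have [|/(_ _ Zz0)/eqP|//] := irreducible_prime Zirr ph pP'; last by rewrite (negPf hz0).
  move=> z Zz; have [->|hz] := eqVneq (h z) 0; first by rewrite mul0r.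
  have [v [/tangent_spaceP Tv xv]] := dual z i Zz hz.
  have := Tv _ (polynomial_function_meval P px) PZ; rewrite directional_meval //.
  rewrite (bigD1 i) //= big1 ?addr0.
    by rewrite (directional_scalar _ _ (xlin i)) xv eqxx mulr1 => ->; rewrite mulr0.
  by move=> j jNi; rewrite (directional_scalar _ _ (xlin j)) xv (negPf jNi) mulr0.
have PC := mderiv_eq0 P'0.
by have := PZ _ Zz0; rewrite PC mevalC => ->; rewrite mpolyC0.
Qed.

(** Nonsingularity only involves tangent spaces: some irreducible closed subset
   through [y] has, at each of its points, a tangent space of dimension at least
   that of [Y] at [y].  By semicontinuity a dense set of points suffices. *)
Lemma nonsingular_irreducible Y y : nonsingular Y y -> exists Z,
  [/\ irreducible Z, Z `<=` Y, Z y & forall z, Z z ->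
    (\dim (tangent_vspace Y y) <= \dim (tangent_vspace Z z))%N].
Proof.
move=> [Yy [d [T [[[Z [Zirr ZY Zy [[g hg] _]]] _] hT dT]]]].
exists Z; split=> // z Zz; have -> : tangent_vspace Y y = T.
  by apply/vspaceP => v; apply/idP/idP => [/(tangent_vspaceP _ Yy)/hT|/hT/(tangent_vspaceP _ Yy)].
by rewrite dT; apply: alg_independent_tangent_dim hg Zz.
Qed.

Lemma nonsingular_dense Y y Z S : irreducible Z -> Z `<=` Y -> Z y ->
  S `<=` Z -> Z `<=` affine_closure S ->
  (forall z, S z -> (\dim (tangent_vspace Y y) <= \dim (tangent_vspace Z z))%N) ->
  nonsingular Y y.
Proof.
move=> Zirr ZY Zy SZ ZS hdim; have Yy := ZY _ Zy.
have hmin z : Z z -> (\dim (tangent_vspace Y y) <= \dim (tangent_vspace Z z))%N.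
  move=> Zz; have [h [ph hz h_dim]] := tangent_dim_semicontinuous Zz.
  have [s Ss hs] : exists2 s, S s & h s != 0.
    apply: contrapT => hS; case/eqP: hz; apply: (ZS _ Zz) => // s Ss.
    by apply: contrapT => /eqP hs; apply: hS; exists s.
  exact: leq_trans (hdim s Ss) (h_dim s (SZ _ Ss) hs).
have E : \dim (tangent_vspace Z y) = \dim (tangent_vspace Y y).
  by apply/eqP; rewrite eqn_leq hmin // andbT; apply/dimvS/tangent_vspaceS.
split=> //; exists (\dim (tangent_vspace Y y)), (tangent_vspace Y y); split=> //.
  split.
    exists Z; split=> //; rewrite -E; apply: has_dim_tangent => // z Zz.
    by rewrite E; apply: hmin.
  move=> Z' d' Zirr' ZY' Zy' [[g hg] _].
  apply: leq_trans (alg_independent_tangent_dim Zirr' hg Zy') _.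
  exact/dimvS/tangent_vspaceS.
by move=> v; split=> /(tangent_vspaceP _ Yy).
Qed.

End TangentDimension.

(** * Images of nonsingular points *)

Section Image.
Variables (K : numFieldType) (W1 W2 : vectType K).

Lemma dim_le_injective (f : W1 -> W2) (T1 : {vspace W1}) (T2 : {vspace W2}) :
  linear f -> (forall v, v \in T1 -> f v \in T2) ->
  (forall v, v \in T1 -> f v = 0 -> v = 0) -> (\dim T1 <= \dim T2)%N.
Proof.
move=> /linear_lfun[L hL] T12 inj.
rewrite -(limg_dim_eq (f := L)); last first.
  apply/eqP; rewrite -subv0; apply/subvP => v; rewrite memv_cap memv_ker hL memv0.
  by case/andP => vT /eqP /inj ->.
by apply/dimvS/subvP => _ /memv_imgP[v vT ->]; rewrite hL; apply: T12.
Qed.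

(** A polynomial map which is generically immersive carries an irreducible set
   through a nonsingular point to an irreducible set whose tangent spaces are
   at least as large. *)
Lemma nonsingular_image (F : W1 -> W2) (Y1 : set W1) (Y2 : set W2) y (k : W1 -> K) :
  polynomial_map F -> zariski_closed Y2 -> (forall w, Y1 w -> Y2 (F w)) ->
  polynomial_function k -> k y != 0 ->
  (forall z v, Y1 z -> k z != 0 -> tangent_space Y1 z v -> tangent_map F z v = 0 -> v = 0) ->
  (\dim (tangent_vspace Y2 (F y)) <= \dim (tangent_vspace Y1 y))%N ->
  nonsingular Y1 y -> nonsingular Y2 (F y).
Proof.
move=> pF clY2 Y12 pk ky inj ledim /nonsingular_irreducible[Z [Zirr ZY Zy hdim]].
pose S := [set F z | z in [set z | Z z /\ k z != 0]].
have kvanish g : polynomial_function g -> vanishes_on S g ->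
    vanishes_on Z (fun z => g (F z)).
  move=> pg gS.
  have [|/(_ _ Zy)/eqP|//] := irreducible_prime Zirr pk (pF _ pg); last by rewrite (negPf ky).
  move=> z Zz; have [->|kz] := eqVneq (k z) 0; first by rewrite mul0r.
  by rewrite gS ?mulr0 //; exists z.
have SFy : S (F y) by exists y.
have clSirr : irreducible (affine_closure S).
  apply: irreducible_affine_closure; first by exists (F y).
  move=> g1 g2 p1 p2 g12.
  have := irreducible_prime Zirr (pF _ p1) (pF _ p2) (kvanish _ (polynomial_functionM p1 p2) g12).
  by case=> gZ; [left|right] => _ [z [Zz _] <-]; apply: gZ.
have ZclS z : Z z -> affine_closure S (F z) by move=> Zz g pg /(kvanish _ pg); apply.
apply: (nonsingular_dense (S := S) clSirr) => //.
- by apply: affine_closure_min => // _ [z [Zz _] <-]; apply/Y12/ZY.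
- exact: sub_affine_closure.
- exact: sub_affine_closure.
move=> _ [z [Zz kz] <-]; apply: leq_trans ledim _; apply: leq_trans (hdim _ Zz) _.
apply: (dim_le_injective (tangent_map_linear z pF)) => v /(tangent_vspaceP _ Zz) Tv.
  by apply/(tangent_vspaceP _ (ZclS _ Zz)); apply: tangent_map_tangent Tv.
move=> v0; apply: inj v0 => //; first exact: ZY.
by apply/(tangent_vspaceP _ (ZY _ Zz)); apply: (subvP (tangent_vspaceS ZY Zz)); apply/(tangent_vspaceP _ Zz).
Qed.

End Image.

(** * Cones and their sections by the unit quadric *)

Section Cone.
Variables (K : numClosedFieldType) (V : vectType K) (B : V -> V -> K).
Hypotheses (Bsym : forall u v, B u v = B v u) (Blin : forall u, scalar (B u)).
Implicit Types (g H : V -> K) (u v y z : V) (s t : K) (Z S : set V).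

Let q z := B z z.

Let BZr u t v : B u (t *: v) = t * B u v.
Proof.
have B0 : B u 0 = 0 by have := Blin u (-1) 0 0; rewrite scaler0 addr0 mulN1r addNr.
by have := Blin u t v 0; rewrite addr0 B0 addr0.
Qed.

Let BDr u v w : B u (v + w) = B u v + B u w.
Proof. by have := Blin u 1 v w; rewrite scale1r mul1r. Qed.

Let qZ t z : q (t *: z) = t ^+ 2 * q z.
Proof. by rewrite /q BZr Bsym BZr mulrA. Qed.

Lemma polynomial_function_quadratic : polynomial_function q.
Proof.
have -> : q = fun z => \sum_i coord (vbasis {:V}) i z * B (vbasis {:V})`_i z.
  apply/funext => z; rewrite /q {1}(coord_vbasis (memvf z)) Bsym (scalar_sum (Blin z)).
  by apply: eq_bigr => i _; rewrite Bsym.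
apply: polynomial_function_sum => i; apply: polynomial_functionM.
  exact: polynomial_function_coord.
exact: polynomial_function_scalar.
Qed.

Let pq := polynomial_function_quadratic.

Lemma directional_quadratic z v : directional q z v = 2 * B z v.
Proof.
rewrite (@directional_curve _ _ _ _ _ ((q z)%:P + (2 * B z v) *: 'X + q v *: 'X^2)).
  by rewrite !derivD derivC !derivZ derivX derivXn !hornerE ?mul0rn ?mulr0 ?addr0.
move=> t; rewrite /q BDr BZr !(Bsym (z + _)) !BDr !BZr (Bsym v z) !hornerD !hornerZ hornerC hornerX hornerXn /q.
ring.
Qed.

Definition homogeneous_of_degree e H := forall t z, H (t *: z) = t ^+ e * H z.

Lemma directional_homogeneous e H t z v : polynomial_function H ->
  homogeneous_of_degree e H -> t * directional H (t *: z) v = t ^+ e * directional H z v.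
Proof.
move=> pH hH; rewrite -directional_scale // -directionalZ //.
have lin : linear (fun w : V => t *: w).
  by move=> a u w; rewrite scalerDr !scalerA mulrC.
rewrite -[X in directional H _ X](tangent_map_of_linear z v lin).
rewrite -(chain_rule _ _ (polynomial_map_linear lin) pH).
by congr directional; apply/funext => w; apply: hH.
Qed.

Lemma euler e H z : homogeneous_of_degree e H -> directional H z z = e%:R * H z.
Proof.
move=> hH; rewrite (@directional_curve _ _ _ _ _ (H z *: (1 + 'X) ^+ e)).
  rewrite derivZ deriv_exp derivD derivC derivX add0r mul1r hornerZ hornerMn horner_exp.
  by rewrite !hornerE expr1n mulr_natr mulr_natl.
by move=> t; rewrite -[X in X + _]scale1r -scalerDl hH hornerZ horner_exp !hornerE mulrC.
Qed.

(** Multiplication by powers of [q] equalizes the degrees of the homogeneous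
   components of the same parity, and does not change them modulo [q - 1]. *)
Lemma parity_homogenization g : polynomial_function g -> exists m H0 H1 k,
  [/\ polynomial_function H0, polynomial_function H1, polynomial_function k &
    [/\ homogeneous_of_degree m.*2 H0, homogeneous_of_degree m.*2.+1 H1 &
      forall z, g z = H0 z + H1 z + (q z - 1) * k z]].
Proof.
pose P m g := exists H0 H1 k,
  [/\ polynomial_function H0, polynomial_function H1, polynomial_function k &
    [/\ homogeneous_of_degree m.*2 H0, homogeneous_of_degree m.*2.+1 H1 &
      forall z, g z = H0 z + H1 z + (q z - 1) * k z]].
have raise m n f : P m f -> P (n + m)%N f.
  elim: n f => // n IHn f Pf; have [H0 [H1 [k [p0 p1 pk [h0 h1 e]]]]] := IHn f Pf.
  exists (fun z => H0 z * q z), (fun z => H1 z * q z), (fun z => k z - (H0 z + H1 z)).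
  split; [exact: polynomial_functionM|exact: polynomial_functionM| |].
    by apply: polynomial_functionB => //; apply: polynomial_functionD.
  split=> [t z|t z|z].
  - by rewrite h0 qZ addSn doubleS !exprS; ring.
  - by rewrite h1 qZ addSn doubleS !exprS; ring.
  - by rewrite e; ring.
suff : forall g, polynomial_function g -> exists m, P m g by exact.
have p0 : polynomial_function (fun _ : V => 0 : K) by apply: polynomial_function_cst.
apply: polynomial_function_rect => [c|l hl|g1 g2 pg1 pg2 [m1 I1] [m2 I2]|
    g1 g2 pg1 pg2 [m1 I1] [m2 I2]].
- exists 0%N, (fun=> c), (fun=> 0), (fun=> 0).
  split=> //; first exact: polynomial_function_cst.
  split=> [t z|t z|z]; first by rewrite expr0 mul1r.
    by rewrite mulr0.
  by rewrite mulr0 !addr0.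
- exists 0%N, (fun=> 0), l, (fun=> 0).
  split=> //; first exact: polynomial_function_scalar.
  split=> [t z|t z|z]; first by rewrite mulr0.
    by rewrite expr1; have := scalar_sum hl [:: tt] xpredT (fun=> t) (fun=> z); rewrite !big_seq1.
  by rewrite mulr0 addr0 add0r.
- exists (m2 + m1)%N; move: (raise _ m2 _ I1) (raise _ m1 _ I2); rewrite (addnC m1).
  move=> [H0 [H1 [k [a0 a1 ak [h0 h1 e]]]]] [G0 [G1 [l [b0 b1 bl [h0' h1' e']]]]].
  exists (fun z => H0 z + G0 z), (fun z => H1 z + G1 z), (fun z => k z + l z).
  split; [exact: polynomial_functionD|exact: polynomial_functionD|exact: polynomial_functionD|].
  split=> [t z|t z|z]; first by rewrite h0 h0' mulrDr.
    by rewrite h1 h1' mulrDr.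
  by rewrite e e'; ring.
exists (m1 + m2).+1.
move: I1 I2 => [H0 [H1 [k [a0 a1 ak [h0 h1 e]]]]] [G0 [G1 [l [b0 b1 bl [h0' h1' e']]]]].
exists (fun z => H0 z * G0 z * q z + H1 z * G1 z),
  (fun z => q z * (H0 z * G1 z + H1 z * G0 z)),
  (fun z => (H0 z + H1 z) * l z + k z * g2 z - (H0 z * G0 z) - (H0 z * G1 z + H1 z * G0 z)).
split; try by repeat first [exact: pq | apply: polynomial_functionB | apply: polynomial_functionM
  | apply: polynomial_functionD | assumption].
split=> [t z|t z|z].
- by rewrite h0 h1 h0' h1' qZ doubleS doubleD !exprS exprD; ring.
- by rewrite h0 h1 h0' h1' qZ doubleS doubleD !exprS exprD; ring.
- by rewrite e e'; ring.
Qed.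

Lemma parity_vanishing m g H0 H1 k z :
  homogeneous_of_degree m.*2 H0 -> homogeneous_of_degree m.*2.+1 H1 ->
  (forall z, g z = H0 z + H1 z + (q z - 1) * k z) ->
  q z = 1 -> g z = 0 -> g (- z) = 0 -> H0 z = 0 /\ H1 z = 0.
Proof.
move=> h0 h1 gE qz gz gNz.
have opp e H : homogeneous_of_degree e H -> H (- z) = (-1) ^+ e * H z.
  by move=> hH; rewrite -scaleN1r hH.
have := gE z; rewrite gz qz subrr mul0r addr0 => e1.
have := gE (- z); rewrite gNz -[in q _]scaleN1r qZ sqrrN expr1n mul1r qz.
rewrite subrr mul0r addr0 (opp _ _ h0) (opp _ _ h1) exprS -signr_odd odd_double.
rewrite expr0 mulr1 mul1r mulN1r => e2.
have H00 : 2 * H0 z = (H0 z + H1 z) + (H0 z - H1 z) by ring.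
rewrite -e1 -e2 addr0 in H00.
have {}H00 : H0 z = 0.
  by apply/eqP; move/eqP: H00; rewrite mulf_eq0 pnatr_eq0.
by split=> //; move: e1; rewrite H00 add0r => <-.
Qed.

(** Radial projection to the unit quadric [q = 1] carries tangent vectors to
   tangent vectors, although it is not polynomial: the functions vanishing on the
   symmetric set [A] are generated, modulo [q - 1], by homogeneous ones. *)
Lemma radial_projection_tangent (D A : set V) s y v :
  (forall y, A y -> A (- y)) -> A `<=` [set y | q y = 1] ->
  (forall z t, D z -> q z = t ^+ 2 -> t != 0 -> A (t^-1 *: z)) ->
  s != 0 -> D (s *: y) -> q y = 1 -> tangent_space D (s *: y) v ->
  tangent_space A y (v - B y v *: y).
Proof.
move=> Aopp A1 DA sN0 Dsy qy /tangent_spaceP Tv; apply/tangent_spaceP => g pg gA.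
have Ay : A y.
  have := DA _ s Dsy; rewrite qZ qy mulr1 => /(_ erefl sN0).
  by rewrite scalerA mulVf // scale1r.
have [m [H0 [H1 [k [p0 p1 pk [h0 h1 gE]]]]]] := parity_homogenization pg.
have HA z : A z -> H0 z = 0 /\ H1 z = 0.
  by move=> Az; apply: (parity_vanishing h0 h1 gE); rewrite ?gA ?(A1 _ Az) //; apply: Aopp.
suff dH e H : polynomial_function H -> homogeneous_of_degree e H ->
    (forall z, A z -> H z = 0) -> directional H y (v - B y v *: y) = 0.
  have gE' : g = fun z => (H0 z + H1 z) + (q z - 1) * k z by apply/funext.
  have pq1 : polynomial_function (fun z => q z - 1).
    by apply: polynomial_functionB => //; apply: polynomial_function_cst.
  rewrite gE' directionalD ?directionalD ?directionalM //; first last.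
  - exact: polynomial_functionM.
  - exact: polynomial_functionD.
  rewrite (dH _ _ p0 h0) ?(dH _ _ p1 h1); try by [move=> z /HA[]].
  rewrite qy subrr mul0r directionalB //; last exact: polynomial_function_cst.
  rewrite directional_cst directional_quadratic BDr -scaleNr BZr -/(q y) qy.
  by rewrite mulr1 subrr mulr0 subr0 mul0r !addr0.
move=> pH hH HA0.
have Hy : H y = 0 by apply: HA0.
have qHD : vanishes_on D (fun z => q z * H z).
  move=> z Dz; have [->|qz] := eqVneq (q z) 0; first by rewrite mul0r.
  have tN0 : sqrtC (q z) != 0 by rewrite sqrtC_eq0.
  have Az : A ((sqrtC (q z))^-1 *: z) by apply: DA => //; rewrite sqrtCK.
  have -> : z = sqrtC (q z) *: ((sqrtC (q z))^-1 *: z) by rewrite scalerA divff // scale1r.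
  by rewrite hH (HA0 _ Az) !mulr0.
have := Tv _ (polynomial_functionM pq pH) qHD.
rewrite directionalM // hH Hy !mulr0 add0r qZ qy mulr1 => /eqP.
rewrite mulf_eq0 expf_eq0 (negPf sN0) /= => /eqP dHv.
have := directional_homogeneous s y v pH hH; rewrite dHv mulr0 => /esym/eqP.
rewrite mulf_eq0 expf_eq0 (negPf sN0) andbF /= => /eqP dHy.
by rewrite -scaleNr directional_add // directional_scale // dHy (euler _ hH) Hy !mulr0 addr0.
Qed.

Lemma tangent_scale Z S y t v : (forall z, Z z -> S (t *: z)) -> t != 0 ->
  tangent_space Z y v -> tangent_space S (t *: y) v.
Proof.
move=> ZS tN0 Tv; have lin : linear (fun w : V => t *: w).
  by move=> a u w; rewrite scalerDr !scalerA mulrC.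
have := tangent_map_tangent (polynomial_map_linear lin) ZS Tv.
rewrite tangent_map_of_linear // => /tangent_spaceP Ttv; apply/tangent_spaceP => g pg gS.
have := Ttv g pg gS; rewrite directional_scale // => /eqP.
by rewrite mulf_eq0 (negPf tN0) => /eqP.
Qed.

Lemma tangent_radial S y t : (forall t, t != 0 -> S (t *: y)) -> tangent_space S (t *: y) y.
Proof.
move=> Sy; apply/tangent_spaceP => g pg gS.
have [r hr] := polynomial_function_curve pg (t *: y) y.
rewrite (directional_curve hr); suff -> : r = 0 by rewrite derivC horner0.
have : r * ('X + t%:P) = 0.
  apply: poly_eq0_fun => a; rewrite hornerM !hornerE -hr -scalerDl.
  have [at0|atN0] := eqVneq (a + t) 0; first by rewrite at0 mulr0.
  by rewrite gS ?mul0r //; apply: Sy; rewrite addrC.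
move=> /eqP; rewrite mulf_eq0 => /orP[/eqP//|/eqP/(congr1 (fun p : {poly K} => p`_1))].
by rewrite coefD coefX coefC addr0 coef0 => /eqP; rewrite oner_eq0.
Qed.

Lemma dim_radial_le (T T1 : {vspace V}) y :
  (forall v, v \in T -> v - B y v *: y \in T1) -> (\dim T <= (\dim T1).+1)%N.
Proof.
move=> hT; have sub : (T <= T1 + <[y]>)%VS.
  apply/subvP => v vT; rewrite -(subrK (B y v *: y) v).
  by apply: memv_add; [apply: hT|apply/memvZ/memv_line].
apply: leq_trans (dimvS sub) _; apply: leq_trans (dimv_add_leqif _ _).1 _.
by rewrite dim_vline addnC; case: (y != 0); rewrite ?add1n ?add0n ?leqnn.
Qed.

Lemma dim_radial_ge (T T1 : {vspace V}) y : q y = 1 ->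
  (T1 <= T)%VS -> y \in T -> (forall v, v \in T1 -> B y v = 0) ->
  ((\dim T1).+1 <= \dim T)%N.
Proof.
move=> qy T1T yT T1y.
have yN0 : y != 0.
  apply/eqP => y0; have := qZ 0 y; rewrite y0 scale0r -y0 qy expr0n /= mul0r.
  by move/eqP; rewrite oner_eq0.
have cap0 : (T1 :&: <[y]> = 0)%VS.
  apply/eqP; rewrite -subv0; apply/subvP => v; rewrite memv_cap => /andP[vT1 /vlineP[c vE]].
  have := T1y _ vT1; rewrite vE BZr -/(q y) qy mulr1 => ->.
  by rewrite scale0r mem0v.
have := dimv_disjoint_sum cap0; rewrite dim_vline yN0 addn1 => <-.
by apply: dimvS; rewrite subv_add T1T -memvE.
Qed.

Section UnitSection.
Variable C : set V.
Hypotheses (clC : zariski_closed C) (coneC : forall t z, C z -> C (t *: z)).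

Let Y := C `&` [set y | q y = 1].

Lemma unit_section_closed : zariski_closed Y.
Proof.
apply: zariski_closedI => //.
have := @zariski_closed_zero _ _ (fun z => q z - 1); rewrite (_ : [set _ | _] = [set y | q y = 1]).
  by apply; apply: polynomial_functionB => //; apply: polynomial_function_cst.
by apply/seteqP; split=> z /= => [/eqP|->]; rewrite ?subrr // subr_eq0 => /eqP.
Qed.

Lemma unit_section_opp y : Y y -> Y (- y).
Proof. by move=> [Cy qy]; rewrite -scaleN1r; split; [apply: coneC|rewrite /= qZ qy mulr1 sqrrN expr1n]. Qed.

Lemma unit_section_orthogonal S y v : S `<=` [set y | q y = 1] -> tangent_space S y v ->
  B y v = 0.
Proof.
move=> S1 /tangent_spaceP Tv.
have p1 : polynomial_function (fun _ : V => 1 : K) by apply: polynomial_function_cst.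
have := Tv _ (polynomial_functionB pq p1); rewrite directionalB // directional_cst.
rewrite directional_quadratic subr0 => /(_ _)/eqP h; apply/eqP; move: h.
by rewrite mulf_eq0 pnatr_eq0 /=; apply=> z /S1 /= ->; rewrite subrr.
Qed.

Lemma unit_section_tangent s y v : s != 0 -> Y y ->
  tangent_space C (s *: y) v -> tangent_space Y y (v - B y v *: y).
Proof.
move=> sN0 [Cy qy]; apply: radial_projection_tangent => //.
- exact: unit_section_opp.
- by move=> z [].
- move=> z t Cz qz tN0; split; first exact: coneC.
  by rewrite /= qZ qz -exprMn mulVf // expr1n.
- exact: coneC.
Qed.

Lemma cone_tangent s y v : s != 0 -> Y y ->
  tangent_space Y y v -> tangent_space C (s *: y) v.
Proof.
move=> sN0 Yy; apply: tangent_scale => // z [Cz _]; exact: coneC.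
Qed.

Lemma cone_tangent_dim s y : s != 0 -> Y y ->
  \dim (tangent_vspace C (s *: y)) = (\dim (tangent_vspace Y y)).+1.
Proof.
move=> sN0 Yy; have [Cy qy] := Yy; have Csy : C (s *: y) by apply: coneC.
apply/eqP; rewrite eqn_leq; apply/andP; split.
  apply: (@dim_radial_le _ _ y) => v /(tangent_vspaceP _ Csy) Tv.
  exact/(tangent_vspaceP _ Yy)/(unit_section_tangent sN0).
apply: (dim_radial_ge qy).
- apply/subvP => v /(tangent_vspaceP _ Yy) Tv.
  exact/(tangent_vspaceP _ Csy)/cone_tangent.
- by apply/(tangent_vspaceP _ Csy)/tangent_radial => t _; apply: coneC.
- move=> v /(tangent_vspaceP _ Yy); apply: unit_section_orthogonal => z [] //.
Qed.

(** If [Z] is an irreducible subset of the section then the cone over [Z] is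
   irreducible too, and its tangent spaces are those of [Z] enlarged by the radial
   direction. *)
Lemma nonsingular_cone s y : s != 0 -> nonsingular Y y -> nonsingular C (s *: y).
Proof.
move=> sN0 /nonsingular_irreducible[Z [Zirr ZY Zy hdim]]; have Yy := ZY _ Zy.
pose S := [set z | exists t z', [/\ Z z', t != 0 & z = t *: z']].
have SZ t z : Z z -> t != 0 -> S (t *: z) by move=> Zz tN0; exists t, z.
have clSirr : irreducible (affine_closure S).
  apply: irreducible_affine_closure; first by exists (s *: y); apply: SZ.
  move=> g1 g2 p1 p2 g12.
  pose A g := \bigcap_(t in [set t : K | t != 0]) [set z | g (t *: z) = 0].
  have clA g : polynomial_function g -> zariski_closed (A g).
    move=> pg; apply: zariski_closed_bigcap => t _; apply: zariski_closed_zero.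
    have lin : linear (fun w : V => t *: w) by move=> a u w; rewrite scalerDr !scalerA mulrC.
    exact: (polynomial_map_linear lin pg).
  have curve0 g z : polynomial_function g -> exists r : {poly K}, forall t, g (t *: z) = r.[t].
    move=> pg; have [r hr] := polynomial_function_curve pg 0 z.
    by exists r => t; rewrite -hr add0r.
  have [_ _ Zor] := Zirr.
  suff : Z `<=` A g1 `|` A g2.
    by move=> /(Zor _ _ (clA _ p1) (clA _ p2))[ZA|ZA]; [left|right] => _ [t [z [Zz tN0 ->]]]; apply: (ZA z Zz).
  move=> z Zz; have [[r1 e1] [r2 e2]] := (curve0 g1 z p1, curve0 g2 z p2).
  have : r1 * r2 * 'X = 0.
    apply: poly_eq0_fun => t; rewrite !hornerE -e1 -e2.
    by have [->|tN0] := eqVneq t 0; rewrite ?mulr0 // g12 ?mul0r //; apply: SZ.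
  move=> /eqP; rewrite !mulf_eq0 polyX_eq0 orbF => /orP[]/eqP r0; [left|right] => t _ /=.
    by rewrite e1 r0 horner0.
  by rewrite e2 r0 horner0.
have SC : affine_closure S `<=` C.
  by apply: affine_closure_min => // _ [t [z [/ZY[Cz _] _ ->]]]; apply: coneC.
have Ssy : affine_closure S (s *: y) by apply/sub_affine_closure/SZ.
apply: (nonsingular_dense (S := S) clSirr) => //; first exact: sub_affine_closure.
move=> _ [t [z [Zz tN0 ->]]]; rewrite cone_tangent_dim //.
have [Cz qz] := ZY _ Zz.
have Stz : affine_closure S (t *: z) by apply/sub_affine_closure/SZ.
apply: leq_trans (dim_radial_ge qz _ _ _); last first.
- by move=> v /(tangent_vspaceP _ Zz); apply: unit_section_orthogonal => w /ZY[].
- by apply/(tangent_vspaceP _ Stz)/tangent_radial => a aN0; apply/sub_affine_closure/SZ.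
- apply/subvP => v /(tangent_vspaceP _ Zz) Tv; apply/(tangent_vspaceP _ Stz).
  by apply: tangent_scale Tv => // w Zw; apply/sub_affine_closure/SZ.
- exact: hdim.
Qed.

(** By Zorn's lemma there is a minimal closed set which covers [S] together with
   its opposite: a chain of such sets has an intersection of the same kind. *)
Lemma minimal_half_cover S : exists A, [/\ zariski_closed A,
  forall y, S y -> A y \/ A (- y) &
  forall A', zariski_closed A' -> A' `<=` A ->
    (forall y, S y -> A' y \/ A' (- y)) -> A `<=` A'].
Proof.
pose P A := zariski_closed A /\ forall y, S y -> A y \/ A (- y).
pose R (a b : {A | P A}) : bool := `[< sval b `<=` sval a >].
have [||||[A [clA SA]] Amax] := @Zorn {A | P A} R.
- by move=> a; apply/asboolP.
- by move=> a b c /asboolP ba /asboolP cb; apply/asboolP => z /cb/ba.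
- move=> [a Pa] [b Pb] /asboolP ba /asboolP ab.
  have E : a = b by apply/seteqP.
  by move: Pa Pb {ba ab}; rewrite E => Pa Pb; congr exist; apply: Prop_irrelevance.
- move=> F totF; suff PF : P (\bigcap_(a in F) sval a).
    by exists (exist _ _ PF) => a Fa; apply/asboolP => z /(_ _ Fa).
  split; first by apply: zariski_closed_bigcap => -[a []].
  move=> y Sy; have [h|/existsNP[a /not_implyP[Fa nay]]] :=
    pselect (forall a, F a -> sval a y); first by left.
  right=> b Fb.
  have hb := (svalP b).2 y Sy; have ha := (svalP a).2 y Sy.
  have [/asboolP ba|/asboolP ab] := totF _ _ Fa Fb.
    by case: hb => // /ba.
  by case: ha => // /ab.
exists A; split=> // A' clA' A'A SA'.
have PA' : P A' by [].
have /(congr1 sval) /= -> // : exist _ A' PA' = exist _ A (conj clA SA).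
by apply: Amax; apply/asboolP.
Qed.

Lemma zariski_closed_opp (A : set V) : zariski_closed A -> zariski_closed [set z | A (- z)].
Proof.
move=> clA; have lin : linear (fun w : V => - w).
  by move=> a u w; rewrite opprD scalerN.
exact: (zariski_closed_preimage (polynomial_map_linear lin) clA).
Qed.

(** A symmetric set is separated from a point of the unit quadric by a
   homogeneous function, as the even and odd parts of a function vanishing on it
   vanish as well. *)
Lemma homogeneous_separation g y (E : set V) : polynomial_function g ->
  (forall z, E z -> E (- z)) -> E `<=` [set z | q z = 1] -> vanishes_on E g ->
  q y = 1 -> g y != 0 -> exists e H, [/\ polynomial_function H,
    homogeneous_of_degree e H, H y != 0 & vanishes_on E H].
Proof.
move=> pg Eopp E1 gE qy gy.
have [m [H0 [H1 [k [p0 p1 pk [h0 h1 gH]]]]]] := parity_homogenization pg.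
have HE z : E z -> H0 z = 0 /\ H1 z = 0.
  by move=> Ez; apply: (parity_vanishing h0 h1 gH); rewrite ?gE ?(E1 _ Ez) //; apply: Eopp.
have [H0y|H0y] := eqVneq (H0 y) 0; last first.
  by exists m.*2, H0; split=> // z /HE[].
exists m.*2.+1, H1; split=> // [|z /HE[] //].
by apply: contraNneq gy => H1y; rewrite gH H0y H1y qy subrr mul0r !addr0.
Qed.

(** The section is a double cover of an open part of the projectivized cone.  If
   [Z] is an irreducible subset of the cone, its radial
   projection [S] to the quadric is either irreducible or the union of two
   opposite irreducible halves.  A minimal closed [A] which covers [S] together
   with [- A] is such a half, and its tangent spaces are large enough because
   [A] coincides with [S] generically. *)
Lemma nonsingular_unit_section s y : s != 0 -> Y y ->
  nonsingular C (s *: y) -> nonsingular Y y.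
Proof.
move=> sN0 Yy /nonsingular_irreducible[Z [Zirr ZC Zsy hdim]].
pose S := [set z | q z = 1 /\ exists2 t, t != 0 & Z (t *: z)].
have SY : S `<=` Y.
  move=> z [qz [t tN0 /ZC Ctz]]; split=> //.
  by rewrite -[z](scalerK tN0); apply: coneC.
have Sopp z : S z -> S (- z).
  move=> [qz [t tN0 Ztz]]; split; first by rewrite -scaleN1r qZ sqrrN expr1n mul1r.
  by exists (- t); rewrite ?oppr_eq0 // scaleNr scalerN opprK.
have Sy : S y by case: Yy => _ qy; split=> //; exists s.
have [A [clA SA Amin]] := minimal_half_cover S.
(* By minimality the points of [S] in [A] are dense in [A]. *)
have AS : A `<=` affine_closure (S `&` A).
  apply: Amin; [exact: affine_closure_closed|by apply: affine_closure_min => // z []|].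
  move=> z Sz; have [Az|Az] := SA z Sz; [left|right]; apply: sub_affine_closure => //.
  by split=> //; apply: Sopp.
(* A covering of [S] by two closed symmetric sets is trivial: the radial
   projections of their traces on the quadric would otherwise decompose [Z]. *)
have cover A1 A2 : zariski_closed A1 -> zariski_closed A2 ->
    (forall z, S z -> (A1 z \/ A1 (- z)) \/ (A2 z \/ A2 (- z))) ->
    (forall z, S z -> A1 z \/ A1 (- z)) \/ (forall z, S z -> A2 z \/ A2 (- z)).
  move=> cl1 cl2 S12; pose half A' := [set z | (A' z \/ A' (- z)) /\ q z = 1].
  have sep A' : zariski_closed A' -> (forall z, S z -> A' z \/ A' (- z)) \/
      exists e H z0, [/\ polynomial_function H, homogeneous_of_degree e H,
        Z z0, H z0 != 0 & vanishes_on (half A') H].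
    move=> clA'; have [h|/existsNP[z /not_implyP[[qz [t tN0 Ztz]] nz]]] :=
      pselect (forall z, S z -> A' z \/ A' (- z)); first by left.
    right; have clU := zariski_closedU clA' (zariski_closed_opp clA').
    have [g [pg gU gz]] : exists g, [/\ polynomial_function g,
        vanishes_on (A' `|` [set z | A' (- z)]) g & g z != 0].
      apply: contrapT => h; apply: nz; apply: (affine_closure_min clU (@subset_refl _ _)) => g pg gU.
      by apply: contrapT => /eqP gz; apply: h; exists g.
    have [|||e [H [pH hH Hz HE]]] := @homogeneous_separation g z (half A') pg _ _ _ qz gz.
    - move=> w [h qw]; split; last by rewrite -scaleN1r qZ sqrrN expr1n mul1r.
      by rewrite opprK; case: h; [right|left].
    - by move=> w [].
    - by move=> w [h _]; apply: gU.
    exists e, H, (t *: z); split=> //.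
    by rewrite hH mulf_neq0 // expf_neq0.
  have [h|[e1 [H1 [z1 [p1 h1 Zz1 H1z1 HE1]]]]] := sep A1 cl1; first by left.
  have [h|[e2 [H2 [z2 [p2 h2 Zz2 H2z2 HE2]]]]] := sep A2 cl2; first by right.
  have [||] := irreducible_prime Zirr pq (polynomial_functionM p1 p2).
  - move=> z Zz; have [->|qz] := eqVneq (q z) 0; first by rewrite mul0r.
    have tN0 : sqrtC (q z) != 0 by rewrite sqrtC_eq0.
    have zE : z = sqrtC (q z) *: ((sqrtC (q z))^-1 *: z) by rewrite scalerA divff // scale1r.
    have Sz : S ((sqrtC (q z))^-1 *: z).
      split; first by rewrite qZ exprVn sqrtCK mulVf.
      by exists (sqrtC (q z)); rewrite -?zE.
    have qSz := Sz.1; rewrite [z in H1 z]zE [z in H2 z]zE h1 h2.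
    case: (S12 _ Sz) => h; first by rewrite (HE1 _ (conj h qSz)) !(mulr0, mul0r).
    by rewrite (HE2 _ (conj h qSz)) !mulr0.
  - move=> /(_ _ Zsy)/eqP; rewrite qZ (_ : q y = 1) ?mulr1; last by case: Yy.
    by rewrite expf_eq0 (negPf sN0).
  - move=> h; have [h'|h'] := irreducible_prime Zirr p1 p2 h.
      by have := h' _ Zz1 => /eqP; rewrite (negPf H1z1).
    by have := h' _ Zz2 => /eqP; rewrite (negPf H2z2).
have SAne : (S `&` A) !=set0.
  by have [Ay|Ay] := SA y Sy; [exists y|exists (- y); split=> //; apply: Sopp].
have Airr : irreducible A.
  have -> : A = affine_closure (S `&` A).
    by apply/seteqP; split=> //; apply: affine_closure_min => // z [].
  apply: irreducible_affine_closure => // g1 g2 p1 p2 g12.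
  have clI g : polynomial_function g -> zariski_closed (A `&` [set z | g z = 0]).
    by move=> pg; apply: zariski_closedI => //; apply: zariski_closed_zero.
  have one g : polynomial_function g ->
      (forall z, S z -> (A `&` [set z | g z = 0]) z \/ (A `&` [set z | g z = 0]) (- z)) ->
      vanishes_on (S `&` A) g.
    move=> pg hg z [_ Az].
    by have [] := Amin _ (clI g pg) _ hg z Az => // w [].
  have [|h|h] := cover _ _ (clI g1 p1) (clI g2 p2).
  - move=> z Sz; have hz w : S w -> A w -> g1 w = 0 \/ g2 w = 0.
      by move=> Sw Aw; have /eqP := g12 w (conj Sw Aw); rewrite mulf_eq0 => /orP[]/eqP; [left|right].
    have [Az|Az] := SA z Sz; first by have [?|?] := hz _ Sz Az; [left; left|right; left].
    by have [?|?] := hz _ (Sopp _ Sz) Az; [left; right|right; right].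
  - by left; apply: one.
  - by right; apply: one.
(* Near a general point [S] coincides with [A]. *)
pose S1 := [set z | [/\ S z, A z & forall v, tangent_space S z v -> tangent_space A z v]].
have AS1 : A `<=` affine_closure S1.
  have [AN|/existsNP[a /not_implyP[Aa Na]]] := pselect (forall z, A z -> A (- z)).
    move=> a Aa g pg gS1; apply: (AS _ Aa) => // z [Sz Az]; apply: gS1; split=> //.
    move=> v /tangent_spaceP Tv; apply/tangent_spaceP => f pf fA; apply: Tv => // w Sw.
    by have [/fA|/AN] := SA w Sw => //; rewrite opprK => /fA.
  have clN := zariski_closed_opp clA.
  have [h [ph hN ha]] : exists h, [/\ polynomial_function h,
      vanishes_on [set z | A (- z)] h & h a != 0].
    apply: contrapT => hh; apply: Na; apply: (affine_closure_min clN (@subset_refl _ _)) => g pg gU.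
    by apply: contrapT => /eqP ga; apply: hh; exists g.
  move=> b Ab g pg gS1.
  have [w Aw|/(_ _ Ab) //|/(_ _ Aa)/eqP] := irreducible_prime Airr pg ph; last by rewrite (negPf ha).
  apply: (AS _ Aw (fun z => g z * h z)); first exact: polynomial_functionM.
  move=> z [Sz Az]; have [->|hz] := eqVneq (h z) 0; first by rewrite mulr0.
  rewrite gS1 ?mul0r //; split=> // v /tangent_spaceP Tv; apply/tangent_spaceP => f pf fA.
  have fhS : vanishes_on S (fun z => f z * h z).
    by move=> u Su; have [/fA->|/hN->] := SA u Su; rewrite ?mul0r ?mulr0.
  have := Tv _ (polynomial_functionM pf ph) fhS; rewrite directionalM // (fA _ Az) mul0r addr0.
  by move=> /eqP; rewrite mulf_eq0 (negPf hz) orbF => /eqP.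
have AY : A `<=` Y.
  move=> a /AS; apply: (affine_closure_min unit_section_closed) => z [/SY].
  by [].
(* Either [y] or [- y] lies on [A]. *)
have main u : (u = y \/ u = - y) -> A u -> nonsingular Y u.
  move=> uE Au; apply: (nonsingular_dense (S := S1) Airr) => // [z []//|z [Sz Az TSA]].
  have [qz [t tN0 Ztz]] := Sz.
  have [r [rN0 ru]] : exists r, r != 0 /\ r *: u = s *: y.
    case: uE => ->; first by exists s.
    by exists (- s); rewrite oppr_eq0 scaleNr scalerN opprK.
  have := hdim _ Ztz; rewrite -ru (cone_tangent_dim rN0 (AY _ Au)) => le1.
  rewrite -ltnS; apply: leq_trans le1 _.
  apply: (@dim_radial_le _ _ z) => v /(tangent_vspaceP _ Ztz) Tv.
  apply/(tangent_vspaceP _ Az)/TSA.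
  apply: (radial_projection_tangent Sopp _ _ tN0 Ztz qz Tv); first by move=> w [].
  move=> w a Zw qw aN0; split; first by rewrite qZ qw -exprMn mulVf // expr1n.
  by exists a; rewrite // scalerA divff // scale1r.
have [Ay|ANy] := SA y Sy; first by apply: main => //; left.
have nsN := main _ (or_intror erefl) ANy.
have linN : linear (fun w : V => - w) by move=> a u w; rewrite opprD scalerN.
rewrite -[y]opprK; have pN := polynomial_map_linear linN.
apply: (nonsingular_image pN unit_section_closed unit_section_opp
  (polynomial_function_cst _ 1) (oner_neq0 _)) nsN.
  by move=> z v _ _ _; rewrite tangent_map_of_linear // => /eqP; rewrite oppr_eq0 => /eqP.
rewrite opprK; apply: (dim_le_injective linN) => v; last by move=> _ /eqP; rewrite oppr_eq0 => /eqP.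
move=> /(tangent_vspaceP _ Yy) Tv; apply/(tangent_vspaceP _ (unit_section_opp Yy)).
have := tangent_map_tangent pN unit_section_opp Tv.
by rewrite tangent_map_of_linear.
Qed.

End UnitSection.

End Cone.

(** * Generic transversality *)

Lemma meval_eq0 (K : numFieldType) n (p : {mpoly K[n]}) :
  (forall a : 'I_n -> K, p.@[a] = 0) -> p = 0.
Proof.
have [s] := ubnP (msize p); elim: s p => // s IHs p; rewrite ltnS => ps p0.
have [->//|pN0] := eqVneq p 0.
pose x i (v : 'rV[K]_n) : K := v 0 i.
have xlin i : scalar (x i) by move=> a u v; rewrite /x !mxE.
have p'0 i : p^`M(i) = 0.
  apply: IHs => [|a].
    apply: leq_ltn_trans (msize_mderiv p i) _.
    by apply: leq_trans ps; rewrite prednK // lt0n msize_poly_eq0.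
  have := directional_meval p (\row_j a j) (delta_mx 0 i)
    (fun j => polynomial_function_scalar (xlin j)).
  rewrite (_ : (fun w => _) = fun=> 0) ?directional_cst; last by apply/funext => w.
  rewrite (bigD1 i) //= big1 ?addr0 => [|j jNi]; last first.
    by rewrite (directional_scalar _ _ (xlin j)) /x mxE (negPf jNi) andbF mulr0.
  rewrite (directional_scalar _ _ (xlin i)) /x mxE !eqxx mulr1 => e.
  by rewrite [RHS]e; apply: meval_eq => j; rewrite mxE.
have pC := mderiv_eq0 p'0.
by have := p0 (fun=> 0); rewrite pC mevalC => ->; rewrite mpolyC0.
Qed.

Section Generic.
Variables (K : numFieldType) (W : vectType K).
Implicit Types (P Q : set W).

Lemma meval_coordinates_eq0 (p : {mpoly K[\dim {:W}]}) :
  (forall w : W, p.@[coordinates w] = 0) -> p = 0.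
Proof.
move=> p0; apply: meval_eq0 => a; rewrite -(p0 (\sum_i a i *: (vbasis {:W})`_i)).
by apply: meval_eq => i; rewrite /coordinates coord_sum_free // (basis_free (vbasisP _)).
Qed.

Lemma polynomial_function_mul_eq0 (g1 g2 : W -> K) : polynomial_function g1 ->
  polynomial_function g2 -> (forall w, g1 w * g2 w = 0) ->
  (forall w, g1 w = 0) \/ (forall w, g2 w = 0).
Proof.
move=> [p1 e1] [p2 e2] h; have : p1 * p2 = 0.
  by apply: meval_coordinates_eq0 => w; rewrite mevalM -e1 -e2 h.
by move=> /eqP; rewrite mulf_eq0 => /orP[]/eqP p0; [left|right] => w; rewrite ?e1 ?e2 p0 meval0.
Qed.

Lemma genericI P Q : generic P -> generic Q -> generic (P `&` Q).
Proof.
move=> [A [clA AT AP]] [A' [clA' AT' AQ]]; exists (A `|` A'); split.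
- exact: zariski_closedU.
- apply/eqP => U; have [S Spf AE] := clA; have [S' Spf' AE'] := clA'.
  have [g Sg [a ga]] : exists2 g, S g & exists a, g a != 0.
    apply: contrapT => h; case/eqP: AT; rewrite AE; apply/seteqP; split=> // w _ g Sg.
    by apply: contrapT => /eqP gw; apply: h; exists g => //; exists w.
  have [g' Sg' [a' ga']] : exists2 g, S' g & exists a, g a != 0.
    apply: contrapT => h; case/eqP: AT'; rewrite AE'; apply/seteqP; split=> // w _ g' Sg'.
    by apply: contrapT => /eqP gw; apply: h; exists g' => //; exists w.
  have [w|h|h] := polynomial_function_mul_eq0 (Spf _ Sg) (Spf' _ Sg').
  + have : (A `|` A') w by rewrite U.
    by rewrite AE AE' => -[/(_ _ Sg)->|/(_ _ Sg')->]; rewrite ?mul0r ?mulr0.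
  + by rewrite h eqxx in ga.
  + by rewrite h eqxx in ga'.
- by move=> w; rewrite setCU => -[/AP ? /AQ ?].
Qed.

Lemma genericS P Q : P `<=` Q -> generic P -> generic Q.
Proof. by move=> PQ [A [clA AT AP]]; exists A; split=> // w /AP/PQ. Qed.

Lemma generic_neq0 (g : W -> K) : polynomial_function g -> (exists w, g w != 0) ->
  generic [set w | g w != 0].
Proof.
move=> pg [w gw]; exists [set w | g w = 0]; split=> [||v /eqP //].
  exact: zariski_closed_zero.
by apply/eqP => U; have : [set w | g w = 0] w by [rewrite U]; move=> /= /eqP; rewrite (negPf gw).
Qed.

Lemma generic_not_dense P : (exists w, ~ affine_closure P w) -> generic (~` P).
Proof.
move=> [w Pw]; exists (affine_closure P); split.
- exact: affine_closure_closed.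
- by apply/eqP => U; apply: Pw; rewrite U.
- by apply: subsetC; apply: sub_affine_closure.
Qed.

Lemma eq_generic_card (T1 T2 : Type) (S1 : W -> set T1) (S2 : W -> set T2) P :
  generic P -> (forall w, P w -> (S1 w #= S2 w)%card) ->
  generic_card S1 = generic_card S2.
Proof.
move=> genP S12; rewrite /generic_card; congr (xget _ _); apply/seteqP.
split=> d /= /(genericI genP); apply: genericS => w /= [Pw].
  by apply: card_eq_trans; rewrite card_eq_sym; apply: S12.
by apply: card_eq_trans; apply: S12.
Qed.

End Generic.

Section GenericTransversality.
Variables (K : numFieldType) (W V : vectType K) (ev : W -> V -> K).
Hypothesis ev_polynomial : polynomial_function (fun p : (W * V)%type => ev p.1 p.2).
Hypothesis ev_scalar : forall x, scalar (ev^~ x).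
Hypothesis ev_separates : forall x, x != 0 -> exists f, ev f x != 0.

Lemma polynomial_function_ev f : polynomial_function (ev f).
Proof.
have pm : polynomial_map (fun x : V => (f, x) : (W * V)%type).
  apply: polynomial_map_scalar => l hl.
  have -> : (fun x => l (f, x)) = fun x : V => l (f, 0) + l (0, x).
    apply/funext => x; have := hl 1 (f, 0) (0, x); rewrite mul1r scale1r => <-.
    by congr l; rewrite -[RHS]/(f + 0, 0 + x) addr0 add0r.
  apply: polynomial_functionD; first exact: polynomial_function_cst.
  apply: polynomial_function_scalar => a u v; rewrite -hl.
  by congr l; rewrite -[RHS]/(a *: 0 + 0, a *: u + v) scaler0 addr0.
exact: (pm _ ev_polynomial).
Qed.

(** A Bertini-type theorem.  If it failed, [x] could be moved along with [f] in
   an arbitrary direction [l], with velocity [v] tangent to [C] and to [e = 0].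
   Differentiating [ev f x = 0] gives [ev l x = - D (ev f) x v = - c D e x v = 0]
   for every [l], which is absurd. *)
Lemma generic_transversality (C : set V) (e : V -> K) : polynomial_function e ->
  generic (~` [set f | exists x c, [/\ C x, x != 0, ev f x = 0, e x = 0 &
    forall v, tangent_space C x v -> directional (ev f) x v = c * directional e x v]]).
Proof.
move=> pe; set bad := [set f | _]; apply: generic_not_dense.
apply: contrapT => /forallNP dense.
pose T := [set p : (W * V)%type | exists c, [/\ C p.2, p.2 != 0, ev p.1 p.2 = 0, e p.2 = 0 &
    forall v, tangent_space C p.2 v -> directional (ev p.1) p.2 v = c * directional e p.2 v]].
have lin1 : linear (fun p : (W * V)%type => p.1) by [].
have lin2 : linear (fun p : (W * V)%type => p.2) by [].
have pm1 := polynomial_map_linear lin1; have pm2 := polynomial_map_linear lin2.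
pose g (i : 'I_(\dim {:W})) (p : (W * V)%type) := coord (vbasis {:W}) i p.1.
have pg i : polynomial_function (g i) by apply: (pm1 _ (polynomial_function_coord i)).
have [qs [pqs hqs]] := tangent_space_finite C.
pose ps : seq ((W * V)%type -> K) := [:: (fun p => ev p.1 p.2), (fun p => e p.2) &
  [seq (fun p : (W * V)%type => h p.2) | h <- qs]].
have gfree : alg_independent_on T g.
  split=> // P hP; apply: meval_coordinates_eq0 => w.
  have /contrapT/(_ (fun w => P.@[coordinates w])) := dense w; apply; first by exists P.
  by move=> f [x [c h]]; apply: (hP (f, x)); exists c.
have In_qs p : List.In p [seq (fun p : (W * V)%type => h p.2) | h <- qs] ->
    exists2 h, List.In h qs & p = (fun p => h p.2).
  elim: (qs) => //= h s IHs [<-|/IHs[h' h's ->]]; first by exists h => //; left.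
  by exists h' => //; right.
have qs_In h : List.In h qs ->
    List.In (fun p : (W * V)%type => h p.2) [seq (fun p : (W * V)%type => h p.2) | h <- qs].
  by elim: (qs) => //= h' s IHs [->|/IHs]; [left|right].
have [|[f x] [[c [/= Cx xN0 fx ex hf]] hv]] := generic_tangent (ps := ps) gfree.
  move=> p /= [<-|[<-|/In_qs[h /pqs[ph hC] ->]]].
  - by split=> // p' [c []].
  - by split=> [|p' [c []] //]; apply: (pm2 _ pe).
  - by split=> [|p' [c [? _ _ _ _]]]; [apply: (pm2 _ ph)|apply: hC].
have [l lx] := ev_separates xN0.
have [[v1 v2] [hps hg]] := hv (fun i => coordinates l i).
have v1E : v1 = l.
  rewrite (coord_vbasis (memvf v1)) [RHS](coord_vbasis (memvf l)).
  apply: eq_bigr => i _; congr (_ *: _); rewrite -[RHS]hg.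
  by rewrite directional_scalar //; apply: (fun a u v => coord_scalar i a u.1 v.1).
have d2 h : polynomial_function h ->
    directional (fun p : (W * V)%type => h p.2) (f, x) (v1, v2) = directional h x v2.
  by move=> ph; rewrite (chain_rule _ _ pm2 ph) tangent_map_of_linear.
have Tv2 : tangent_space C x v2.
  apply/hqs => // p pqs'; rewrite -(d2 _ (pqs _ pqs').1).
  by apply: hps; right; right; apply: qs_In.
have ev2 : directional e x v2 = 0 by rewrite -(d2 _ pe); apply: hps; right; left.
have := hps _ (or_introl erefl).
have -> : (v1, v2) = (v1, 0) + (0, v2) :> (W * V)%type.
  by rewrite -[RHS]/(v1 + 0, 0 + v2) addr0 add0r.
rewrite directional_add //.
have -> : directional (fun p => ev p.1 p.2) (f, x) (0, v2) = directional (ev f) x v2.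
  have [r hr] := polynomial_function_curve (polynomial_function_ev f) x v2.
  rewrite (directional_curve hr); apply: directional_curve => t /=.
  by rewrite scaler0 addr0 hr.
have -> : directional (fun p => ev p.1 p.2) (f, x) (v1, 0) = ev v1 x.
  rewrite -(directional_scalar f v1 (ev_scalar x)).
  have [r hr] := polynomial_function_curve (polynomial_function_scalar (ev_scalar x)) f v1.
  rewrite (directional_curve hr); apply: directional_curve => t /=.
  by rewrite scaler0 addr0 hr.
by rewrite (hf _ Tv2) ev2 mulr0 addr0 v1E => /eqP; rewrite (negPf lx).
Qed.

End GenericTransversality.

(** * The Veronese cone *)

Section PowerCoefficients.
Variables (K : numFieldType) (n : nat).

Lemma mderivX_power (p : {mpoly K[n]}) k j :
  (p ^+ k.+1)^`M(j) = p ^+ k * p^`M(j) *+ k.+1.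
Proof.
elim: k => [|k IHk]; first by rewrite expr1 expr0 mul1r.
rewrite exprS mderivM IHk -mulrnAr mulrA -exprS mulrnAr mulrC.
by rewrite [RHS]mulrS.
Qed.

(** The multinomial theorem, by comparing coefficients in a partial derivative of
   the power. *)
Lemma mcoeff_linear_power (a : 'I_n -> K) k m : mdeg m = k ->
  ((\sum_i a i *: 'X_i) ^+ k)@_m * (\prod_i (m i)`!)%:R =
  k`!%:R * \prod_i a i ^+ m i.
Proof.
pose l : {mpoly K[n]} := \sum_i a i *: 'X_i; rewrite -/l.
elim: k m => [|k IHk] m mk.
  have /eqP := mk; rewrite mdeg_eq0 => /eqP ->.
  rewrite expr0 mcoeff1 eqxx mul1r fact0 mul1r.
  by rewrite !big1 // => i _; rewrite mnm0E ?fact0 ?expr0.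
have [j mj] : exists j, m j != 0%N.
  apply: contrapT => h; have : mdeg m == 0%N.
    rewrite mdeg_eq0; apply/eqP/mnmP => i; rewrite mnm0E.
    by apply: contrapT => /eqP mi; apply: h; exists i.
  by rewrite mk.
pose m' := (m - U_(j))%MM; have mE : m = (m' + U_(j))%MM by rewrite submK ?lep1mP.
have m'k : mdeg m' = k by move: mk; rewrite mE mdegD mdeg1 addn1 => -[].
have l'j : l^`M(j) = (a j)%:MP.
  rewrite /l linear_sum (bigD1 j) //= big1 ?addr0.
    rewrite mderivZ mderivX mnm1E eqxx -{1}[U_(j)%MM]add0m addmK scale1r mpolyX0.
    by rewrite -[RHS]mulr1 mul_mpolyC.
  move=> i iNj; rewrite mderivZ mderivX mnm1E (negPf iNj).
  by rewrite scale0r scaler0.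
have := congr1 (mcoeff m') (mderivX_power l k j).
rewrite mcoeff_mderiv -mE l'j mulrC mul_mpolyC mcoeffMn mcoeffZ => e.
have -> : (\prod_i (m i)`! = (m' j).+1 * \prod_i (m' i)`!)%N.
  rewrite (bigD1 j) //= [in RHS](bigD1 j) //= mulnA -factS; congr (_`! * _)%N.
    by rewrite mE mnmDE mnm1E eqxx addn1.
  by apply: eq_bigr => i iNj; rewrite mE mnmDE mnm1E eq_sym (negPf iNj) addn0.
have -> : \prod_i a i ^+ m i = a j * \prod_i a i ^+ m' i.
  rewrite (bigD1 j) //= [in RHS](bigD1 j) //= mulrA -exprS; congr (_ ^+ _ * _).
    by rewrite mE mnmDE mnm1E eqxx addn1.
  by apply: eq_bigr => i iNj; rewrite mE mnmDE mnm1E eq_sym (negPf iNj) addn0.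
rewrite natrM mulrA (mulr_natr _ (m' j).+1) e factS natrM.
have := IHk m' m'k; set c := (l ^+ k)@_m'; set f := (\prod_i _)%N => eIH.
rewrite -(mulr_natl (a j * c)).
have -> : k.+1%:R * (a j * c) * f%:R = k.+1%:R * a j * (c * f%:R) by ring.
by rewrite eIH; ring.
Qed.

Lemma meval_homog (p : {mpoly K[n]}) d (a : 'I_n -> K) t :
  p \is d.-homog -> p.@[fun i => t * a i] = t ^+ d * p.@[a].
Proof.
move=> /dhomogP hp; rewrite !mevalE mulr_sumr big_seq [RHS]big_seq.
apply: eq_bigr => m /hp md; rewrite mulrCA; congr (_ * _).
have {}md : mdeg m = d := md.
by rewrite -md mdegE -prodrXr -big_split; apply: eq_bigr => i _; rewrite exprMn.
Qed.

End PowerCoefficients.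

Section Veronese.
Variables (K : numClosedFieldType) (n omega : nat).
Hypothesis omega_gt0 : (0 < omega)%N.
Local Notation V := 'rV[K]_n.+1.
Local Notation W := (dhomog n.+1 K omega).
Variables (A E : 'M[K]_n.+1).
Local Notation nu := (@veronese K n omega E).
Hypothesis hE : E *m A *m E^T = 1%:M.
Implicit Types (u v x y z : V) (f w : W).

Lemma unit_frame : E \in unitmx.
Proof. by move: hE; rewrite -mulmxA => /mulmx1_unit[]. Qed.

Lemma xcoord_scalar i : scalar (fun x => xcoord E x i).
Proof. by move=> a u v; rewrite /xcoord mulmxDl -scalemxAl !mxE. Qed.

Definition from_xcoord (a : 'I_n.+1 -> K) : V := (\row_i a i) *m E.

Lemma from_xcoordK a i : xcoord E (from_xcoord a) i = a i.
Proof. by rewrite /xcoord /from_xcoord mulmxK ?unit_frame // mxE. Qed.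

Lemma xcoord_inj x y : (forall i, xcoord E x i = xcoord E y i) -> x = y.
Proof.
move=> h; rewrite -[x](mulmxKV unit_frame) -[y](mulmxKV unit_frame); congr (_ *m _).
exact/rowP.
Qed.

Lemma xcoord0 i : xcoord E 0 i = 0.
Proof. by rewrite /xcoord mul0mx mxE. Qed.

Lemma xcoordZ t x i : xcoord E (t *: x) i = t * xcoord E x i.
Proof. by rewrite /xcoord -scalemxAl mxE. Qed.

Definition qpolar x y : K := \sum_i xcoord E x i * xcoord E y i.

Lemma qpolarC x y : qpolar x y = qpolar y x.
Proof. by apply: eq_bigr => i _; rewrite mulrC. Qed.

Lemma qpolar_scalar x : scalar (qpolar x).
Proof.
move=> a u v; rewrite /qpolar mulr_sumr -big_split /=; apply: eq_bigr => i _.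
by rewrite xcoord_scalar; ring.
Qed.

Lemma qform_polar x : qform A x = qpolar x x.
Proof.
have [a ->] : exists a, x = a *m E by exists (x *m invmx E); rewrite mulmxKV ?unit_frame.
rewrite /qform.
rewrite trmx_mul !mulmxA -(mulmxA a) -(mulmxA a) hE mulmx1 mxE.
by apply: eq_bigr => i _; rewrite [a^T _ _]mxE /xcoord mulmxK ?unit_frame.
Qed.

Definition form_at f x : K := (f : {mpoly K[n.+1]}).@[xcoord E x].

Lemma form_at_scalar x : scalar (form_at^~ x).
Proof. by move=> a f g; rewrite /form_at; rewrite linearP. Qed.

Lemma form_atZ f t x : form_at f (t *: x) = t ^+ omega * form_at f x.
Proof.
rewrite /form_at -(meval_homog _ _ (dhomog_is_dhomog f)).
by apply: meval_eq => i; rewrite xcoordZ.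
Qed.

Lemma form_at_veronese x y : form_at (nu x) y = qpolar x y ^+ omega.
Proof.
rewrite /form_at /= rmorphXn /= rmorph_sum /=; congr (_ ^+ _).
by apply: eq_bigr => i _; rewrite mevalZ mevalXU.
Qed.

Lemma veroneseZ t x : nu (t *: x) = t ^+ omega *: nu x.
Proof.
apply: val_inj => /=; rewrite -exprZn; congr (_ ^+ _); rewrite scaler_sumr.
by apply: eq_bigr => i _; rewrite xcoordZ scalerA.
Qed.

Lemma form_at_eq0 f : (forall x, form_at f x = 0) -> f = 0.
Proof.
move=> f0; apply: val_inj; apply: meval_eq0 => a; rewrite -(f0 (from_xcoord a)).
by apply: meval_eq => i; rewrite from_xcoordK.
Qed.

Lemma form_at_separates x : x != 0 -> exists f, form_at f x != 0.
Proof.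
move=> xN0; have [i xi] : exists i, xcoord E x i != 0.
  apply: contrapT => h; case/eqP: xN0; apply: xcoord_inj => i; rewrite xcoord0.
  by apply: contrapT => /eqP xi; apply: h; exists i.
exists (nu (from_xcoord (fun j => (j == i)%:R))); rewrite form_at_veronese expf_neq0 //.
rewrite /qpolar (bigD1 i) //= big1 => [|j jNi].
  by rewrite from_xcoordK eqxx mul1r addr0.
by rewrite from_xcoordK (negPf jNi) mul0r.
Qed.

Lemma monomial_expansion f :
  f = \sum_(m : 'X_{1..n.+1 < omega.+1} | mdeg m == omega)
        (f : {mpoly K[n.+1]})@_m *: insubd (0 : W) 'X_[m].
Proof.
apply: val_inj; rewrite /= linear_sum /=.
have fs : (msize (f : {mpoly K[n.+1]}) <= omega.+1)%N.
  rewrite msizeE; apply/bigmax_leqP_seq => m mf _.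
  by rewrite (dhomogP _ _ _ (dhomog_is_dhomog f) _ mf).
rewrite {1}(mpolywE fs) [RHS]big_mkcond /=; apply: eq_bigr => m _.
case: eqP => [mE|/eqP mE]; last first.
  by rewrite (dhomog_nemf_coeff (dhomog_is_dhomog f) mE) scale0r.
by rewrite insubdK // -topredE /= dhomogX; apply/eqP.
Qed.

Lemma mcoeff_scalar m : scalar (fun f : W => (f : {mpoly K[n.+1]})@_m).
Proof. by move=> a f g; rewrite !linearP. Qed.

Lemma form_at_polynomial : polynomial_function (fun p : (W * V)%type => form_at p.1 p.2).
Proof.
have -> : (fun p : (W * V)%type => form_at p.1 p.2) = fun p =>
    \sum_(m : 'X_{1..n.+1 < omega.+1} | mdeg m == omega)
      (p.1 : {mpoly K[n.+1]})@_m * form_at (insubd (0 : W) 'X_[m]) p.2.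
  apply/funext => -[f x] /=; rewrite {1}(monomial_expansion f).
  exact: (scalar_sum (form_at_scalar x)).
apply: polynomial_function_sum => m; apply: polynomial_functionM.
  by apply: polynomial_function_scalar => a u v; apply: (mcoeff_scalar m a u.1 v.1).
have lin2 : linear (fun p : (W * V)%type => p.2) by [].
apply: (polynomial_map_linear lin2); apply: polynomial_function_meval => i.
exact/polynomial_function_scalar/xcoord_scalar.
Qed.

Lemma polynomial_function_form_at f : polynomial_function (form_at f).
Proof.
by apply: polynomial_function_meval => i; apply/polynomial_function_scalar/xcoord_scalar.
Qed.

Lemma veronese_polynomial : polynomial_map nu.
Proof.
apply: polynomial_map_scalar => l hl.
have -> : (fun x => l (nu x)) = fun x =>
    \sum_(m : 'X_{1..n.+1 < omega.+1} | mdeg m == omega)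
      l (insubd (0 : W) 'X_[m]) *
      (omega`!%:R / (\prod_i (m i)`!)%:R * \prod_i xcoord E x i ^+ m i).
  apply/funext => x; rewrite {1}(monomial_expansion (nu x)) (scalar_sum hl).
  apply: eq_bigr => m /eqP mE; rewrite mulrC; congr (_ * _).
  have fN0 : (\prod_i (m i)`!)%:R != 0 :> K.
    by rewrite pnatr_eq0 -lt0n; apply: prodn_gt0 => i; apply: fact_gt0.
  apply: (mulIf fN0); rewrite (mcoeff_linear_power _ mE); field.
  exact: fN0.
apply: polynomial_function_sum => m; apply: polynomial_functionZ.
apply: polynomial_functionZ; apply: polynomial_function_prod => i.
exact/polynomial_functionX/polynomial_function_scalar/xcoord_scalar.
Qed.

(** The polar of a form at [y], a linear section of the Veronese map up to
   a scalar factor. *)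
Definition polar_at y f : V :=
  from_xcoord (fun i => omega%:R^-1 * ((f : {mpoly K[n.+1]})^`M(i)).@[xcoord E y]).

Let omegaN0 : omega%:R != 0 :> K.
Proof. by rewrite pnatr_eq0 -lt0n. Qed.

Lemma polar_at_linear y : linear (polar_at y).
Proof.
move=> a f g; apply: xcoord_inj => i; rewrite xcoord_scalar !from_xcoordK.
by rewrite !linearP; ring.
Qed.

Lemma polar_at_veronese y x : polar_at y (nu x) = qpolar x y ^+ omega.-1 *: x.
Proof.
apply: xcoord_inj => i; rewrite xcoordZ from_xcoordK.
have lE : (\sum_j xcoord E x j *: 'X_j : {mpoly K[n.+1]})^`M(i) = (xcoord E x i)%:MP.
  rewrite linear_sum (bigD1 i) //= big1 ?addr0.
    rewrite mderivZ mderivX mnm1E eqxx -{1}[U_(i)%MM]add0m addmK scale1r mpolyX0.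
    by rewrite -[RHS]mulr1 mul_mpolyC.
  by move=> j jNi; rewrite mderivZ mderivX mnm1E (negPf jNi) scale0r scaler0.
rewrite /= -[in X in X^`M(i)](prednK omega_gt0) mderivX_power lE.
rewrite prednK // mevalMn mevalM mevalC rmorphXn /= rmorph_sum /=.
rewrite -[X in _ * X]mulr_natl mulKf //; congr (_ ^+ _ * _).
by apply: eq_bigr => j _; rewrite mevalZ mevalXU.
Qed.

Lemma directional_form_at f y v :
  directional (form_at f) y v = omega%:R * qpolar (polar_at y f) v.
Proof.
rewrite directional_meval; last by move=> i; apply/polynomial_function_scalar/xcoord_scalar.
rewrite /qpolar mulr_sumr; apply: eq_bigr => i _.
rewrite (directional_scalar _ _ (xcoord_scalar i)) from_xcoordK.
by rewrite !mulrA mulfV // mul1r.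
Qed.

Lemma qpolar_polar_at y f : qpolar (polar_at y f) y = form_at f y.
Proof.
apply: (mulfI omegaN0); rewrite -directional_form_at.
by apply: euler => t z; apply: form_atZ.
Qed.

Lemma qpolar_separates x : x != 0 -> exists y, qpolar x y = 1.
Proof.
move=> xN0; have [i xi] : exists i, xcoord E x i != 0.
  apply: contrapT => h; case/eqP: xN0; apply: xcoord_inj => i; rewrite xcoord0.
  by apply: contrapT => /eqP xi; apply: h; exists i.
exists (from_xcoord (fun j => (j == i)%:R / xcoord E x i)).
rewrite /qpolar (bigD1 i) //= big1 => [|j jNi].
  by rewrite from_xcoordK eqxx mul1r addr0 divff.
by rewrite from_xcoordK (negPf jNi) mul0r mulr0.
Qed.

Lemma qpolar_scalarl y : scalar (qpolar^~ y).
Proof. by move=> a u v; rewrite !(qpolarC _ y) qpolar_scalar. Qed.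

Lemma qpolar0 y : qpolar 0 y = 0.
Proof. by rewrite /qpolar big1 // => i _; rewrite xcoord0 mul0r. Qed.

Lemma polar_tangent_veronese y z v : polar_at y (tangent_map nu z v) =
  (omega.-1%:R * qpolar z y ^+ omega.-2 * qpolar v y) *: z + qpolar z y ^+ omega.-1 *: v.
Proof.
apply: xcoord_inj => i.
have hl : scalar (fun f => xcoord E (polar_at y f) i).
  by move=> a f g; rewrite polar_at_linear xcoord_scalar.
rewrite (scalar_tangent_map _ _ veronese_polynomial hl).
have -> : (fun x => xcoord E (polar_at y (nu x)) i) =
    fun x => qpolar x y ^+ omega.-1 * xcoord E x i.
  by apply/funext => x; rewrite polar_at_veronese xcoordZ.
have pu := polynomial_function_scalar (qpolar_scalarl y).
have px := polynomial_function_scalar (xcoord_scalar i).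
rewrite directionalM //; last exact: polynomial_functionX.
rewrite directionalX // (directional_scalar _ _ (qpolar_scalarl y)).
by rewrite (directional_scalar _ _ (xcoord_scalar i)) xcoord_scalar xcoordZ.
Qed.

Lemma veronese_immersion y z v : qpolar z y != 0 -> tangent_map nu z v = 0 -> v = 0.
Proof.
move=> zy dv; have := polar_tangent_veronese y z v.
have -> : polar_at y (tangent_map nu z v) = 0.
  by rewrite dv; have := polar_at_linear y (-1) 0 0; rewrite scaler0 addr0 scaleN1r addNr.
have e1 : omega%:R = omega.-1%:R + 1 :> K by rewrite natr1 prednK.
have z1 : qpolar z y ^+ omega.-1 != 0 by rewrite expf_neq0.
move=> e; have := congr1 (qpolar^~ y) e; rewrite /= qpolar0 qpolar_scalarl => e2.
have vy : qpolar v y = 0.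
  move/esym/eqP: e2; have -> : qpolar (qpolar z y ^+ omega.-1 *: v) y =
      qpolar z y ^+ omega.-1 * qpolar v y.
    have := qpolar_scalarl y (qpolar z y ^+ omega.-1) v 0.
    by rewrite addr0 => ->; rewrite qpolar0 addr0.
  have [o1|o1] := eqVneq omega.-1 0%N.
    by rewrite o1 !mul0r add0r expr0 mul1r => /eqP.
  have -> : omega.-1%:R * qpolar z y ^+ omega.-2 * qpolar v y * qpolar z y +
      qpolar z y ^+ omega.-1 * qpolar v y = omega%:R * qpolar z y ^+ omega.-1 * qpolar v y.
    have eX : qpolar z y ^+ omega.-1 = qpolar z y * qpolar z y ^+ omega.-2.
      by rewrite -exprS prednK ?lt0n.
    by rewrite e1 eX; ring.
  by rewrite !mulf_eq0 (negPf omegaN0) (negPf z1) => /eqP.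
move/esym/eqP: e; rewrite vy mulr0 scale0r add0r scaler_eq0 (negPf z1) => /eqP.
exact.
Qed.

Section VeroneseCone.
Variable C : set V.
Hypotheses (clC : zariski_closed C) (coneC : forall t z, C z -> C (t *: z)) (C0 : C 0).

Definition veronese_cone : set W := [set w | exists2 x, C x & w = nu x].

Lemma polar_veronese_cone y w : veronese_cone w -> C (polar_at y w).
Proof. by move=> [x Cx ->]; rewrite polar_at_veronese; apply: coneC. Qed.

Lemma veronese_polar y w : veronese_cone w ->
  nu (polar_at y w) = form_at w y ^+ omega.-1 *: w.
Proof.
by move=> [x Cx ->]; rewrite polar_at_veronese veroneseZ form_at_veronese -!exprM mulnC.
Qed.

Lemma veronese_root t x : exists r, t *: nu x = nu (r *: x).
Proof. by exists (omega.-root t); rewrite veroneseZ rootCK. Qed.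

Lemma veronese0 : nu 0 = 0.
Proof. by rewrite -(scale0r (0 : V)) veroneseZ expr0n gtn_eqF // scale0r. Qed.

Lemma veronese_cone_closed : zariski_closed veronese_cone.
Proof.
rewrite (_ : veronese_cone = \bigcap_(y in setT)
    ([set w | nu (polar_at y w) = form_at w y ^+ omega.-1 *: w] `&` (polar_at y @^-1` C))).
  apply: zariski_closed_bigcap => y _.
  have pp := polynomial_map_linear (polar_at_linear y).
  apply: zariski_closedI; last exact: zariski_closed_preimage.
  apply: zariski_closed_eq; first by move=> g /veronese_polynomial/pp.
  apply: polynomial_map_scalar => l hl.
  have -> : (fun w => l (form_at w y ^+ omega.-1 *: w)) =
      fun w => form_at w y ^+ omega.-1 * l w.
    by apply/funext => w; have := scalar_sum hl [:: tt] xpredT (fun=> form_at w y ^+ omega.-1) (fun=> w); rewrite !big_seq1.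
  apply: polynomial_functionM; last exact: polynomial_function_scalar.
  exact/polynomial_functionX/polynomial_function_scalar/form_at_scalar.
apply/seteqP; split=> w.
  by move=> Nw y _; split; [apply: veronese_polar|apply: polar_veronese_cone].
move=> hw; have [->|wN0] := eqVneq w 0; first by exists 0; rewrite ?veronese0.
have [y wy] : exists y, form_at w y != 0.
  apply: contrapT => h; case/eqP: wN0; apply: form_at_eq0 => y.
  by apply: contrapT => /eqP wy; apply: h; exists y.
have [wE Cp] := hw y I; have cN0 : form_at w y ^+ omega.-1 != 0 by rewrite expf_neq0.
have [r rE] := veronese_root (form_at w y ^+ omega.-1)^-1 (polar_at y w).
exists (r *: polar_at y w); first exact: coneC.
by rewrite -rE wE scalerA mulVf // scale1r.
Qed.

Lemma veronese_in_cone x : C x -> veronese_cone (nu x).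
Proof. by exists x. Qed.

Lemma polar_at_unit x y : qpolar x y = 1 -> polar_at y (nu x) = x.
Proof. by move=> xy; rewrite polar_at_veronese xy expr1n scale1r. Qed.

Lemma veronese_cone_tangent_polar y w w' : veronese_cone w ->
  tangent_space veronese_cone w w' ->
  tangent_map nu (polar_at y w) (polar_at y w') =
  (omega.-1%:R * form_at w y ^+ omega.-2 * form_at w' y) *: w + form_at w y ^+ omega.-1 *: w'.
Proof.
move=> Nw /tangent_spaceP Tw'.
have ext (a b : W) : (forall i, coord (vbasis {:W}) i a = coord (vbasis {:W}) i b) -> a = b.
  move=> h; rewrite (coord_vbasis (memvf a)) (coord_vbasis (memvf b)).
  by apply: eq_bigr => i _; rewrite h.
apply: ext => i; pose l := coord (vbasis {:W}) i; rewrite -/l.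
have hl : scalar l := coord_scalar i.
have pl := polynomial_function_scalar hl.
have pc := polynomial_function_scalar (form_at_scalar y).
have pcX k : polynomial_function (fun w => form_at w y ^+ k) by apply: polynomial_functionX.
have pnu : polynomial_function (fun x => l (nu x)) := veronese_polynomial pl.
have pp := polynomial_map_linear (polar_at_linear y).
have ppol : polynomial_function (fun w => l (nu (polar_at y w))) := pp _ pnu.
have := Tw' (fun w => l (nu (polar_at y w)) - form_at w y ^+ omega.-1 * l w).
have -> : directional (fun w => l (nu (polar_at y w)) - form_at w y ^+ omega.-1 * l w) w w' =
    l (tangent_map nu (polar_at y w) (polar_at y w')) -
    (omega.-1%:R * form_at w y ^+ omega.-2 * form_at w' y * l w +
     form_at w y ^+ omega.-1 * l w').
  rewrite directionalB //; last exact: polynomial_functionM.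
  rewrite directionalM // directionalX // (directional_scalar _ _ hl).
  rewrite (directional_scalar _ _ (form_at_scalar y)).
  rewrite (chain_rule _ _ pp pnu) tangent_map_of_linear; last exact: polar_at_linear.
  by rewrite (scalar_tangent_map _ _ veronese_polynomial hl).
have lZ a b : l (a *: b) = a * l b by rewrite /l linearZ.
have lD a b : l (a + b) = l a + l b by rewrite /l linearD.
rewrite lD !lZ => h; apply/eqP; rewrite -subr_eq0; apply/eqP; apply: h.
  by apply: polynomial_functionB => //; apply: polynomial_functionM.
by move=> u Nu; rewrite veronese_polar // lZ subrr.
Qed.

Lemma polar_immersion y w w' : veronese_cone w -> form_at w y != 0 ->
  tangent_space veronese_cone w w' -> polar_at y w' = 0 -> w' = 0.
Proof.
move=> Nw wy Tw' p0; have := veronese_cone_tangent_polar y Nw Tw'.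
have -> : form_at w' y = 0 by rewrite -qpolar_polar_at p0 qpolar0.
rewrite p0 mulr0 scale0r add0r.
have -> : tangent_map nu (polar_at y w) 0 = 0.
  have := tangent_map_linear (polar_at y w) veronese_polynomial (-1) 0 0.
  by rewrite scaler0 addr0 scaleN1r addNr.
by move/esym/eqP; rewrite scaler_eq0 expf_eq0 (negPf wy) andbF => /eqP.
Qed.

Lemma polar_tangent x y w' : C x -> qpolar x y = 1 ->
  tangent_space veronese_cone (nu x) w' -> tangent_space C x (polar_at y w').
Proof.
move=> Cx xy Tw'; have lin := polar_at_linear y.
have := tangent_map_tangent (polynomial_map_linear lin) (@polar_veronese_cone y) Tw'.
by rewrite tangent_map_of_linear // polar_at_unit.
Qed.

(** Up to scalar factors which do not vanish near [x] and [nu x], the maps [nu]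
   and [polar_at y] are inverse to each other, so both of them are immersive
   there and identify the tangent spaces. *)
Lemma nonsingular_veronese x : C x -> x != 0 ->
  nonsingular veronese_cone (nu x) <-> nonsingular C x.
Proof.
move=> Cx xN0; have [y xy] := qpolar_separates xN0.
have Nx := veronese_in_cone Cx.
have pu := polynomial_function_scalar (qpolar_scalarl y).
have pc := polynomial_function_scalar (form_at_scalar y).
have pp := polynomial_map_linear (polar_at_linear y).
have oneN0 : (1 : K) != 0 := oner_neq0 K.
split=> ns.
  rewrite -(polar_at_unit xy).
  apply: (nonsingular_image pp clC (@polar_veronese_cone y) pc _ _ _ ns).
  - by rewrite form_at_veronese xy expr1n.
  - move=> w w' Nw wy Tw'; rewrite tangent_map_of_linear; last exact: polar_at_linear.
    exact: polar_immersion Tw'.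
  rewrite polar_at_unit //; apply: (dim_le_injective (tangent_map_linear x veronese_polynomial)).
    move=> v /(tangent_vspaceP _ Cx) Tv; apply/(tangent_vspaceP _ Nx).
    exact: tangent_map_tangent veronese_polynomial veronese_in_cone Tv.
  by move=> v _; apply: (veronese_immersion (y := y)); rewrite xy.
apply: (nonsingular_image veronese_polynomial veronese_cone_closed veronese_in_cone pu _ _ _ ns).
- by rewrite xy.
- by move=> z v _ zy _; apply: veronese_immersion zy.
apply: (dim_le_injective (polar_at_linear y)) => w' /(tangent_vspaceP _ Nx) Tw'.
  exact/(tangent_vspaceP _ Cx)/polar_tangent.
by apply: polar_immersion Tw' => //; rewrite form_at_veronese xy expr1n.
Qed.

Lemma tangent_veronese_cone x w' : C x -> x != 0 ->
  tangent_space veronese_cone (nu x) w' ->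
  exists2 v, tangent_space C x v & w' = tangent_map nu x v.
Proof.
move=> Cx xN0 Tw'; have [y xy] := qpolar_separates xN0.
have lin := tangent_map_linear x veronese_polynomial.
have dx : tangent_map nu x x = omega%:R *: nu x.
  rewrite [RHS](coord_vbasis (memvf _)); apply: eq_bigr => i _; congr (_ *: _).
  rewrite (@euler _ _ omega) ?linearZ // => t z.
  by rewrite veroneseZ linearZ.
pose c := omega.-1%:R * form_at w' y / omega%:R.
exists (- c *: x + polar_at y w').
  apply/(tangent_vspaceP _ Cx); apply: memvD.
    apply/memvZ/(tangent_vspaceP _ Cx).
    have := @tangent_radial _ _ C x 1; rewrite scale1r; apply=> t _; exact: coneC.
  exact/(tangent_vspaceP _ Cx)/polar_tangent.
rewrite lin dx -{2}(polar_at_unit xy) (veronese_cone_tangent_polar y (veronese_in_cone Cx) Tw').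
rewrite form_at_veronese xy !expr1n scale1r mulr1 addrA scalerA -scalerDl.
by rewrite /c mulNr divfK // addNr scale0r add0r.
Qed.

Section Critical.
Variable P : W -> W -> K.
Hypotheses (Psym : forall f g, P f g = P g f) (Plin : forall f, scalar (P f))
  (Prep : forall f x, P f (nu x) = form_at f x).

Let PD f g h : P f (g + h) = P f g + P f h.
Proof. by have := Plin f 1 g h; rewrite scale1r mul1r. Qed.

Let P0 f : P f 0 = 0.
Proof. by have := Plin f (-1) 0 0; rewrite scaler0 addr0 mulN1r addNr. Qed.

Let PZ f t g : P f (t *: g) = t * P f g.
Proof. by have := Plin f t g 0; rewrite addr0 P0 addr0. Qed.

Lemma squared_distance_differential f w w' :
  differential (fun w => P (w - f) (w - f)) w w' 0 <-> P (w - f) w' = 0.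
Proof.
have D : differential (fun w => P (w - f) (w - f)) w w' (2 * P (w - f) w').
  exists ((P (w - f) (w - f))%:P + (2 * P (w - f) w') *: 'X + P w' w' *: 'X^2).
    move=> t; rewrite addrAC; move: (w - f) => d.
    rewrite PD PZ !(Psym (d + _)) !PD !PZ (Psym w' d).
    rewrite !hornerD !hornerZ hornerC hornerX hornerXn; ring.
  by rewrite !derivD derivC !derivZ derivX derivXn !hornerE ?mul0rn ?mulr0 ?addr0.
split=> [/directionalE h|Pw]; last by rewrite Pw mulr0 in D.
by move/eqP: (directionalE D); rewrite h eq_sym mulf_eq0 pnatr_eq0 => /eqP.
Qed.

(** By the reproducing property of the pairing, the first-order condition for
   the distance to [f] at [nu x] reads [D f = omega q^(omega-1) <x, .>]. *)
Lemma critical_veronese f x : C x -> x != 0 ->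
  (forall w', tangent_space veronese_cone (nu x) w' ->
     differential (fun w => P (w - f) (w - f)) (nu x) w' 0) <->
  (forall v, tangent_space C x v -> directional (form_at f) x v =
     omega%:R * qpolar x x ^+ omega.-1 * qpolar x v).
Proof.
move=> Cx xN0.
have key v : P (nu x - f) (tangent_map nu x v) =
    omega%:R * qpolar x x ^+ omega.-1 * qpolar x v - directional (form_at f) x v.
  rewrite (scalar_tangent_map _ _ veronese_polynomial (Plin _)).
  rewrite (_ : (fun z => _) = form_at (nu x - f)); last exact/funext.
  rewrite !directional_form_at -mulrA -mulrBr; congr (_ * _).
  have -> : polar_at x (nu x - f) = -1 *: polar_at x f + polar_at x (nu x).
    by rewrite -polar_at_linear scaleN1r addrC.
  rewrite polar_at_veronese qpolar_scalarl addrC mulN1r; congr (_ - _).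
  have := qpolar_scalarl v (qpolar x x ^+ omega.-1) x 0.
  by rewrite addr0 qpolar0 addr0.
split=> h v Tv.
  have := h _ (tangent_map_tangent veronese_polynomial veronese_in_cone Tv).
  by move=> /squared_distance_differential; rewrite key => /eqP; rewrite subr_eq0 => /eqP.
have [u Tu ->] := tangent_veronese_cone Cx xN0 Tv.
by apply/squared_distance_differential; rewrite key h // subrr.
Qed.

End Critical.
End VeroneseCone.

End Veronese.

(** * Eigenpoints and critical points *)

Section Lines.
Variables (K : numFieldType) (W : vectType K).
Implicit Types (L : projective_space W) (w : W) (X : set (projective_space W)).

Lemma line_through w : w != 0 -> exists L : projective_space W, val L = <[w]>%VS.
Proof.
move=> wN0; have h : \dim <[w]> == 1%N by rewrite dim_vline wN0.
by exists (exist (fun L : {vspace W} => \dim L == 1%N) _ h).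
Qed.

Lemma line_spanned L w : w \in val L -> w != 0 -> val L = <[w]>%VS.
Proof.
move=> wL wN0; apply/esym/eqP; rewrite eqEdim -memvE wL dim_vline wN0.
by rewrite (eqP (valP L)).
Qed.

Lemma line_generator L : exists2 w, w \in val L & w != 0.
Proof.
exists (vpick (val L)); rewrite ?memv_pick // vpick0.
by apply/eqP => L0; have := valP L; rewrite L0 dimv0.
Qed.

Lemma homogeneous_functionZ d (g : W -> K) t w :
  homogeneous_function d g -> g (t *: w) = t ^+ d * g w.
Proof.
move=> [h hh hE]; rewrite !hE -(meval_homog _ _ hh).
by apply: meval_eq => i; rewrite /coordinates linearZ.
Qed.

Lemma affine_cone_closed X : projective_variety X -> X !=set0 -> zariski_closed (affine_cone X).
Proof.
move=> [S Shom XE] [L0 XL0]; exists S; first by move=> g /Shom[d [h _ hE]]; exists h.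
rewrite XE in XL0 *; apply/seteqP; split=> w.
  by move=> [L XL wL] g Sg; apply: XL.
move=> /= Sw; have [->|wN0] := eqVneq w 0; first by exists L0; rewrite ?mem0v.
have [L LE] := line_through wN0; exists L; last by rewrite LE memv_line.
move=> g Sg v; rewrite LE => /vlineP[t ->]; have [d hg] := Shom _ Sg.
by rewrite (homogeneous_functionZ _ _ hg) Sw // mulr0.
Qed.

Lemma affine_coneZ X t w : affine_cone X w -> affine_cone X (t *: w).
Proof. by move=> [L XL wL]; exists L => //; apply: memvZ. Qed.

Lemma zariski_closure_variety X : projective_variety (zariski_closure X).
Proof.
exists [set g | (exists d, homogeneous_function d g) /\
    forall L, zariski_closure X L -> forall w, w \in val L -> g w = 0].
  by move=> g [].
apply/seteqP; split=> L; first by move=> XL g [_]; apply.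
move=> hL Y [varY XY]; have [S Shom YE] := varY.
rewrite YE => g Sg; apply: hL; split; first exact: Shom.
by move=> L' /(_ Y (conj varY XY)); rewrite YE; apply.
Qed.

End Lines.

Section RayleighRitzDistance.
Variables (K : numClosedFieldType) (n omega : nat).
Hypothesis omega_gt0 : (0 < omega)%N.
Local Notation V := 'rV[K]_n.+1.
Local Notation W := (dhomog n.+1 K omega).
Variables (A E : 'M[K]_n.+1).
Hypothesis hE : E *m A *m E^T = 1%:M.
Local Notation nu := (@veronese K n omega E).
Local Notation B := (@qpolar K n E).
Local Notation ev := (@form_at K n omega E).
Variable P : W -> W -> K.
Hypotheses (Psym : forall f g, P f g = P g f) (Plin : forall f, scalar (P f))
  (Prep : forall f x, P f (nu x) = ev f x).
Variable X : set (projective_space V).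
Hypotheses (varX : projective_variety X) (X0 : X !=set0).
Local Notation C := (affine_cone X).
Local Notation Y := (C `&` [set y | B y y = 1]).
Local Notation vX := (@veronese_image K n omega E X).
Local Notation N := (@veronese_cone K n omega E C).
Local Notation dist f := (fun w : W => P (w - f) (w - f)).
Implicit Types (x y v : V) (f w : W).

Let clC : zariski_closed C := affine_cone_closed varX X0.
Let coneC t x : C x -> C (t *: x) := @affine_coneZ _ _ X t x.

Let C0 : C 0.
Proof. by have [L XL] := X0; exists L; rewrite ?mem0v. Qed.

Let BZZ t x : B (t *: x) (t *: x) = t ^+ 2 * B x x.
Proof.
have h u v : B u (t *: v) = t * B u v.
  by have := scalar_sum (qpolar_scalar E u) [:: tt] xpredT (fun=> t) (fun=> v); rewrite !big_seq1.
by rewrite h (qpolarC E (t *: x)) h mulrA.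
Qed.

Lemma unit_quadricE : affine_quadric A = [set y | B y y = 1].
Proof. by apply/seteqP; split=> y /=; rewrite /affine_quadric /= (qform_polar hE). Qed.

Lemma affine_cone_veronese : affine_cone vX = N.
Proof.
apply/seteqP; split=> w.
  move=> [M [L [XL [x LE ME]]]]; rewrite ME => /vlineP[t ->].
  have [r ->] := veronese_root omega_gt0 E t x; exists (r *: x) => //; apply: coneC.
  by exists L; rewrite ?LE ?memv_line.
move=> [x Cx ->]; suff main z : C z -> z != 0 -> affine_cone vX (nu z).
  have [->|] := eqVneq x 0; last exact: main.
  have [L XL] := X0; have [z zL zN0] := line_generator L.
  have := affine_coneZ 0 (main z (ex_intro2 _ _ L XL zL) zN0).
  by rewrite scale0r (veronese0 omega_gt0 E).
move=> {x Cx} [L XL zL] zN0.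
have nuN0 : nu z != 0.
  apply/eqP => nu0; have [f] := form_at_separates omega hE zN0.
  by rewrite -Prep nu0; have := Plin f (-1) 0 0; rewrite scaler0 addr0 mulN1r addNr => ->; rewrite eqxx.
have [M ME] := line_through nuN0; exists M; last by rewrite ME memv_line.
by exists L; split=> //; exists z => //; apply: line_spanned.
Qed.

Let tangent_self x : C x -> tangent_space C x x.
Proof.
by move=> Cx; have := @tangent_radial _ _ C x 1; rewrite scale1r; apply=> t _; apply: coneC.
Qed.

Let pev f := polynomial_function_form_at E f.
Let homev f : homogeneous_of_degree omega (ev f) := form_atZ E f.

Let euler_ev f y : directional (ev f) y y = omega%:R * ev f y.
Proof. exact: euler. Qed.

(** The tangent space of the cone is spanned by that of its unit section and by the
   radial direction, where Euler's relation applies. *)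
Lemma critical_directional f s y : s != 0 -> Y y ->
  (forall v, tangent_space Y y v -> directional (ev f) y v = 0) ->
  forall v, tangent_space C (s *: y) v ->
    directional (ev f) y v = omega%:R * ev f y * B y v.
Proof.
move=> sN0 Yy crit v Tv.
have := crit _ (unit_section_tangent (qpolarC E) (qpolar_scalar E) coneC sN0 Yy Tv).
rewrite -scaleNr directional_add // directional_scale // euler_ev => /eqP.
by rewrite mulNr subr_eq0 => /eqP ->; ring.
Qed.

(** With [s ^+ omega = f(y)] the point of the Veronese cone is [nu (s y)].  On the
   tangent space of the cone at [s y], spanned by [y] and its orthogonal part,
   the two first-order conditions differ by the radial one, which Euler's
   relation reduces to this choice of [s]. *)
Lemma critical_correspondence f y : Y y -> ev f y != 0 ->
  Crit (ev f) Y y <-> Crit (dist f) N (ev f y *: nu y).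
Proof.
move=> Yy fy; have [Cy qy] := Yy.
pose s := omega.-root (ev f y).
have sw : s ^+ omega = ev f y by rewrite rootCK.
have sN0 : s != 0 by apply: contraNneq fy => s0; rewrite -sw s0 expr0n gtn_eqF.
have yN0 : y != 0.
  by apply: contra_eqN qy => /eqP ->; rewrite qpolar0 eq_sym oner_eq0.
have syN0 : s *: y != 0 by rewrite scaler_eq0 negb_or sN0.
have Csy : C (s *: y) := coneC s Cy.
rewrite -sw -veroneseZ.
have ns : nonsingular Y y <-> nonsingular N (nu (s *: y)).
  rewrite (nonsingular_veronese omega_gt0 hE clC coneC C0 Csy syN0).
  split; first exact: (nonsingular_cone (qpolarC E) (qpolar_scalar E) clC coneC sN0).
  exact: (nonsingular_unit_section (qpolarC E) (qpolar_scalar E) clC coneC sN0 Yy).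
have eqn v : directional (ev f) (s *: y) v =
      omega%:R * B (s *: y) (s *: y) ^+ omega.-1 * B (s *: y) v <->
    directional (ev f) y v = omega%:R * ev f y * B y v.
  have e1 := directional_homogeneous s y v (pev f) (homev f).
  have BZl : B (s *: y) v = s * B y v.
    by have := scalar_sum (qpolar_scalarl E v) [:: tt] xpredT (fun=> s) (fun=> y); rewrite !big_seq1.
  have e2 : s * (omega%:R * B (s *: y) (s *: y) ^+ omega.-1 * B (s *: y) v) =
      s ^+ omega * (omega%:R * ev f y * B y v).
    rewrite BZZ qy mulr1 BZl -sw -exprM mul2n -addnn exprD.
    have -> : s ^+ omega = s * s ^+ omega.-1 by rewrite -exprS prednK.
    by ring.
  have swN0 : s ^+ omega != 0 by rewrite expf_neq0.
  split=> h.
    by apply: (mulfI swN0); rewrite -e1 h e2.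
  by apply: (mulfI sN0); rewrite e1 h e2.
split=> -[/ns ns' crit]; split=> //.
  apply/(critical_veronese omega_gt0 hE coneC Psym Plin Prep f Csy syN0) => v Tv.
  apply/eqn; apply: (critical_directional sN0 Yy) Tv => u Tu.
  exact/(differentialP _ _ _ (pev f))/crit.
move=> v Tv; apply/(differentialP _ _ _ (pev f)).
move/(critical_veronese omega_gt0 hE coneC Psym Plin Prep f Csy syN0): crit.
move=> /(_ v (cone_tangent coneC sN0 Yy Tv)) /eqn ->.
by rewrite (unit_section_orthogonal (qpolarC E) (qpolar_scalar E) _ Tv) ?mulr0 // => z [].
Qed.

(** For [e = 0] these are the forms whose zero locus is tangent to the cone.  For
   [e = q] they include the forms [f] for which the distance from [f] has a
   critical point [nu x] with [x] isotropic. *)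
Definition degenerate_forms (e : V -> K) : set W :=
  [set f | exists x c, [/\ C x, x != 0, ev f x = 0, e x = 0 &
    forall v, tangent_space C x v -> directional (ev f) x v = c * directional e x v]].

Lemma eigenpoint_nonzero f y : ~ degenerate_forms (fun=> 0) f ->
  Crit (ev f) Y y -> ev f y != 0.
Proof.
move=> fgood [[Yy _] crit]; apply: contra_notN fgood => /eqP fy.
have [Cy qy] := Yy; exists y, 0; split=> // [|v Tv].
  by apply: contra_eqN qy => /eqP ->; rewrite qpolar0 eq_sym oner_eq0.
rewrite directional_cst mulr0.
rewrite (critical_directional (oner_neq0 _) Yy) ?scale1r ?fy ?mulr0 ?mul0r //.
by move=> u /crit/(differentialP _ _ _ (pev f)).
Qed.

(** The origin is excluded by [x0], since the ray through [nu x0] is tangent to the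
   cone at the origin.  A critical point [nu x] satisfies [f(x) = q(x)^omega] by
   Euler's relation, so it can be normalized unless [x] is isotropic. *)
Lemma critical_point_form x0 f w : C x0 -> ev f x0 != 0 ->
  ~ degenerate_forms (fun x => B x x) f -> Crit (dist f) N w ->
  exists y, [/\ Y y, ev f y != 0 & w = ev f y *: nu y].
Proof.
move=> Cx0 fx0 fgood [[[x Cx ->] _] crit].
have [xE|xN0] := eqVneq x 0.
  case/negP: fx0; rewrite -oppr_eq0; apply/eqP.
  have Nt t : t != 0 -> N (t *: nu x0).
    move=> _; have [r ->] := veronese_root omega_gt0 E t x0.
    by apply: veronese_in_cone; apply: coneC.
  have T0 := @tangent_radial _ _ N (nu x0) 0 Nt; rewrite scale0r in T0.
  have nu0 := veronese0 omega_gt0 E.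
  have := crit (nu x0); rewrite xE nu0 => /(_ T0)/(squared_distance_differential Psym Plin).
  rewrite sub0r Psym => e; rewrite -e -scaleN1r.
  have := scalar_sum (Plin (nu x0)) [:: tt] xpredT (fun=> -1) (fun=> f).
  by rewrite !big_seq1 => ->; rewrite Psym Prep mulN1r.
move/(critical_veronese omega_gt0 hE coneC Psym Plin Prep f Cx xN0): crit => crit.
have oN0 : omega%:R != 0 :> K by rewrite pnatr_eq0 -lt0n.
have fx : ev f x = B x x ^+ omega.
  have := crit x (tangent_self Cx); rewrite euler_ev -mulrA -exprSr prednK //.
  exact: mulfI.
have [qx|qx] := eqVneq (B x x) 0.
  case: fgood; exists x, (omega%:R * B x x ^+ omega.-1 / 2); split=> //.
    by rewrite fx qx expr0n gtn_eqF.
  move=> v Tv; rewrite crit // (directional_quadratic (qpolarC E) (qpolar_scalar E)).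
  by rewrite mulrA divfK ?pnatr_eq0.
pose s := sqrtC (B x x); have sN0 : s != 0 by rewrite sqrtC_eq0.
have fy : ev f (s^-1 *: x) = s ^+ omega.
  rewrite form_atZ fx -[B x x]sqrtCK -/s -exprM mulnC exprM exprVn.
  by rewrite expr2 mulKf ?expf_neq0.
exists (s^-1 *: x); split.
- split; first exact: coneC.
  by rewrite /= BZZ exprVn sqrtCK mulVf.
- by rewrite fy expf_neq0.
- by rewrite fy -veroneseZ scalerA divff // scale1r.
Qed.

Lemma veronese_line_inj a b x y : a != 0 -> b != 0 -> x != 0 -> y != 0 ->
  a *: nu x = b *: nu y -> <[x]>%VS = <[y]>%VS.
Proof.
move=> aN0 bN0 xN0 yN0 e; have [z xz] := qpolar_separates hE xN0.
have := congr1 (polar_at E z) e.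
have pZ t f : polar_at E z (t *: f) = t *: polar_at E z f.
  have lin := @polar_at_linear K n omega A E hE z.
  have p0 : polar_at E z (0 : W) = 0.
    by have := lin (-1) 0 0; rewrite scaler0 addr0 scaleN1r addNr.
  by have := lin t f 0; rewrite !addr0 p0 addr0.
rewrite !pZ !(polar_at_veronese omega_gt0 hE) xz expr1n scale1r scalerA.
set c := b * _ => axy.
have xE : x = (a^-1 * c) *: y by rewrite -scalerA -axy scalerA mulVf // scale1r.
have tN0 : a^-1 * c != 0 by apply: contraNneq xN0 => t0; rewrite xE t0 scale0r.
apply/eqP; rewrite eqEdim !dim_vline xN0 yN0 leqnn andbT -memvE xE.
by apply/memvZ/memv_line.
Qed.

(** The bijection maps the class of a unit vector [y] to [f(y) nu(y)], which does
   not depend on the sign of [y]. *)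
Lemma eigenpoint_card f x0 : C x0 -> ev f x0 != 0 ->
  ~ degenerate_forms (fun=> 0) f -> ~ degenerate_forms (fun x => B x x) f ->
  (eigenpoint A E X f #= Crit (dist f) N)%card.
Proof.
move=> Cx0 fx0 good0 goodq.
have eigE L : eigenpoint A E X f L <-> exists2 y, val L = <[y]>%VS & Crit (ev f) Y y.
  by rewrite /eigenpoint /= unit_quadricE.
pose rep (L : projective_space V) := xget 0 [set y | val L = <[y]>%VS /\ B y y = 1].
pose F L := ev f (rep L) *: nu (rep L).
have unitN0 y : B y y = 1 -> y != 0.
  by move=> qy; apply: contra_eqN qy => /eqP ->; rewrite qpolar0 eq_sym oner_eq0.
have FE L y : val L = <[y]>%VS -> B y y = 1 -> F L = ev f y *: nu y.
  move=> Ly qy; rewrite /F /rep; case: xgetP => [z _ [Lz qz]|/(_ y) []]; last by split.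
  have : z \in <[y]>%VS by rewrite -Ly Lz memv_line.
  move=> /vlineP[t zE]; have t2 : t ^+ 2 = 1.
    by move: qz; rewrite zE BZZ qy mulr1.
  rewrite zE form_atZ veroneseZ scalerA mulrAC -exprD addnn -mul2n exprM t2 expr1n.
  by rewrite mul1r.
rewrite card_eq_sym (_ : Crit _ _ = [set F L | L in eigenpoint A E X f]).
  apply: inj_card_eq => L L'; rewrite !inE => /eigE[y Ly Cy] /eigE[y' Ly' Cy'].
  have [[Yy _] _] := Cy; have [[Yy' _] _] := Cy'.
  have qy : B y y = 1 by case: Yy. have qy' : B y' y' = 1 by case: Yy'.
  rewrite (FE L y) // (FE L' y') // => e; apply: val_inj; rewrite Ly Ly'.
  by apply: veronese_line_inj e; rewrite ?unitN0 //; apply: eigenpoint_nonzero.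
apply/seteqP; split=> w.
  move=> Cw; have [y [Yy fy wE]] := critical_point_form Cx0 fx0 goodq Cw.
  have qy : B y y = 1 by case: Yy.
  have [L LE] := line_through (unitN0 _ qy); exists L; last by rewrite (FE L y).
  apply/eigE; exists y => //; apply/(critical_correspondence Yy fy).
  by rewrite -wE.
move=> [L /eigE[y Ly Cy] <-]; have [[Yy _] _] := Cy.
have qy : B y y = 1 by case: Yy.
rewrite (FE L y) //; apply/critical_correspondence => //.
exact: eigenpoint_nonzero.
Qed.

Lemma rayleigh_ritz_distance_nonempty :
  RRdeg omega A E X = DD vX (fun w => P w w).
Proof.
have [L XL] := X0; have [x0 x0L x0N0] := line_generator L.
have Cx0 : C x0 by exists L.
have gen e : polynomial_function e -> generic (~` degenerate_forms e).
  apply: generic_transversality; last exact: (form_at_separates omega hE).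
    exact: form_at_polynomial.
  exact: form_at_scalar.
rewrite /RRdeg /DD affine_cone_veronese.
apply: (eq_generic_card (P := (~` degenerate_forms (fun=> 0) `&`
  ~` degenerate_forms (fun x => B x x)) `&` [set f | ev f x0 != 0])).
  apply: genericI.
    apply: genericI; apply: gen; first exact: polynomial_function_cst.
    exact: (polynomial_function_quadratic (qpolarC E) (qpolar_scalar E)).
  apply: generic_neq0; last exact: (form_at_separates omega hE).
  exact/polynomial_function_scalar/form_at_scalar.
by move=> f [[good0 goodq] /= fx0]; apply: eigenpoint_card fx0 _ _.
Qed.

End RayleighRitzDistance.

(** * The Bombieri-Weyl pairing *)

Lemma rayleigh_ritz_distance_empty (K : numFieldType) (n omega : nat)
    (A E : 'M[K]_n.+1) (p : dhomog n.+1 K omega -> K) :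
  RRdeg omega A E set0 = DD (veronese_image E set0) p.
Proof.
rewrite /RRdeg /DD; apply: (eq_generic_card (P := setT)).
  exists set0; split=> //.
    exists [set fun=> 1]; first by move=> _ ->; apply: polynomial_function_cst.
    by apply/seteqP; split=> w //= /(_ _ erefl)/eqP; rewrite oner_eq0.
  by apply/eqP => /seteqP[_ /(_ 0 I)].
have cone0 (W : vectType K) : affine_cone (set0 : set (projective_space W)) = set0.
  by apply/seteqP; split=> // w [].
have vero0 : veronese_image E set0 = set0 :> set (projective_space (dhomog n.+1 K omega)).
  by apply/seteqP; split=> // M [L []].
move=> f _; rewrite vero0 cone0.
have -> : eigenpoint A E set0 f = set0.
  by apply/seteqP; split=> // L [psi _ [[[+ _] _] _]]; rewrite cone0.
have -> : Crit (fun w => p (w - f)) set0 = set0.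
  by apply/seteqP; split=> // w [[]].
by rewrite card_eq0.
Qed.

Section BombieriWeyl.
Variables (R : realType) (n omega : nat).
Local Notation K := R[i].
Local Notation W := (dhomog n.+1 K omega).

Definition bw_pairing (f g : W) : K :=
  \sum_(alpha : 'X_{1..n.+1 < omega.+1} | mdeg alpha == omega)
     bw_coord alpha f * bw_coord alpha g.

Lemma bw_pairingC f g : bw_pairing f g = bw_pairing g f.
Proof. by apply: eq_bigr => m _; rewrite mulrC. Qed.

Lemma bw_pairing_scalar f : scalar (bw_pairing f).
Proof.
move=> a g h; rewrite /bw_pairing mulr_sumr -big_split /=; apply: eq_bigr => m _.
by rewrite /bw_coord !linearP /=; ring.
Qed.

Lemma q_BW_pairing : @q_BW R n omega = fun f => bw_pairing f f.
Proof. by apply/funext => f; apply: eq_bigr => m _; rewrite expr2. Qed.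

(** The weights of the form cancel the multinomial coefficients of the powers of
   linear forms, which therefore reproduce evaluation. *)
Lemma bw_pairing_veronese (E : 'M[K]_n.+1) f x :
  bw_pairing f (@veronese K n omega E x) = form_at E f x.
Proof.
rewrite {2}(monomial_expansion f) (scalar_sum (form_at_scalar E x)).
apply: eq_bigr => m /eqP mE.
have XE : form_at E (insubd (0 : W) 'X_[m]) x = \prod_i xcoord E x i ^+ m i.
  by rewrite /form_at insubdK ?mevalX // -topredE /= dhomogX; apply/eqP.
have := mcoeff_linear_power (xcoord E x) mE.
rewrite XE /bw_coord /=.
set P := (\prod_i (m i)`!)%N; set c := (_ ^+ omega)@_m; set p := \prod_i _ => cE.
have PN0 : P%:R != 0 :> K.
  by rewrite pnatr_eq0 -lt0n; apply: prodn_gt0 => i; apply: fact_gt0.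
have FN0 : omega`!%:R != 0 :> K by rewrite pnatr_eq0 -lt0n fact_gt0.
set s : K := (_)%:C%C.
have s2 : s * s = omega`!%:R / P%:R.
  rewrite -rmorphM /= -expr2 sqr_sqrtr; last by rewrite divr_ge0 ?ler0n.
  by rewrite rmorphM fmorphV !rmorph_nat.
have -> : c = omega`!%:R * p / P%:R by rewrite -cE mulfK.
rewrite mulrACA -invfM s2; field.
by rewrite PN0.
Qed.

End BombieriWeyl.

Theorem corollary2p7 (R : realType) (n omega : nat)
    (XR : set (projective_space 'rV[R]_n.+1))
    (X : set (projective_space 'rV[R[i]]_n.+1))
    (A E : 'M[R]_n.+1)
    (homega : (0 < omega)%N)
    (hXR : projective_variety XR)
    (hX : X = zariski_closure (complex_points XR))
    (hAsym : A^T = A)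
    (hApos : forall v : 'rV[R]_n.+1, v != 0 -> 0 < qform A v)
    (hE : E *m A *m E^T = 1%:M) :
  RRdeg omega (complexify A) (complexify E) X =
  DD (veronese_image (complexify E) X) (@q_BW R n omega).
Proof.
have hEC : complexify E *m complexify A *m (complexify E)^T = 1%:M.
  have trE : (complexify E)^T = complexify E^T by apply/matrixP => i j; rewrite !mxE.
  by rewrite trE /complexify -!map_mxM hE map_mx1.
have [->|/set0P X0] := eqVneq X set0; first exact: rayleigh_ritz_distance_empty.
have varX : projective_variety X by rewrite hX; apply: zariski_closure_variety.
rewrite q_BW_pairing.
exact: (rayleigh_ritz_distance_nonempty homega hEC (@bw_pairingC R n omega)
  (@bw_pairing_scalar R n omega) (@bw_pairing_veronese R n omega _) varX X0).
Qed.
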